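(* Let $X$ be a first-countable compact Hausdorff space, let $\gamma=\{\gamma_1,\ldots,\gamma_N\}$ be an iterated function system on $X$, and let $\mathbb{X}\subseteq X$ be a subset. Assume: (i) $\mathbb{X}$ is dense in $X$ and completely invariant under $\gamma$; (ii) the images $\gamma_1(\mathbb{X}),\ldots,\gamma_N(\mathbb{X})$ are pairwise disjoint; (iii) the restriction $\gamma_k|_{\mathbb{X}}$ is injective for all $k=1,\ldots,N$; (iv) the maps $\gamma_1,\ldots,\gamma_N$ are (topological) embeddings; (v) there is a dense open set $U$ in $X$ such that the images $\gamma_1(U),\ldots,\gamma_N(U)$ are pairwise disjoint open sets in $X$ contained in $U$, and $\mathbb{X}\subseteq U$; (vi) $\mathbb{X}$ is comeager in $X$. Assume further: (a) $\gamma$ is essentially free; (b) the set $\gamma^n(X)$ is clopen in $X$ for all $n\in\mathbb{N}$; (c) there exists a continuous map $\sigma:\gamma(X)\to X$ such that $\sigma\circ\gamma_k=\mathrm{id}_X$ for all $k\in\{1,\ldots,N\}$. Let $\hat\rho=(\hat\rho_A,\hat\rho_E)$, $C^*(\hat\rho)$ and $\hat D\subseteq C^*(\hat\rho)$ be as constructed in the context. Then the following are equivalent: (1) $\gamma$ satisfies the graph separation condition, i.e. for all distinct indices $j$ and $k$ and all points $x\in X$ one has $\gamma_j(x)\neq\gamma_k(x)$; (2) $\hat D$ is a Cartan subalgebra of $C^*(\hat\rho)$.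
   Context: An iterated function system on $X$ is a finite family $\gamma=\{\gamma_1,\ldots,\gamma_N\}$ (repetitions allowed) of continuous maps $X\to X$. Put $I=\{1,\ldots,N\}$. For $\boldsymbol k=(k_n,\ldots,k_1)\in I^n$ put $\gamma_{\boldsymbol k}=\gamma_{k_n}\circ\cdots\circ\gamma_{k_1}$ (the identity if $n=0$). For $S\subseteq X$ put $\gamma(S)=\bigcup_{k}\gamma_k(S)$, $\gamma^0(S)=S$, $\gamma^{n+1}(S)=\gamma(\gamma^n(S))$. $S$ is completely invariant under $\gamma$ if $\gamma_k(S)\subseteq S$ and $\gamma_k^{-1}(S)\subseteq S$ for all $k$. $\gamma$ is essentially free if $\{x\in X:\gamma_{\boldsymbol k}(x)=\gamma_{\boldsymbol l}(x)\}$ is nowhere dense for all finite index sequences $\boldsymbol k\neq\boldsymbol l$ (of possibly different lengths, possibly empty). Let $M_{\mathbb{X}}$ be the C*-algebra of bounded operators on $\ell^2(\mathbb{X})$ (orthonormal basis $(e_x)_{x\in\mathbb{X}}$, inner products linear in the second variable) and $D_{\mathbb{X}}\subseteq M_{\mathbb{X}}$ the set of diagonal operators, i.e. those $\alpha$ with $\langle e_x|\alpha e_y\rangle=0$ for $x\ne y$. Let $G=\bigcup_{k}\{(\gamma_k(y),y):y\in X\}\subseteq X\times X$ be the graph of $\gamma$, $A=C(X)$, $E=C(G)$. Define $\rho_A:A\to M_{\mathbb{X}}$ and $\rho_E:E\to M_{\mathbb{X}}$ by $\rho_A(a)e_x=a(x)e_x$ and $\rho_E(f)e_y=\sum_{k=1}^N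 f(\gamma_k(y),y)\,e_{\gamma_k(y)}$. Let $\upsilon_n$ $(n\in\mathbb{Z})$ be the unitary $e_k\mapsto e_{n+k}$ on $\ell^2(\mathbb{Z})$ and $C^*(\mathbb{Z})$ the C*-algebra generated by the $\upsilon_n$. Define $\hat\rho_A(a)=\rho_A(a)\otimes\upsilon_0$, $\hat\rho_E(f)=\rho_E(f)\otimes\upsilon_1$ in $M_{\mathbb{X}}\otimes C^*(\mathbb{Z})$, and let $C^*(\hat\rho)$ be the C*-subalgebra generated by $\hat\rho_A(A)\cup\hat\rho_E(E)$. For $n\in\mathbb{N}_0$ a $\gamma$-chain of length $n$ is a tuple $(x_n,\ldots,x_0)\in X^{n+1}$ such that for each $i$ there is $k\in I$ with $x_i=\gamma_k(x_{i-1})$; for $\boldsymbol k=(k_n,\ldots,k_1)\in I^n$ and $x\in X$ let $\boldsymbol\gamma_{\boldsymbol k}(x)=(\gamma_{k_n,\ldots,k_1}(x),\ldots,\gamma_{k_1}(x),x)$. Let $X_{m,n}$ be the compact space of pairs $(\boldsymbol x,\boldsymbol y)$ of $\gamma$-chains of lengths $m$ and $n$ with the same last entry $x_0=y_0$. Define a linear map $\rho_{m,n}:C(X_{m,n})\to M_{\mathbb{X}}$ as follows: for $y\in\gamma^n(\mathbb{X})$ there are unique $\boldsymbol k\in I^n$, $x\in\mathbb{X}$ with $y=\gamma_{\boldsymbol k}(x)$, and $\rho_{m,n}(f)e_y=\sum_{\boldsymbol j\in I^m}f(\boldsymbol\gamma_{\boldsymbol j}(x),\boldsymbol\gamma_{\boldsymbol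 k}(x))\,e_{\gamma_{\boldsymbol j}(x)}$; for $y\in\mathbb{X}\setminus\gamma^n(\mathbb{X})$, $\rho_{m,n}(f)e_y=0$. Let $E_{m,n}$ be the range of $\rho_{m,n}$. For $k\in\mathbb{Z}$ let $B_k$ be the norm-closed linear span of $\bigcup_{m-n=k}E_{m,n}$ ($m,n\in\mathbb{N}_0$), and $D_k=B_k\cap D_{\mathbb{X}}$. Let $\hat D=\bigoplus_{k\in\mathbb{Z}}D_k\otimes\upsilon_k$, meaning the norm-closed linear span of the subspaces $D_k\otimes\upsilon_k=\{\alpha\otimes\upsilon_k:\alpha\in D_k\}$; it is a closed commutative $*$-subalgebra of $C^*(\hat\rho)$ containing $\hat\rho_A(A)$. An abelian C*-subalgebra $P_0$ of a C*-algebra $Q$ is a Cartan subalgebra if (1) $P_0$ contains an approximate unit of $Q$; (2) $P_0$ is maximal abelian; (3) $P_0$ is regular, i.e. the normalizer $\{b\in Q: bP_0b^*\subseteq P_0,\ b^*P_0b\subseteq P_0\}$ generates $Q$ as a C*-algebra; (4) there is a faithful conditional expectation of $Q$ onto $P_0$. *)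

(* Defs.v *)
From HB Require Import structures.
From mathcomp Require Import all_boot all_order all_algebra.
From mathcomp Require Import complex finmap ring lra.
From mathcomp Require Import all_classical all_reals all_analysis.
From mathcomp.analysis Require showcase.summability.

Set Implicit Arguments.
Unset Strict Implicit.
Unset Printing Implicit Defensive.
Import Order.TTheory GRing.Theory Num.Theory numFieldNormedType.Exports.
Local Open Scope classical_set_scope.
Local Open Scope ring_scope.

(* R[i], typed as a numClosedFieldType so that it inherits the topology and
   the normed-module structure of MathComp-Analysis. *)
Definition Cx (R : realType) : numClosedFieldType := R[i].

Section Ell2.
Variable R : realType.
Local Notation C := (Cx R).

Definition sqmod (z : C) : R := complex.Re z ^+ 2 + complex.Im z ^+ 2.

Lemma sqmod_ge0 z : 0 <= sqmod z.
Proof. by rewrite /sqmod addr_ge0 // sqr_ge0. Qed.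

Lemma sqmodM x y : sqmod (x * y) = sqmod x * sqmod y.
Proof. by case: x y => [a b] [c d]; rewrite /sqmod /=; ring. Qed.

Lemma sqmodD x y : sqmod (x + y) <= 2 * (sqmod x + sqmod y).
Proof.
case: x y => [a b] [c d]; rewrite /sqmod /=.
by have := sqr_ge0 (a - c); have := sqr_ge0 (b - d); nra.
Qed.

Section SquareSummable.
Variable I : choiceType.

Definition sqsum (u : I -> C) : \bar R :=
  (\esum_(i in setT) (sqmod (u i))%:E)%E.

Definition square_summable : {pred I -> C} :=
  [pred u | (sqsum u < +oo)%E].

Lemma esum_leP (a : I -> R) (M : R) :
  (forall X : {fset I}, \sum_(i <- X) a i <= M) <->
  (\esum_(i in setT) (a i)%:E <= M%:E)%E.
Proof.
split=> [aM|aM X].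
  apply: ge_ereal_sup => /= _ [X [finX _]] <-.
  by rewrite fsbig_finite //= sumEFin lee_fin aM.
rewrite -lee_fin -sumEFin; apply: le_trans aM.
apply: esum_ge; exists [set` X]; first by split.
by rewrite fsbig_finite //= set_fsetK.
Qed.

Lemma square_summableP (u : I -> C) :
  u \in square_summable <->
  exists M : R, forall X : {fset I}, \sum_(i <- X) sqmod (u i) <= M.
Proof.
rewrite inE /=; split=> [uoo|[M uM]]; last first.
  apply: (@le_lt_trans _ _ M%:E); last exact: ltry.
  exact/esum_leP.
exists (fine (sqsum u)); apply/esum_leP; rewrite fineK // ge0_fin_numE //.
by apply: esum_ge0 => i _; rewrite lee_fin sqmod_ge0.
Qed.

Fact square_summable_submod_closed : submod_closed square_summable.
Proof.
split=> [|a u v /square_summableP[M uM] /square_summableP[N vN]].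
  apply/square_summableP; exists 0 => X.
  by rewrite big1 // => i _; rewrite /sqmod /= expr0n addr0.
apply/square_summableP; exists (2 * (sqmod a * M + N)) => X.
apply: (@le_trans _ _ (\sum_(i <- X) 2 * (sqmod a * sqmod (u i) + sqmod (v i)))).
  apply: ler_sum => i _; apply: le_trans (sqmodD _ _) _.
  by rewrite sqmodM.
rewrite -mulr_sumr ler_wpM2l // big_split /= lerD ?vN //.
by rewrite -mulr_sumr ler_wpM2l ?uM ?sqmod_ge0.
Qed.

HB.instance Definition _ := GRing.isSubmodClosed.Build C (I -> C) square_summable
  square_summable_submod_closed.

Record ell2 := Ell2 { ell2_fun :> I -> C; _ : ell2_fun \in square_summable }.

HB.instance Definition _ := [isSub for ell2_fun].
HB.instance Definition _ := [Choice of ell2 by <:].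
HB.instance Definition _ := [SubChoice_isSubLmodule of ell2 by <:].

(* The sum over I is the limit of the finite partial sums along the directed set
   of finite subsets of I. *)
Definition ip (u v : ell2) : C :=
  summability.sum (fun i : I => ((u i)^* * v i : C)).

Definition hnorm (u : ell2) : R := Num.sqrt (fine (sqsum u)).

Fact delta_subproof (i : I) : (fun j => (j == i)%:R : C) \in square_summable.
Proof.
apply/square_summableP; exists 1 => X.
rewrite (eq_bigr (fun j => (j == i)%:R)) => [|j _]; last first.
  by rewrite /sqmod; case: eqP => _ /=; rewrite ?expr0n ?expr1n addr0.
have [iX|iX] := boolP (i \in X).
  rewrite (big_fsetD1 i) //= eqxx big_seq big1 ?addr0 // => j.
  by rewrite !inE => /andP[/negPf ->].
rewrite big_seq big1 // => j jX.
by case: eqP iX => // <-; rewrite jX.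
Qed.

Definition delta (i : I) : ell2 := Ell2 (delta_subproof i).
End SquareSummable.

Fact tens_subproof (I J : choiceType) (u : ell2 I) (v : ell2 J) :
  (fun p => u p.1 * v p.2 : C) \in @square_summable (I * J)%type.
Proof.
have /square_summableP[M uM] := valP u.
have /square_summableP[N vN] := valP v.
have N_ge0 : 0 <= N by have := vN fset0; rewrite big_seq_fset0.
apply/square_summableP; exists (M * N); apply/esum_leP.
apply: (@le_trans _ _
  (\esum_(i in setT) \esum_(j in setT) (sqmod (u i) * sqmod (v j))%:E)%E).
  rewrite esum_esum => [|i j _ _]; last by rewrite lee_fin mulr_ge0 ?sqmod_ge0.
  rewrite (_ : setT `*`` _ = setT); last by apply/seteqP; split.
  by apply: le_esum => -[i j] _ /=; rewrite sqmodM.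
apply: (@le_trans _ _ (\esum_(i in setT) (sqmod (u i) * N)%:E)%E).
  apply: le_esum => i _; apply/esum_leP => X.
  by rewrite -mulr_sumr ler_wpM2l ?sqmod_ge0.
by apply/esum_leP => X; rewrite -mulr_suml ler_wpM2r.
Qed.

Definition tens (I J : choiceType) (u : ell2 I) (v : ell2 J) : ell2 (I * J)%type :=
  Ell2 (tens_subproof u v).

Fact shift_subproof (n : int) (v : ell2 int) :
  (fun k => v (k - n)) \in @square_summable int.
Proof.
have /square_summableP[M vM] := valP v; apply/square_summableP; exists M => X.
have := vM [fset k - n | k in X]%fset.
by rewrite big_imfset //= => i j _ _ /addIr.
Qed.

Definition shift (n : int) (v : ell2 int) : ell2 int := Ell2 (shift_subproof n v).

End Ell2.

Section Operators.
Variables (R : realType) (I : choiceType).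
Local Notation H := (ell2 R I).

Definition bounded_op (T : H -> H) : Prop :=
  linear T /\ exists M : R, forall u, hnorm (T u) <= M * hnorm u.

Definition opnorm (T : H -> H) : R :=
  sup [set hnorm (T u) | u in [set u | hnorm u <= 1]].

(* The bounded operator satisfying P, when P determines one; the value 0 is a
   default for the case where no bounded operator satisfies P. *)
Definition the_op (P : (H -> H) -> Prop) : H -> H :=
  xget 0 [set T | bounded_op T /\ P T].

Definition adj (T : H -> H) : H -> H :=
  the_op (fun S => forall u v, ip (T u) v = ip u (S v)).

Definition positive_op (T : H -> H) : Prop := forall u, 0 <= ip u (T u).

Definition norm_closed (A : set (H -> H)) : Prop :=
  forall T, bounded_op T ->
    (forall e : R, 0 < e -> exists2 S, A S & opnorm (T - S) < e) -> A T.

Definition closed_subspace (A : set (H -> H)) : Prop :=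
  [/\ A `<=` bounded_op,
      A 0,
      forall (a : Cx R) S T, A S -> A T -> A (a *: S + T)
    & norm_closed A].

Definition closed_span (A : set (H -> H)) : set (H -> H) :=
  smallest closed_subspace A.

Definition cstar_subalgebra (A : set (H -> H)) : Prop :=
  [/\ closed_subspace A,
      forall S T, A S -> A T -> A (S \o T)
    & forall T, A T -> A (adj T)].

Definition cstar_generated (A : set (H -> H)) : set (H -> H) :=
  smallest cstar_subalgebra A.

Definition abelian_op (A : set (H -> H)) : Prop :=
  forall S T, A S -> A T -> S \o T = T \o S.

Definition approximate_unit_in (Q P : set (H -> H)) : Prop :=
  exists (L : Type) (le : L -> L -> Prop) (e : L -> H -> H),
    [/\ [/\ inhabited L,
            forall i, le i i,
            forall i j k, le i j -> le j k -> le i k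
          & forall i j, exists2 k, le i k & le j k],
        forall i, [/\ P (e i), positive_op (e i) & opnorm (e i) <= 1],
        forall i j, le i j -> positive_op (e j - e i)
      & forall q (d : R), Q q -> 0 < d -> exists i, forall j, le i j ->
          opnorm (e j \o q - q) < d /\ opnorm (q \o e j - q) < d].

Definition maximal_abelian (Q P : set (H -> H)) : Prop :=
  abelian_op P /\
  forall P', cstar_subalgebra P' -> abelian_op P' -> P `<=` P' -> P' `<=` Q ->
    P' = P.

Definition normalizer (Q P : set (H -> H)) : set (H -> H) :=
  [set b | [/\ Q b,
     forall p, P p -> P (b \o p \o adj b)
   & forall p, P p -> P (adj b \o p \o b)]].

(* Complete positivity is not listed: it follows from positivity together with
   the bimodule property. *)
Definition faithful_conditional_expectation (Q P : set (H -> H))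
    (F : (H -> H) -> (H -> H)) : Prop :=
  [/\ [/\ forall q, Q q -> P (F q),
          forall p, P p -> F p = p
        & forall (a : Cx R) q q', Q q -> Q q' -> F (a *: q + q') = a *: F q + F q'],
      forall q, Q q -> opnorm (F q) <= opnorm q,
      forall q, Q q -> positive_op q -> positive_op (F q),
      forall p q p', P p -> Q q -> P p' -> F (p \o q \o p') = p \o F q \o p'
    & forall q, Q q -> F (adj q \o q) = 0 -> q = 0].

Definition cartan_subalgebra (Q P : set (H -> H)) : Prop :=
  [/\ [/\ cstar_subalgebra P, abelian_op P & P `<=` Q],
      approximate_unit_in Q P,
      maximal_abelian Q P,
      cstar_generated (normalizer Q P) = Q
    & exists F, faithful_conditional_expectation Q P F].

End Operators.

(* The spatial tensor product: l^2(I) (x) l^2(J) is realised as l^2(I * J).  For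
   operators T generating a nuclear algebra such as C*(Z) this is unambiguous. *)
Definition op_tens (R : realType) (I J : choiceType)
    (S : ell2 R I -> ell2 R I) (T : ell2 R J -> ell2 R J) :
    ell2 R (I * J)%type -> ell2 R (I * J)%type :=
  the_op (fun W => forall u v, W (tens u v) = tens (S u) (T v)).

Section Topology.
Variable X : topologicalType.

Definition first_countable : Prop :=
  forall x : X, exists2 U : nat -> set X, (forall n, nbhs x (U n)) &
    forall V, nbhs x V -> exists n, U n `<=` V.

Definition nowhere_dense (A : set X) : Prop := interior (closure A) = set0.

Definition meager (A : set X) : Prop :=
  exists2 F : nat -> set X, (forall n, nowhere_dense (F n)) &
    A = \bigcup_n F n.

Definition comeager (A : set X) : Prop := meager (~` A).

Definition embedding (f : X -> X) : Prop :=
  [/\ continuous f, injective f &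
      forall O, open O -> exists2 V, open V & f @` O = range f `&` V].

End Topology.

Section IFS.
Variables (X : topologicalType) (N : nat) (g : 'I_N -> X -> X).

(* A word (k_n, ..., k_1) is the sequence with head k_n and last letter k_1. *)
Definition word_map (k : seq 'I_N) (x : X) : X := foldr g x k.

Definition ifs_image (S : set X) : set X := \bigcup_k (g k @` S).

Definition ifs_iter (n : nat) (S : set X) : set X := iter n ifs_image S.

Definition completely_invariant (S : set X) : Prop :=
  forall k, g k @` S `<=` S /\ g k @^-1` S `<=` S.

Definition essentially_free : Prop :=
  forall k l : seq 'I_N, k <> l ->
    nowhere_dense [set x | word_map k x = word_map l x].

Definition graph_separation : Prop :=
  forall (j k : 'I_N) (x : X), j <> k -> g j x <> g k x.

Definition ifs_graph : set (X * X) :=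
  \bigcup_k range (fun y => (g k y, y)).

(* A chain (x_n, ..., x_0) is the function i |-> x_i. *)
Definition is_chain (n : nat) (c : {ptws 'I_n.+1 -> X}) : Prop :=
  forall i : 'I_n, exists k : 'I_N,
    c (lift ord0 i) = g k (c (widen_ord (leqnSn n) i)).

(* The suffix of length i of (k_n, ..., k_1) is (k_i, ..., k_1). *)
Definition word_chain (n : nat) (k : n.-tuple 'I_N) (x : X) :
    {ptws 'I_n.+1 -> X} :=
  fun i => word_map (drop (n - i) k) x.

Definition chain_pairs (m n : nat) :
    set ({ptws 'I_m.+1 -> X} * {ptws 'I_n.+1 -> X})%type :=
  [set p | [/\ is_chain p.1, is_chain p.2 & p.1 ord0 = p.2 ord0]].

End IFS.

Arguments chain_pairs {X N} g m n _.

Section Rho.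
Variables (R : realType) (X : topologicalType) (N : nat) (g : 'I_N -> X -> X).
Variable XX : set X.
Local Notation C := (Cx R).
Local Notation H := (ell2 R XX).

(* e_x for x in XX; the value 0 outside XX is never used when g maps XX to XX. *)
Definition evec (x : X) : H := oapp (@delta R XX) 0 (insub x).

Definition rhoA (a : X -> C) : H -> H :=
  the_op (fun T => forall x, XX x -> T (evec x) = a x *: evec x).

Definition rhoE (f : X * X -> C) : H -> H :=
  the_op (fun T => forall y, XX y ->
    T (evec y) = \sum_(k < N) f (g k y, y) *: evec (g k y)).

Definition rho (m n : nat)
    (f : ({ptws 'I_m.+1 -> X} * {ptws 'I_n.+1 -> X})%type -> C) : H -> H :=
  the_op (fun T =>
    (forall (k : n.-tuple 'I_N) x, XX x ->
       T (evec (word_map g k x)) =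
       \sum_(j : m.-tuple 'I_N)
         f (word_chain g j x, word_chain g k x) *: evec (word_map g j x)) /\
    (forall y, XX y -> ~ ifs_iter g n XX y -> T (evec y) = 0)).

(* Continuous functions on a subset K are represented by functions on the whole
   space whose restriction to K is continuous. *)
Definition Emn (m n : nat) : set (H -> H) :=
  [set rho f | f in [set f : _ -> C | {within chain_pairs g m n, continuous f}]].

Definition Bk (k : int) : set (H -> H) :=
  closed_span [set T | exists m n : nat, m%:Z - n%:Z = k /\ Emn m n T].

Definition diagonal_op : set (H -> H) :=
  [set T | bounded_op T /\
     forall x y : XX, x != y -> ip (delta R x) (T (delta R y)) = 0].

Definition Dk (k : int) : set (H -> H) := Bk k `&` diagonal_op.

Local Notation Hhat := (ell2 R (XX * int)%type).

Definition hatrhoA (a : X -> C) : Hhat -> Hhat := op_tens (rhoA a) (@shift R 0).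

Definition hatrhoE (f : X * X -> C) : Hhat -> Hhat :=
  op_tens (rhoE f) (@shift R 1).

Definition cstar_hatrho : set (Hhat -> Hhat) :=
  cstar_generated
    ([set hatrhoA a | a in [set a : X -> C | continuous a]] `|`
     [set hatrhoE f | f in [set f : X * X -> C |
                              {within ifs_graph g, continuous f}]]).

Definition hatD : set (Hhat -> Hhat) :=
  closed_span [set T | exists k S, Dk k S /\ T = op_tens S (@shift R k)].

End Rho.

Arguments cstar_hatrho R {X N} g XX _.
Arguments hatD R {X N} g XX _.

(* Main.v *)
(* Write sigma for the common left inverse of the branches, V for the operator
   rho_E(1) (x) upsilon_1 and A for the image of C(X).  Since A and V
   generate C*(rho), and since V* a V = L(a) and V a = (a o sigma) V with L(a) and a o sigma again
   continuous (the latter, cut off to gamma(X), because gamma(X) is clopen), the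
   algebra C*(rho) is the closed span of the monomials a V^m V*^n b.  The matrix
   entries of such a monomial along a pair of words (j, l) depend continuously on
   the base point, so essential freeness forces every element of C*(rho) that is
   diagonal on l^2(XX) to have degree 0 and a continuous diagonal.  Hence hat D is
   the image of C(X), it is maximal abelian, and taking diagonals is a faithful
   conditional expectation, whether or not the graph is separated.

   The condition therefore concerns regularity only.  If the graph is separated, the
   images gamma_k(X) are clopen, and cutting V down to them gives normalizers which
   generate C*(rho).  If gamma_j(x0) = gamma_k(x0) with j <> k, the entries of any
   b in C*(rho) along j and along k have the same limit at x0; for a normalizer the
   product of these entries vanishes near x0, hence both limits are 0.  This property
   passes to the closed span of the normalizers, but fails for V. *)

From HB Require Import structures.
Require Import Defs.
From mathcomp Require Import all_boot all_order all_algebra.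
From mathcomp Require Import complex finmap ring lra zify.
From mathcomp Require Import all_classical all_reals all_analysis.
From mathcomp.analysis Require showcase.summability.
Import Order.TTheory GRing.Theory Num.Theory.
Import numFieldNormedType.Exports.

Set Implicit Arguments.
Unset Strict Implicit.
Unset Printing Implicit Defensive.

Local Open Scope classical_set_scope.
Local Open Scope ring_scope.

(** * Modulus of complex numbers *)

(** All basis vectors [delta R (x, r)], r an integer, lie over the same point x, so C(X) cannot see
    entries between different degrees over one point. This is the obstacle in both implications, and
    essential freeness removes it: once to show that operators diagonal over [XX] are diagonal
    outright, and once to show that a row of a normalizer meets a fibre essentially in a single
    degree. Elements of the algebra are norm limits for which no formula is available. What is known
    about their entries is therefore phrased as conditions stable under linear combinations and norm
    limits, and tested on simple operators. Products are taken only among monomials and among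
    normalizers, both stable under composition and adjoints, so the conditions themselves have to be
    closed and linear only. The representation and the tensor products are specified by their values
    on certain vectors. Each is first built as a bounded operator and identified by uniqueness; only
    then can its entries be computed. *)

Section Modulus.
Variable R : realType.
Local Notation C := (Cx R).
Implicit Types z w : C.

(* [`|z|] lives in [Cx R]; [absC z] is the same number in [R]. *)
Definition absC z : R := Num.sqrt (sqmod z).

Definition toC (r : R) : C := (r +i* 0)%C.

Lemma norm_absC z : `|z| = toC (absC z).
Proof. by rewrite /absC /sqmod; exact: (@normc_def R z). Qed.

Lemma absC_ge0 z : 0 <= absC z.
Proof. exact: sqrtr_ge0. Qed.

Lemma sqr_absC z : absC z ^+ 2 = sqmod z.
Proof. by rewrite sqr_sqrtr // sqmod_ge0. Qed.

Lemma toC_le (a b : R) : (toC a <= toC b) = (a <= b).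
Proof. exact: lecR. Qed.

Lemma toC_lt (a b : R) : (toC a < toC b) = (a < b).
Proof. exact: ltcR. Qed.

Lemma toCD (a b : R) : toC (a + b) = toC a + toC b.
Proof. exact: (rmorphD (real_complex R)). Qed.

Lemma toCM (a b : R) : toC (a * b) = toC a * toC b.
Proof. exact: (rmorphM (real_complex R)). Qed.

Lemma toCN (a : R) : toC (- a) = - toC a.
Proof. exact: (rmorphN (real_complex R)). Qed.

Lemma toC0 : toC 0 = 0. Proof. by []. Qed.
Lemma toC1 : toC 1 = 1. Proof. by []. Qed.

Lemma toC_sum (I : Type) (s : seq I) (f : I -> R) :
  toC (\sum_(i <- s) f i) = \sum_(i <- s) toC (f i).
Proof. exact: (rmorph_sum (real_complex R)). Qed.

Lemma toC_inj : injective toC.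
Proof. exact: complexI. Qed.

Lemma absCM z w : absC (z * w) = absC z * absC w.
Proof. by rewrite /absC sqmodM sqrtrM // sqmod_ge0. Qed.

Lemma absCD z w : absC (z + w) <= absC z + absC w.
Proof. by rewrite -toC_le toCD -!norm_absC ler_normD. Qed.

Lemma absCN z : absC (- z) = absC z.
Proof. by apply: toC_inj; rewrite -!norm_absC normrN. Qed.

Lemma absCB z w : absC (z - w) <= absC z + absC w.
Proof. by rewrite -(absCN w) absCD. Qed.

Lemma absC_dist z w : absC (z - w) = absC (w - z).
Proof. by rewrite -absCN opprB. Qed.

Lemma absC_toC (r : R) : absC (toC r) = `|r|.
Proof. by rewrite /absC /sqmod /= expr0n addr0 sqrtr_sqr. Qed.

Lemma absC0 : absC 0 = 0. Proof. by rewrite -toC0 absC_toC normr0. Qed.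
Lemma absC1 : absC 1 = 1. Proof. by rewrite -toC1 absC_toC normr1. Qed.

Lemma absC_eq0 z : absC z = 0 -> z = 0.
Proof. by move=> z0; apply/eqP; rewrite -normr_eq0 norm_absC z0. Qed.

(** Polarization, termwise: it reduces the convergence of the series [ip] to that of four series of
    squared moduli. *)
Lemma conjC_mul z w : z^* * w =
  (toC (sqmod (z + w)) - toC (sqmod (z - w))) * toC 4^-1 +
  'i * ((toC (sqmod ('i * z + w)) - toC (sqmod ('i * z - w))) * toC 4^-1).
Proof.
rewrite -!toCN -!toCD -!toCM -complexiE; case: z w => [a b] [c d].
apply/eqP; rewrite eq_complex /= /sqmod /=; apply/andP; split; apply/eqP; by field.
Qed.

Lemma sqmod_conj z : toC (sqmod z) = z^* * z.
Proof. by rewrite mulrC -normCK norm_absC -sqr_absC expr2 toCM -expr2. Qed.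

Lemma absC_conj z : absC z^* = absC z.
Proof. by apply: toC_inj; rewrite -!norm_absC norm_conjC. Qed.

Lemma sqmod0 : sqmod (0 : C) = 0.
Proof. by rewrite -sqr_absC absC0 expr0n. Qed.

End Modulus.

(** * The Hilbert space of square-summable functions *)

Arguments ell2_fun : simpl never.

Section InnerProduct.
Variables (R : realType) (I : choiceType).
Local Notation C := (Cx R).
Local Notation H := (ell2 R I).
Implicit Types u v w : H.

Lemma ell2P u v : (forall i, u i = v i) -> u = v.
Proof. by move=> uv; apply: val_inj; apply/funext. Qed.

Lemma ell2D u v i : (u + v) i = u i + v i. Proof. by []. Qed.
Lemma ell2Z (a : C) u i : (a *: u) i = a * u i. Proof. by []. Qed.
Lemma ell2B u v i : (u - v) i = u i - v i. Proof. by []. Qed.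
Lemma ell2_0 i : (0 : H) i = 0. Proof. by []. Qed.

Lemma ell2_sum (J : Type) (s : seq J) (F : J -> H) i :
  (\sum_(j <- s) F j) i = \sum_(j <- s) F j i.
Proof. by elim/big_rec2: _ => // j x y _ <-. Qed.

Lemma deltaE (i j : I) : delta R i j = (j == i)%:R. Proof. by []. Qed.

Lemma delta_eq (i : I) : delta R i i = 1. Proof. by rewrite deltaE eqxx. Qed.
Lemma delta_neq (i j : I) : j != i -> delta R i j = 0.
Proof. by rewrite deltaE => /negPf ->. Qed.

Lemma sqsumE u : sqsum u = (hnorm u ^+ 2)%:E.
Proof.
have /square_summableP[M uM] := valP u.
have sM : (sqsum u <= M%:E)%E by apply/esum_leP.
have s0 : (0 <= sqsum u)%E by apply: esum_ge0 => i _; rewrite lee_fin sqmod_ge0.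
rewrite /hnorm sqr_sqrtr ?fine_ge0 // fineK // ge0_fin_numE //.
exact: le_lt_trans sM (ltry _).
Qed.

Lemma hnorm_ge0 u : 0 <= hnorm u. Proof. exact: sqrtr_ge0. Qed.

Lemma hnorm_sqr_leP u (M : R) :
  (forall X : {fset I}, \sum_(i <- X) sqmod (u i) <= M) <-> hnorm u ^+ 2 <= M.
Proof. by rewrite -lee_fin -sqsumE; exact: esum_leP. Qed.

Lemma sum_le_hnorm u (X : {fset I}) : \sum_(i <- X) sqmod (u i) <= hnorm u ^+ 2.
Proof. by move: X; apply/hnorm_sqr_leP. Qed.

Lemma hnorm_leP u (M : R) : 0 <= M ->
  (forall X : {fset I}, \sum_(i <- X) sqmod (u i) <= M ^+ 2) <-> hnorm u <= M.
Proof.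
move=> M0; rewrite hnorm_sqr_leP; split.
  by rewrite ler_sqr ?nnegrE ?hnorm_ge0.
by rewrite ler_sqr ?nnegrE ?hnorm_ge0.
Qed.

Lemma absC_le_hnorm u i : absC (u i) <= hnorm u.
Proof.
rewrite -ler_sqr ?nnegrE ?hnorm_ge0 ?absC_ge0 // sqr_absC.
by have := sum_le_hnorm u [fset i]%fset; rewrite big_seq_fset1.
Qed.

Lemma hnorm_approx u (e : R) : 0 < e ->
  exists X : {fset I}, hnorm u ^+ 2 - e < \sum_(i <- X) sqmod (u i).
Proof.
move=> e0; apply: contrapT => /forallNP uX.
have : hnorm u ^+ 2 <= hnorm u ^+ 2 - e.
  by apply/hnorm_sqr_leP => X; rewrite leNgt; apply/negP.
by rewrite lerBrDr gerDl leNgt e0.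
Qed.

Lemma sum_sqmod_sub u (X Y : {fset I}) : (X `<=` Y)%fset ->
  \sum_(i <- X) sqmod (u i) <= \sum_(i <- Y) sqmod (u i).
Proof.
move=> XY; rewrite (big_fsetID _ (mem X) Y) /= -[leLHS]addr0 lerD //; last first.
  by apply: sumr_ge0 => i _; exact: sqmod_ge0.
rewrite le_eqVlt; apply/orP; left; apply/eqP; apply: eq_fbigl => i.
rewrite !inE; apply/idP/andP => [iX|[]//]; split=> //.
exact: (fsubsetP XY).
Qed.

Import summability.
Existing Instance totally_filter.

Lemma cvg_totally_ext (f g : {fset I} -> C) (l : C) :
  (forall X, f X = g X) -> g @ totally --> l -> f @ totally --> l.
Proof. by move=> /funext ->. Qed.

Lemma sqmod_cvg u :
  partial_sum (fun i => toC (sqmod (u i))) @ totally --> toC (hnorm u ^+ 2).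
Proof.
apply/cvgrPdist_lt => e e0.
(* In the order of [Cx R], comparable numbers have equal imaginary parts, so a positive e is
   real. *)
have [e' e'0 ->] : exists2 e', 0 < e' & e = toC e'.
  exists (complex.Re e); move: e0; rewrite ltcE => /andP[/eqP /= im0 //].
  by move: im0; case: (e) => a b /= ->.
have [X uX] := hnorm_approx u e'0.
exists X => //= Y XY.
rewrite /partial_sum -(big_seq_fsetE _ _ xpredT (fun i => toC (sqmod (u i)))) -toC_sum.
rewrite -toCN -toCD norm_absC absC_toC toC_lt ger0_norm.
  by have := sum_sqmod_sub u XY; lra.
by rewrite subr_ge0 sum_le_hnorm.
Qed.

(** [ip] is a [lim] by definition, so it is enough that some limit exists; by [conjC_mul] it is a
    combination of the squared norms of u + v, u - v, iu + v and iu - v. *)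
Lemma ip_cvg u v :
  partial_sum (fun i => (u i)^* * v i : C) @ totally --> ip u v.
Proof.
suff [l ul] : exists l : C, partial_sum (fun i => (u i)^* * v i : C) @ totally --> l.
  rewrite /ip /summability.sum.
  by rewrite (cvg_lim (@norm_hausdorff _ C) ul).
have cD := @sqmod_cvg (u + v); have cB := @sqmod_cvg (u - v).
have ciD := @sqmod_cvg ('i *: u + v); have ciB := @sqmod_cvg ('i *: u - v).
pose f4 := toC (4^-1) : C.
eexists; apply: cvg_totally_ext; last exact: (cvgD (cvgM (cvgB cD cB) (cvg_cst f4))
  (cvgM (cvg_cst ('i : C)) (cvgM (cvgB ciD ciB) (cvg_cst f4)))).
move=> X; rewrite /partial_sum /GRing.mul_fun !fctE /= -!sumrB !mulr_suml mulr_sumr -big_split /=.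
by apply: eq_bigr => i _; rewrite conjC_mul.
Qed.

Lemma ip_unique u v (l : C) :
  partial_sum (fun i => (u i)^* * v i : C) @ totally --> l -> ip u v = l.
Proof.
move=> ul; rewrite /ip /summability.sum.
exact: (cvg_lim (@norm_hausdorff _ C) ul).
Qed.

Lemma ip_linearr u (a : C) v w : ip u (a *: v + w) = a * ip u v + ip u w.
Proof.
apply: ip_unique.
apply: cvg_totally_ext; last exact: (cvgD (cvgM (cvg_cst a) (@ip_cvg u v)) (@ip_cvg u w)).
move=> X; rewrite /partial_sum /GRing.mul_fun !fctE /= mulr_sumr -big_split /=.
apply: eq_bigr => i _; transitivity ((u (fsval i))^* * (a * v (fsval i) + w (fsval i)) : C); [by []|ring].
Qed.

Lemma ip_linearl u (a : C) v w : ip (a *: v + w) u = a^* * ip v u + ip w u.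
Proof.
apply: ip_unique.
apply: cvg_totally_ext; last exact: (cvgD (cvgM (cvg_cst a^*) (@ip_cvg v u)) (@ip_cvg w u)).
move=> X; rewrite /partial_sum /GRing.mul_fun !fctE /= mulr_sumr -big_split /=.
apply: eq_bigr => i _.
transitivity ((a * v (fsval i) + w (fsval i))^* * u (fsval i) : C); first by [].
by rewrite rmorphD rmorphM; ring.
Qed.

Lemma ip_ext u v u' v' : (forall i, (u i)^* * v i = (u' i)^* * v' i) ->
  ip u v = ip u' v'.
Proof.
move=> E; rewrite /ip; congr summability.sum.
by apply/funext.
Qed.

Lemma ip_hnorm u : ip u u = toC (hnorm u ^+ 2).
Proof.
apply: ip_unique; apply: cvg_totally_ext (@sqmod_cvg u) => X.
by apply: eq_bigr => i _; rewrite sqmod_conj.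
Qed.

Lemma ip0r u : ip u 0 = 0.
Proof. by have := ip_linearr u (-1) u u; rewrite scaleN1r addNr mulN1r addNr. Qed.
Lemma ip0l u : ip 0 u = 0.
Proof. by have := ip_linearl u (-1) u u; rewrite scaleN1r addNr rmorphN1 mulN1r addNr. Qed.
Lemma ipDr u v w : ip u (v + w) = ip u v + ip u w.
Proof. by have := ip_linearr u 1 v w; rewrite scale1r mul1r. Qed.
Lemma ipDl u v w : ip (v + w) u = ip v u + ip w u.
Proof. by have := ip_linearl u 1 v w; rewrite scale1r rmorph1 mul1r. Qed.
Lemma ipZr u (a : C) v : ip u (a *: v) = a * ip u v.
Proof. by have := ip_linearr u a v 0; rewrite ip0r !addr0. Qed.
Lemma ipZl u (a : C) v : ip (a *: v) u = a^* * ip v u.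
Proof. by have := ip_linearl u a v 0; rewrite ip0l !addr0. Qed.
Lemma ipNr u v : ip u (- v) = - ip u v.
Proof. by rewrite -scaleN1r ipZr mulN1r. Qed.
Lemma ipNl u v : ip (- v) u = - ip v u.
Proof. by rewrite -scaleN1r ipZl rmorphN1 mulN1r. Qed.
Lemma ipBr u v w : ip u (v - w) = ip u v - ip u w.
Proof. by rewrite ipDr ipNr. Qed.
Lemma ipBl u v w : ip (v - w) u = ip v u - ip w u.
Proof. by rewrite ipDl ipNl. Qed.
Lemma ip_suml (J : Type) (s : seq J) (F : J -> H) v :
  ip (\sum_(j <- s) F j) v = \sum_(j <- s) ip (F j) v.
Proof. by elim/big_rec2: _ => [|j x y _ <-]; rewrite ?ip0l ?ipDl. Qed.

Lemma ip_conj u v : ip v u = (ip u v)^*.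
Proof.
apply: ip_unique; have /cvgrPdist_lt uv := @ip_cvg u v.
apply/cvgrPdist_lt => e /uv; apply: filterS => X; rewrite -norm_conjC rmorphB.
congr (`|_ - _| < _); rewrite /partial_sum rmorph_sum.
by apply: eq_bigr => i _; rewrite rmorphM /= conjCK mulrC.
Qed.


End InnerProduct.

Section HilbertNorm.
Variables (R : realType) (I : choiceType).
Local Notation C := (Cx R).
Local Notation H := (ell2 R I).
Implicit Types u v w : H.

Lemma hnorm0 : hnorm (0 : H) = 0.
Proof.
have := ip_hnorm (0 : H); rewrite ip0r => /esym/toC_inj/eqP.
by rewrite sqrf_eq0 => /eqP.
Qed.

Lemma hnorm_eq0 u : hnorm u = 0 -> u = 0.
Proof.
move=> u0; apply: ell2P => i; apply: absC_eq0; apply/eqP.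
by rewrite eq_le absC_ge0 andbT -u0 absC_le_hnorm.
Qed.

Lemma hnormZ (a : C) u : hnorm (a *: u) = absC a * hnorm u.
Proof.
apply/eqP; rewrite -(eqrXn2 (_ : 0 < 2)%N) ?mulr_ge0 ?hnorm_ge0 ?absC_ge0 //.
apply/eqP; apply: (@toC_inj R); rewrite -ip_hnorm ipZl ipZr ip_hnorm mulrA.
by rewrite -sqmod_conj -toCM exprMn sqr_absC.
Qed.

Lemma hnormN u : hnorm (- u) = hnorm u.
Proof. by rewrite -scaleN1r hnormZ absCN absC1 mul1r. Qed.

Lemma cauchy_schwarz u v : absC (ip u v) <= hnorm u * hnorm v.
Proof.
have [/eqP u0|u0] := boolP (hnorm u == 0).
  by rewrite (hnorm_eq0 u0) ip0l absC0 hnorm0 mul0r.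
have u_gt0 : 0 < hnorm u by rewrite lt_def u0 hnorm_ge0.
(* w is the component of v orthogonal to u, scaled by the squared norm of u to avoid a division; the
   inequality says that its squared norm is nonnegative. *)
set c := ip u v; pose w := toC (hnorm u ^+ 2) *: v - c *: u.
have E : hnorm w ^+ 2 = (hnorm u ^+ 2) * (hnorm u ^+ 2 * hnorm v ^+ 2 - absC c ^+ 2).
  apply: (@toC_inj R); rewrite -ip_hnorm /w !(ipBl, ipBr, ipZl, ipZr) !ip_hnorm.
  rewrite (ip_conj u v) -/c sqr_absC.
  move: (hnorm u ^+ 2) (hnorm v ^+ 2) => a b.
  rewrite (toCM a) toCD toCN (toCM a) sqmod_conj.
  have -> : (toC a)^* = toC a by apply/CrealP; apply/complex_realP; eexists.
  by ring.
have := sqr_ge0 (hnorm w); rewrite E pmulr_rge0 ?exprn_gt0 // subr_ge0 -exprMn.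
by rewrite ler_sqr ?nnegrE ?mulr_ge0 ?hnorm_ge0 ?absC_ge0.
Qed.

Lemma Re_le_absC (z : C) : complex.Re z <= absC z.
Proof.
rewrite /absC /sqmod; apply: le_trans (ler_norm _) _.
by rewrite -sqrtr_sqr ler_sqrt ?addr_ge0 ?sqr_ge0 // lerDl sqr_ge0.
Qed.

Lemma hnormD u v : hnorm (u + v) <= hnorm u + hnorm v.
Proof.
rewrite -ler_sqr ?nnegrE ?addr_ge0 ?hnorm_ge0 //.
have : toC (hnorm (u + v) ^+ 2) = toC (hnorm u ^+ 2 + hnorm v ^+ 2 + 2 * complex.Re (ip u v)).
  rewrite -ip_hnorm !(ipDl, ipDr) !ip_hnorm (ip_conj u v).
  move: (hnorm u ^+ 2) (hnorm v ^+ 2) => a b; rewrite 2!toCD (toCM 2).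
  have -> : (ip u v)^* = 2 * toC (complex.Re (ip u v)) - ip u v.
    by case: (ip u v) => c d; apply/eqP; rewrite eq_complex /=; apply/andP; split; apply/eqP; ring.
  rewrite (_ : toC 2 = 2); first by ring.
  by rewrite -toC1 -[2 in LHS]/(1 + 1) toCD.
move/toC_inj ->; rewrite sqrrD.
have := le_trans (Re_le_absC _) (cauchy_schwarz u v).
by move=> h; lra.
Qed.

Lemma hnormB u v : hnorm (u - v) <= hnorm u + hnorm v.
Proof. by rewrite -(hnormN v) hnormD. Qed.

Import summability.
Existing Instance totally_filter.

Lemma ip_delta (i : I) u : ip (delta R i) u = u i.
Proof.
apply: ip_unique; apply/cvgrPdist_lt => e e0; exists [fset i]%fset => //= X iX.
rewrite /summability.partial_sum -(big_seq_fsetE _ _ xpredT (fun j => (delta R i j)^* * u j)) /=.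
rewrite (big_fsetD1 i) /=; last by apply: (fsubsetP iX); rewrite inE.
rewrite delta_eq conjC1 mul1r big_seq big1 ?addr0 ?subrr ?normr0 // => j.
by rewrite !inE => /andP[ji _]; rewrite delta_neq // conjC0 mul0r.
Qed.

Lemma hnorm_delta (i : I) : hnorm (delta R i) = 1.
Proof.
have := ip_hnorm (delta R i); rewrite ip_delta delta_eq -toC1 => /toC_inj/esym/eqP.
by rewrite sqrp_eq1 ?hnorm_ge0 // => /eqP.
Qed.

Definition trunc (F : {fset I}) u : H := \sum_(i <- F) u i *: delta R i.

Lemma truncE F u j : trunc F u j = if j \in F then u j else 0.
Proof.
rewrite /trunc ell2_sum; case: ifP => jF.
  rewrite (big_fsetD1 j) // ell2Z delta_eq mulr1 big_seq big1 => [|i].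
    exact: addr0.
  by rewrite !inE => /andP[ij _]; rewrite ell2Z delta_neq ?mulr0 // eq_sym.
rewrite big_seq big1 // => i iF; rewrite ell2Z delta_neq ?mulr0 //.
by apply: contraFneq jF => ->.
Qed.

Lemma trunc_approx u (e : R) : 0 < e -> exists F, hnorm (u - trunc F u) < e.
Proof.
(* The tolerance (e/2)^2 is for squared norms; halving restores the strict inequality after the
   non-strict [hnorm_leP]. *)
move=> e0; have [F uF] := hnorm_approx u (exprn_gt0 2 (divr_gt0 e0 (ltr0n R 2))).
exists F; suff : hnorm (u - trunc F u) <= e / 2 by move=> h; lra.
apply/hnorm_leP; first by lra.
move=> X; apply: le_trans (_ : \sum_(i <- (X `\` F)%fset) sqmod (u i) <= _).
  rewrite (big_fsetID _ (mem F) X) /= [leLHS]addrC.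
  rewrite [X in _ + X]big_seq [X in _ + X]big1 ?addr0; last first.
    by move=> i; rewrite !inE => /andP[iX iF]; rewrite ell2B truncE iF subrr sqmod0.
  rewrite le_eqVlt; apply/orP; left; apply/eqP.
  have -> : [fset x | x in X & x \notin mem F]%fset = (X `\` F)%fset.
    by apply/fsetP => i; rewrite !inE andbC.
  rewrite !big_seq; apply: eq_bigr => i; rewrite !inE => /andP[iF _].
  by rewrite ell2B truncE (negPf iF) subr0.
have := sum_le_hnorm u (X `|` F)%fset.
rewrite (big_fsetID _ (mem F) (X `|` F)%fset) /=.
have -> : [fset x | x in (X `|` F)%fset & x \in mem F]%fset = F.
  by apply/fsetP => i; rewrite !inE; case: (i \in F); rewrite ?orbT ?andbF.
have -> : [fset x | x in (X `|` F)%fset & x \notin mem F]%fset = (X `\` F)%fset.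
  by apply/fsetP => i; rewrite !inE; case: (i \in F); rewrite ?orbT ?andbF ?orbF ?andbT.
lra.
Qed.

End HilbertNorm.

(** * Bounded operators *)

Section BoundedOperators.
Variables (R : realType) (I : choiceType).
Local Notation C := (Cx R).
Local Notation H := (ell2 R I).
Implicit Types (u v w : H) (S T : H -> H).

Lemma le0_small (x K : R) : 0 <= K -> (forall e, 0 < e -> x <= K * e) -> x <= 0.
Proof.
move=> K0 xK; apply/ler_addgt0Pr => e e0; rewrite add0r.
have K1 : 0 < K + 1 by rewrite ltr_wpDl.
apply: le_trans (xK _ (divr_gt0 e0 K1)) _.
by rewrite mulrA ler_pdivrMr // mulrC; apply: ler_wpM2l; [exact: ltW|rewrite lerDl].
Qed.

Lemma opD S T u : (S + T) u = S u + T u. Proof. by []. Qed.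
Lemma opB S T u : (S - T) u = S u - T u. Proof. by []. Qed.
Lemma opZ (a : C) T u : (a *: T) u = a *: T u. Proof. by []. Qed.
Lemma op0 u : (0 : H -> H) u = 0. Proof. by []. Qed.
Lemma op_sum (J : Type) (s : seq J) (F : J -> H -> H) u :
  (\sum_(j <- s) F j) u = \sum_(j <- s) F j u.
Proof. by elim/big_rec2: _ => // j x y _ <-. Qed.

Lemma bop_lin T (a : C) u v : bounded_op T -> T (a *: u + v) = a *: T u + T v.
Proof. by case=> + _; apply. Qed.

Lemma bop0 T : bounded_op T -> T 0 = 0.
Proof.
by move=> bT; have := bop_lin (-1) 0 0 bT; rewrite !scaleN1r !addNr => ->.
Qed.

Lemma bopD T u v : bounded_op T -> T (u + v) = T u + T v.
Proof. by move=> bT; have := bop_lin 1 u v bT; rewrite !scale1r. Qed.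

Lemma bopZ T (a : C) u : bounded_op T -> T (a *: u) = a *: T u.
Proof. by move=> bT; have := bop_lin a u 0 bT; rewrite !addr0 (bop0 bT) addr0. Qed.

Lemma bopB T u v : bounded_op T -> T (u - v) = T u - T v.
Proof. by move=> bT; rewrite bopD // -scaleN1r bopZ // scaleN1r. Qed.

Lemma bop_sum T (J : Type) (s : seq J) (F : J -> H) : bounded_op T ->
  T (\sum_(j <- s) F j) = \sum_(j <- s) T (F j).
Proof.
move=> bT; elim: s => [|j s IH]; first by rewrite !big_nil bop0.
by rewrite !big_cons bopD // IH.
Qed.

Lemma opnorm_has_sup T : bounded_op T ->
  has_sup [set hnorm (T u) | u in [set u | hnorm u <= 1]].
Proof.
move=> bT; split; first by exists (hnorm (T 0)), 0 => //=; rewrite hnorm0.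
case: bT => _ [M TM]; exists `|M| => _ [u /= u1 <-].
apply: le_trans (TM u) _; apply: le_trans (ler_norm _) _.
by rewrite normrM (ger0_norm (hnorm_ge0 _)) ler_piMr.
Qed.

Lemma opnormP T u : bounded_op T -> hnorm (T u) <= opnorm T * hnorm u.
Proof.
move=> bT; have [/eqP u0|u0] := boolP (hnorm u == 0).
  by rewrite (hnorm_eq0 u0) bop0 // hnorm0 mulr0.
have u_gt0 : 0 < hnorm u by rewrite lt_def u0 hnorm_ge0.
pose c : C := toC (hnorm u)^-1.
have ac : absC c = (hnorm u)^-1 by rewrite absC_toC ger0_norm // invr_ge0 ltW.
have : hnorm (T (c *: u)) <= opnorm T.
  apply: ub_le_sup; first by have [] := opnorm_has_sup bT.
  by exists (c *: u) => //=; rewrite hnormZ ac mulVf.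
by rewrite bopZ // hnormZ ac mulrC ler_pdivrMr.
Qed.

Lemma opnorm_le T (M : R) : 0 <= M -> (forall u, hnorm (T u) <= M * hnorm u) ->
  opnorm T <= M.
Proof.
move=> M0 TM; apply: ge_sup.
  by exists (hnorm (T 0)), 0 => //=; rewrite hnorm0.
by move=> _ [u /= u1 <-]; apply: le_trans (TM u) _; rewrite ler_piMr.
Qed.

Lemma opnorm_ge0 T : bounded_op T -> 0 <= opnorm T.
Proof.
move=> bT; apply: le_trans (hnorm_ge0 (T 0)) _.
apply: ub_le_sup; first by have [] := opnorm_has_sup bT.
by exists 0 => //=; rewrite hnorm0.
Qed.

Lemma bop_zero : bounded_op (0 : H -> H).
Proof.
split=> [a u v|]; first by rewrite !op0 scaler0 addr0.
by exists 0 => u; rewrite op0 hnorm0 mul0r.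
Qed.

Lemma bop_id : bounded_op (@id H).
Proof. by split=> //; exists 1 => u; rewrite mul1r. Qed.

Lemma bop_comb (a : C) S T : bounded_op S -> bounded_op T -> bounded_op (a *: S + T).
Proof.
move=> bS bT; split=> [b u v|].
  rewrite !(opD, opZ) (bop_lin _ _ _ bS) (bop_lin _ _ _ bT) !scalerDr !scalerA (mulrC a b).
  by rewrite addrACA.
exists (absC a * opnorm S + opnorm T) => u; rewrite opD opZ.
apply: le_trans (hnormD _ _) _; rewrite hnormZ mulrDl lerD ?opnormP // -mulrA.
by rewrite ler_wpM2l ?absC_ge0 ?opnormP.
Qed.

Lemma bop_add S T : bounded_op S -> bounded_op T -> bounded_op (S + T).
Proof. by move=> bS bT; have := bop_comb 1 bS bT; rewrite scale1r. Qed.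

Lemma bop_sub S T : bounded_op S -> bounded_op T -> bounded_op (S - T).
Proof. by move=> bS bT; have := bop_comb (-1) bT bS; rewrite scaleN1r addrC. Qed.

Lemma bop_comp S T : bounded_op S -> bounded_op T -> bounded_op (S \o T).
Proof.
move=> bS bT; split=> [a u v|] /=; first by rewrite (bop_lin _ _ _ bT) (bop_lin _ _ _ bS).
exists (opnorm S * opnorm T) => u /=; apply: le_trans (opnormP _ bS) _.
by rewrite -mulrA ler_wpM2l ?opnorm_ge0 ?opnormP.
Qed.

Lemma bop_bigsum (J : Type) (s : seq J) (F : J -> H -> H) :
  (forall j, bounded_op (F j)) -> bounded_op (\sum_(j <- s) F j).
Proof.
move=> bF; elim: s => [|j s IH]; first by rewrite big_nil; exact: bop_zero.
by rewrite big_cons; exact: bop_add.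
Qed.

Lemma opnorm_comb (a : C) S T : bounded_op S -> bounded_op T ->
  opnorm (a *: S + T) <= absC a * opnorm S + opnorm T.
Proof.
move=> bS bT; apply: opnorm_le.
  by rewrite addr_ge0 ?mulr_ge0 ?absC_ge0 ?opnorm_ge0.
move=> u; rewrite opD opZ.
apply: le_trans (hnormD _ _) _; rewrite hnormZ mulrDl lerD ?opnormP // -mulrA.
by rewrite ler_wpM2l ?absC_ge0 ?opnormP.
Qed.

Lemma opnormD S T : bounded_op S -> bounded_op T ->
  opnorm (S + T) <= opnorm S + opnorm T.
Proof.
by move=> bS bT; have := opnorm_comb 1 bS bT; rewrite scale1r absC1 mul1r.
Qed.

Lemma opnorm0 : opnorm (0 : H -> H) = 0.
Proof.
apply/eqP; rewrite eq_le opnorm_ge0 ?andbT; last exact: bop_zero.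
by apply: opnorm_le => // u; rewrite hnorm0 mul0r.
Qed.

Lemma opnorm_comp S T : bounded_op S -> bounded_op T ->
  opnorm (S \o T) <= opnorm S * opnorm T.
Proof.
move=> bS bT; apply: opnorm_le; first by rewrite mulr_ge0 ?opnorm_ge0.
move=> u /=; apply: le_trans (opnormP _ bS) _.
by rewrite -mulrA ler_wpM2l ?opnorm_ge0 ?opnormP.
Qed.

Lemma entry_le_opnorm T i j : bounded_op T -> absC (T (delta R j) i) <= opnorm T.
Proof.
move=> bT; apply: le_trans (absC_le_hnorm _ _) _; apply: le_trans (opnormP _ bT) _.
by rewrite hnorm_delta mulr1.
Qed.

Lemma trunc_ext S T F u : bounded_op S -> bounded_op T ->
  (forall i, S (delta R i) = T (delta R i)) -> S (trunc F u) = T (trunc F u).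
Proof.
move=> bS bT ST; rewrite /trunc !bop_sum //; apply: eq_bigr => i _.
by rewrite !bopZ // ST.
Qed.

(** Finitely supported vectors are dense and S - T is bounded. This supplies the uniqueness that
    [the_op_eq] asks for in most later constructions. *)
Lemma bop_ext S T : bounded_op S -> bounded_op T ->
  (forall i, S (delta R i) = T (delta R i)) -> S = T.
Proof.
move=> bS bT ST; apply/funext => u; apply/eqP; rewrite -subr_eq0; apply/eqP.
have bD := bop_sub bS bT.
apply: hnorm_eq0; apply/eqP; rewrite eq_le hnorm_ge0 andbT.
apply: (le0_small (opnorm_ge0 bD)) => e e0.
have [F uF] := trunc_approx u e0.
have := opnormP (u - trunc F u) bD.
rewrite bopB // (opB S T (trunc F u)) (trunc_ext _ _ bS bT) // subrr subr0.
move=> /le_trans; apply; apply: ler_wpM2l; [exact: opnorm_ge0|exact: ltW].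
Qed.

Lemma the_op_eq (P : (H -> H) -> Prop) T : bounded_op T -> P T ->
  (forall S, bounded_op S -> P S -> S = T) -> the_op P = T.
Proof.
move=> bT PT uT; rewrite /the_op; case: xgetP => [S _ [bS PS]|/(_ T)].
  exact: uT.
by case.
Qed.

Lemma ip_eq u v : (forall w, ip w u = ip w v) -> u = v.
Proof. by move=> uv; apply: ell2P => i; rewrite -!ip_delta. Qed.

(** Riesz representation by hand. With u the truncation to X of the candidate vector and s the sum
    to be bounded, [ip (T u) v] has modulus s while the norm of u is at most sqrt s. Hence s is at
    most opnorm T * hnorm v * sqrt s, which bounds s independently of X. *)
Lemma adj_fun_subproof T v (bT : bounded_op T) :
  (fun j => ip (T (delta R j)) v) \in @square_summable R I.
Proof.
apply/square_summableP; exists ((opnorm T * hnorm v) ^+ 2) => X.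
set s := \sum_(i <- X) _.
pose u : H := \sum_(j <- X) ip (T (delta R j)) v *: delta R j.
have uE : hnorm u ^+ 2 <= s.
  apply/hnorm_sqr_leP => Y; rewrite /s.
  have uj j : u j = if j \in X then ip (T (delta R j)) v else 0.
    rewrite /u ell2_sum; case: ifP => jX.
      rewrite (big_fsetD1 j) // ell2Z delta_eq mulr1 big_seq big1 => [|i].
        exact: addr0.
      by rewrite !inE => /andP[ij _]; rewrite ell2Z delta_neq ?mulr0 // eq_sym.
    rewrite big_seq big1 // => i iX; rewrite ell2Z delta_neq ?mulr0 //.
    by apply: contraFneq jX => ->.
  apply: (@le_trans _ _ (\sum_(i <- (Y `|` X)%fset) sqmod (u i))).
    by apply: sum_sqmod_sub; rewrite fsubsetUl.
  rewrite (big_fsetID _ (mem X)) /= [X in _ + X]big_seq [X in _ + X]big1 ?addr0.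
    rewrite le_eqVlt; apply/orP; left; apply/eqP.
    have -> : [fset x | x in (Y `|` X)%fset & x \in mem X]%fset = X.
      by apply/fsetP => i; rewrite !inE; case: (i \in X); rewrite ?orbT ?andbF.
    by rewrite !big_seq; apply: eq_bigr => i iX; rewrite uj iX.
  by move=> i; rewrite !inE => /andP[_ iX]; rewrite uj (negPf iX) sqmod0.
have s0 : 0 <= s by apply: sumr_ge0 => i _; exact: sqmod_ge0.
have sE : absC (ip (T u) v) = s.
  rewrite /u bop_sum // ip_suml.
  rewrite (_ : \sum_(j <- X) _ = toC s); first by rewrite absC_toC ger0_norm.
  rewrite /s toC_sum; apply: eq_bigr => i _.
  by rewrite bopZ // ipZl sqmod_conj.
have := le_trans (cauchy_schwarz (T u) v) (ler_wpM2r (hnorm_ge0 v) (opnormP u bT)).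
rewrite sE mulrAC => le1.
have u1 : hnorm u <= Num.sqrt s by rewrite -(ger0_norm (hnorm_ge0 u)) -sqrtr_sqr ler_sqrt.
have c0 : 0 <= opnorm T * hnorm v by rewrite mulr_ge0 ?hnorm_ge0 ?opnorm_ge0.
have {}le1 := le_trans le1 (ler_wpM2l c0 u1).
have [/eqP s00|s00] := boolP (s == 0); first by rewrite s00 sqr_ge0.
have ss : 0 < Num.sqrt s by rewrite sqrtr_gt0 lt_def s00.
move: le1; rewrite -{1}(sqr_sqrtr s0) expr2 ler_pM2r // => le1.
by rewrite -(sqr_sqrtr s0) ler_sqr ?nnegrE ?sqrtr_ge0.
Qed.

Lemma adj_exists T : bounded_op T ->
  exists2 S, bounded_op S & forall u v, ip (T u) v = ip u (S v).
Proof.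
move=> bT; pose S v : H := Ell2 (adj_fun_subproof v bT).
have Sd i v : S v i = ip (T (delta R i)) v by [].
have TS u v : ip (T u) v = ip u (S v).
  apply/eqP; rewrite -subr_eq0; apply/eqP; apply: absC_eq0.
  apply/eqP; rewrite eq_le absC_ge0 andbT.
  have K0 : 0 <= opnorm T * hnorm v + hnorm (S v).
    by rewrite addr_ge0 ?mulr_ge0 ?opnorm_ge0 ?hnorm_ge0.
  apply: (le0_small K0) => e e0.
  have [F uF] := trunc_approx u e0.
  have -> : ip (T u) v - ip u (S v) =
      ip (T (u - trunc F u)) v - ip (u - trunc F u) (S v).
    rewrite bopB // !ipBl (_ : ip (T (trunc F u)) v = ip (trunc F u) (S v)); first by ring.
    rewrite /trunc bop_sum // !ip_suml; apply: eq_bigr => i _.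
    by rewrite bopZ // !ipZl ip_delta.
  apply: le_trans (absCB _ _) _; rewrite mulrDl; apply: lerD.
    apply: le_trans (cauchy_schwarz _ _) _; rewrite mulrAC ler_wpM2r ?hnorm_ge0 //.
    apply: le_trans (opnormP _ bT) _.
    by apply: ler_wpM2l; [exact: opnorm_ge0|exact: ltW].
  apply: le_trans (cauchy_schwarz _ _) _; rewrite mulrC ler_wpM2l ?hnorm_ge0 //.
  exact: ltW.
exists S => //; split=> [a u v|].
  by apply: ell2P => i; rewrite ell2D ell2Z !Sd ip_linearr.
exists (opnorm T) => v.
have E : absC (ip (S v) (S v)) <= opnorm T * hnorm (S v) * hnorm v.
  rewrite -TS; apply: le_trans (cauchy_schwarz _ _) _.
  by rewrite ler_wpM2r ?hnorm_ge0 ?opnormP.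
have [/eqP -> |s0] := boolP (hnorm (S v) == 0).
  by rewrite mulr_ge0 ?opnorm_ge0 ?hnorm_ge0.
move: E; rewrite ip_hnorm absC_toC ger0_norm ?sqr_ge0 //.
by rewrite expr2 mulrAC ler_pM2r // lt_def s0 hnorm_ge0.
Qed.

Lemma adj_spec T : bounded_op T ->
  bounded_op (adj T) /\ forall u v, ip (T u) v = ip u (adj T v).
Proof.
move=> bT; have [S bS TS] := adj_exists bT.
suff -> : adj T = S by [].
apply: the_op_eq => // S' bS' TS'; apply/funext => v; apply: ip_eq => w.
by rewrite -TS -TS'.
Qed.

Lemma bop_adj T : bounded_op T -> bounded_op (adj T).
Proof. by case/adj_spec. Qed.

Lemma ip_adjr T u v : bounded_op T -> ip u (adj T v) = ip (T u) v.
Proof. by case/adj_spec => _ ->. Qed.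

Lemma ip_adjl T u v : bounded_op T -> ip (adj T u) v = ip u (T v).
Proof. by move=> bT; rewrite ip_conj ip_adjr // -ip_conj. Qed.

Lemma adj_eq S T : bounded_op T -> (forall u v, ip (T u) v = ip u (S v)) -> adj T = S.
Proof.
by move=> bT TS; apply/funext => v; apply: ip_eq => w; rewrite ip_adjr.
Qed.

Lemma adjK T : bounded_op T -> adj (adj T) = T.
Proof.
by move=> bT; apply: adj_eq => [|u v]; [exact: bop_adj|rewrite ip_adjl].
Qed.

Lemma adj_comp S T : bounded_op S -> bounded_op T -> adj (S \o T) = adj T \o adj S.
Proof.
move=> bS bT; apply: adj_eq => [|u v /=]; first exact: bop_comp.
by rewrite !ip_adjr.
Qed.

Lemma adj_comb (a : C) S T : bounded_op S -> bounded_op T ->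
  adj (a *: S + T) = a^* *: adj S + adj T.
Proof.
move=> bS bT; apply: adj_eq => [|u v /=]; first exact: bop_comb.
by rewrite !(opD, opZ) ip_linearl ip_linearr !ip_adjr.
Qed.

Lemma adj_entry T i j : bounded_op T -> adj T (delta R i) j = (T (delta R j) i)^*.
Proof. by move=> bT; rewrite -ip_delta ip_adjr // ip_conj ip_delta. Qed.

Lemma hnorm_adj T u : bounded_op T -> hnorm (adj T u) <= opnorm T * hnorm u.
Proof.
move=> bT; have [/eqP -> |s0] := boolP (hnorm (adj T u) == 0).
  by rewrite mulr_ge0 ?opnorm_ge0 ?hnorm_ge0.
have := cauchy_schwarz (T (adj T u)) u.
rewrite -ip_adjr // ip_hnorm absC_toC ger0_norm ?sqr_ge0 //.
move=> /le_trans /(_ (ler_wpM2r (hnorm_ge0 u) (opnormP _ bT))).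
by rewrite expr2 mulrAC ler_pM2r // lt_def s0 hnorm_ge0.
Qed.

Lemma opnorm_adj T : bounded_op T -> opnorm (adj T) <= opnorm T.
Proof. by move=> bT; apply: opnorm_le => [|u]; [exact: opnorm_ge0|exact: hnorm_adj]. Qed.

Lemma adj_sub S T : bounded_op S -> bounded_op T -> adj (S - T) = adj S - adj T.
Proof.
move=> bS bT; apply: adj_eq => [|u v]; first exact: bop_sub.
by rewrite !opB ipBl ipBr !ip_adjr.
Qed.

Lemma comp_subl S T (U : H -> H) : (S - T) \o U = (S \o U) - (T \o U).
Proof. by []. Qed.

Lemma comp_subr S T (U : H -> H) : bounded_op S -> S \o (T - U) = (S \o T) - (S \o U).
Proof. by move=> bS; apply/funext => u; rewrite /= !opB bopB. Qed.

End BoundedOperators.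

(** * Closed spans and generated C*-algebras *)

Section ClosedSpans.
Variables (R : realType) (I : choiceType).
Local Notation C := (Cx R).
Local Notation H := (ell2 R I).
Implicit Types (S T : H -> H) (A G : set (H -> H)).

Lemma closed_span_sub G : G `<=` closed_span G.
Proof. exact: sub_smallest. Qed.

Lemma closed_span_min G A : closed_subspace A -> G `<=` A -> closed_span G `<=` A.
Proof. by move=> cA GA; apply: smallest_sub. Qed.

Lemma cstar_generated_sub G : G `<=` cstar_generated G.
Proof. exact: sub_smallest. Qed.

Lemma cstar_generated_min G A : cstar_subalgebra A -> G `<=` A -> cstar_generated G `<=` A.
Proof. by move=> cA GA; apply: smallest_sub. Qed.

Lemma bounded_closed_subspace : closed_subspace (@bounded_op R I).
Proof.
split=> //; first exact: bop_zero.
by move=> a S T; exact: bop_comb.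
Qed.

Lemma bounded_cstar : cstar_subalgebra (@bounded_op R I).
Proof.
by split; [exact: bounded_closed_subspace | exact: bop_comp | exact: bop_adj].
Qed.

Lemma closed_span_closed G : G `<=` @bounded_op R I -> closed_subspace (closed_span G).
Proof.
move=> bG; split.
- exact: closed_span_min bounded_closed_subspace bG.
- by move=> A [[]].
- move=> a S T GS GT A AG; have [[_ _ + _] _] := AG; apply; [exact: GS|exact: GT].
- move=> T bT TG A AG; have [[_ _ _ +] _] := AG; apply=> // e /TG[S GS ST].
  by exists S => //; exact: GS.
Qed.

Lemma cstar_generated_cstar G : G `<=` @bounded_op R I -> cstar_subalgebra (cstar_generated G).
Proof.
move=> bG; split.
- split.
  + exact: cstar_generated_min bounded_cstar bG.
  + by move=> A [[[]]].
  + move=> a S T GS GT A AG; have [[[_ _ + _] _ _] _] := AG; apply; [exact: GS|exact: GT].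
  + move=> T bT TG A AG; have [[[_ _ _ +] _ _] _] := AG; apply=> // e /TG[S GS ST].
    by exists S => //; exact: GS.
- move=> S T GS GT A AG; have [[_ + _] _] := AG; apply; [exact: GS|exact: GT].
- move=> T GT A AG; have [[_ _ +] _] := AG; apply; exact: GT.
Qed.

Lemma closed_subspace_bop A T : closed_subspace A -> A T -> bounded_op T.
Proof. by case=> + _ _ _; apply. Qed.

Lemma closed_subspaceD A S T : closed_subspace A -> A S -> A T -> A (S + T).
Proof. by case=> _ _ + _ AS AT => /(_ 1 S T AS AT); rewrite scale1r. Qed.

Lemma closed_subspace_sum A (J : Type) (s : seq J) (F : J -> H -> H) :
  closed_subspace A -> (forall j, A (F j)) -> A (\sum_(j <- s) F j).
Proof.
move=> cA AF; elim: s => [|j s IH]; first by rewrite big_nil; case: cA.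
by rewrite big_cons; exact: closed_subspaceD.
Qed.

(** Applied to left and right multiplications, the adjoint and commutators. The scalar b may differ
    from a because the adjoint is conjugate-linear. *)
Lemma closed_subspace_preim A (L : (H -> H) -> (H -> H)) (K : R) :
  closed_subspace A -> 0 <= K -> L 0 = 0 ->
  (forall T, bounded_op T -> bounded_op (L T)) ->
  (forall (a : C) S T, bounded_op S -> bounded_op T ->
     exists b : C, L (a *: S + T) = b *: L S + L T) ->
  (forall S T, bounded_op S -> bounded_op T -> opnorm (L T - L S) <= K * opnorm (T - S)) ->
  closed_subspace [set T | bounded_op T /\ A (L T)].
Proof.
move=> cA K0 L0 bL linL LK; have [_ A0 Ac An] := cA.
split=> [T []//|||].
- by split; [exact: bop_zero|rewrite L0].
- move=> a S T [bS AS] [bT AT]; split; first exact: bop_comb.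
  by have [b ->] := linL a S T bS bT; exact: Ac.
- move=> T bT TA; split=> //; apply: An; first exact: bL.
  move=> e e0; have K1 : 0 < K + 1 by rewrite ltr_wpDl.
  have [S [bS AS] ST] := TA _ (divr_gt0 e0 K1).
  exists (L S) => //; apply: le_lt_trans (LK _ _ bS bT) _.
  have D0 := opnorm_ge0 (bop_sub bT bS).
  move: ST; rewrite ltr_pdivlMr // => ST; apply: le_lt_trans ST.
  by rewrite mulrDr mulr1 mulrC lerDl.
Qed.

Lemma closed_subspace_compl A S : closed_subspace A -> bounded_op S ->
  closed_subspace [set T | bounded_op T /\ A (S \o T)].
Proof.
move=> cA bS; apply: (closed_subspace_preim (L := fun T => S \o T) cA (opnorm_ge0 bS)).
- by apply/funext => u /=; rewrite op0 bop0.
- by move=> T; exact: bop_comp.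
- move=> a T U bT bU; exists a; apply/funext => u /=.
  by rewrite !(opD, opZ) /= (bop_lin _ _ _ bS).
- move=> T U bT bU; rewrite -comp_subr //; apply: opnorm_comp => //; exact: bop_sub.
Qed.

Lemma closed_subspace_compr A S : closed_subspace A -> bounded_op S ->
  closed_subspace [set T | bounded_op T /\ A (T \o S)].
Proof.
move=> cA bS; apply: (closed_subspace_preim (L := fun T => T \o S) cA (opnorm_ge0 bS)).
- by [].
- by move=> T bT; exact: bop_comp.
- by move=> a T U bT bU; exists a.
- move=> T U bT bU; rewrite -comp_subl mulrC; apply: opnorm_comp => //; exact: bop_sub.
Qed.

Lemma closed_subspace_adj A : closed_subspace A ->
  closed_subspace [set T | bounded_op T /\ A (adj T)].
Proof.
move=> cA; apply: (closed_subspace_preim (L := @adj R I) cA ler01).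
- by apply: adj_eq => [|u v]; [exact: bop_zero|rewrite !op0 ip0l ip0r].
- by move=> T; exact: bop_adj.
- by move=> a S T bS bT; exists a^*; exact: adj_comb.
- move=> S T bS bT; rewrite -adj_sub // mul1r; apply: opnorm_adj; exact: bop_sub.
Qed.

(** Products are extended to the span one factor at a time: first the right factor with the left one
    in G, then the left factor with the right one in the span. *)
Lemma cstar_closed_span G : G `<=` @bounded_op R I ->
  (forall S T, G S -> G T -> closed_span G (S \o T)) ->
  (forall T, G T -> closed_span G (adj T)) ->
  cstar_subalgebra (closed_span G).
Proof.
move=> bG GM Gadj; have cG := closed_span_closed bG.
have bcG : closed_span G `<=` @bounded_op R I by move=> T; exact: closed_subspace_bop.
split=> //; last first.
  move=> T GT; suff [] : [set T | bounded_op T /\ closed_span G (adj T)] T by [].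
  move: T GT; apply: closed_span_min; first exact: closed_subspace_adj.
  by move=> T GT; split; [exact: bG|exact: Gadj].
have GcG S T : G S -> closed_span G T -> closed_span G (S \o T).
  move=> GS GT; have bS := bG _ GS.
  suff [] : [set T | bounded_op T /\ closed_span G (S \o T)] T by [].
  move: T GT; apply: closed_span_min; first exact: closed_subspace_compl.
  by move=> T GT; split; [exact: bG|exact: GM].
move=> S T GS GT; have bT := bcG _ GT.
suff [] : [set S | bounded_op S /\ closed_span G (S \o T)] S by [].
move: S GS; apply: closed_span_min; first exact: closed_subspace_compr.
by move=> S GS; split; [exact: bG|exact: GcG].
Qed.

Lemma opnorm_eq0 T : bounded_op T -> opnorm T = 0 -> T = 0.
Proof.
move=> bT T0; apply/funext => u; apply: hnorm_eq0; apply/eqP.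
by rewrite eq_le hnorm_ge0 andbT; have := opnormP u bT; rewrite T0 mul0r.
Qed.

(** Commuting with S means lying in the preimage of this subspace under the commutator with S. *)
Lemma closed_subspace0 : closed_subspace [set (0 : H -> H)].
Proof.
split=> [_ ->||a S T -> ->|]; first exact: bop_zero.
- by [].
- by rewrite scaler0 addr0.
- move=> T bT T0; apply: opnorm_eq0 => //; apply/eqP.
  rewrite eq_le opnorm_ge0 // andbT; apply: (@le0_small _ _ 1) => // e e0.
  by have [_ -> ] := T0 e e0; rewrite subr0 mul1r => /ltW.
Qed.

Lemma closed_subspace_commute S : bounded_op S ->
  closed_subspace [set T | bounded_op T /\ (S \o T) - (T \o S) = 0].
Proof.
move=> bS; have S0 := opnorm_ge0 bS.
have K0 : 0 <= 2 * opnorm S by rewrite mulr_ge0.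
apply: (closed_subspace_preim (L := fun T => (S \o T) - (T \o S)) closed_subspace0 K0).
- by apply/funext => u /=; rewrite opB /= !op0 bop0 // subrr.
- by move=> T bT; apply: bop_sub; exact: bop_comp.
- move=> a T U bT bU; exists a; apply/funext => u /=.
  rewrite !(opD, opZ, opB) /= !(opD, opZ) (bop_lin _ _ _ bS) scalerBr.
  by rewrite opprD addrACA.
- move=> T U bT bU.
  have -> : (S \o U) - (U \o S) - ((S \o T) - (T \o S)) = (S \o (U - T)) - ((U - T) \o S).
    rewrite comp_subr // comp_subl !opprB [LHS]addrACA [RHS]addrACA.
    by congr (_ + _); exact: addrC.
  have bUT := bop_sub bU bT.
  apply: opnorm_le; first by rewrite mulr_ge0 ?opnorm_ge0.
  move=> u; rewrite opB /=; apply: le_trans (hnormB _ _) _.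
  have h1 : hnorm (S ((U - T) u)) <= opnorm S * opnorm (U - T) * hnorm u.
    by apply: le_trans (opnormP _ bS) _; rewrite -mulrA ler_wpM2l ?opnormP.
  have h2 : hnorm ((U - T) (S u)) <= opnorm S * opnorm (U - T) * hnorm u.
    apply: le_trans (opnormP _ bUT) _; rewrite (mulrC (opnorm S)) -mulrA.
    by rewrite ler_wpM2l ?opnorm_ge0 ?opnormP.
  by apply: le_trans (lerD h1 h2) _; rewrite le_eqVlt; apply/orP; left; apply/eqP; ring.
Qed.

Lemma abelian_closed_span G : G `<=` @bounded_op R I -> abelian_op G ->
  abelian_op (closed_span G).
Proof.
move=> bG aG; have cG := closed_span_closed bG.
have bcG T : closed_span G T -> bounded_op T by exact: closed_subspace_bop.
have comm S : bounded_op S -> (forall T, G T -> S \o T = T \o S) ->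
    forall T, closed_span G T -> S \o T = T \o S.
  move=> bS GS T GT; suff [_ /eqP] : [set T | bounded_op T /\ (S \o T) - (T \o S) = 0] T.
    by rewrite subr_eq0 => /eqP.
  move: T GT; apply: closed_span_min; first exact: closed_subspace_commute.
  by move=> T GT; split; [exact: bG|rewrite GS // subrr].
move=> S T GS GT; apply: (comm S) => //; first exact: bcG.
move=> U GU; symmetry; apply: (comm U) => //; first exact: bG.
by move=> V GV; exact: aG.
Qed.

End ClosedSpans.

(** * Weighted composition operators and tensoring with shifts *)

Section FinsetSums.
Variables (R : realType) (I : choiceType).
Implicit Types (s : seq I) (u : ell2 R I).

Lemma uniq_sum_le_hnorm u s : uniq s -> \sum_(i <- s) sqmod (u i) <= hnorm u ^+ 2.
Proof.
move=> us; have := sum_le_hnorm u [fset x in s]%fset.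
rewrite (perm_big s) //; apply: uniq_perm; rewrite ?fset_uniq // => i.
by rewrite !inE.
Qed.

End FinsetSums.

Section WeightedComposition.
Variables (R : realType) (I : choiceType) (K : finType).
Local Notation C := (Cx R).
Local Notation H := (ell2 R I).
Variables (psi : I -> option I) (e : I -> K) (c : I -> C) (M : R).
Hypothesis psi_inj : forall i j k,
  psi i = Some k -> psi j = Some k -> e i = e j -> i = j.
Hypothesis M0 : 0 <= M.
Hypothesis cM : forall i, psi i -> absC (c i) <= M.

(** A weighted composition operator. The map [psi] is partial and finite-to-one: the label [e]
    splits its domain into finitely many sheets on which it is injective. *)
Definition wcomp_fun (u : H) (j : I) : C := oapp (fun i => c j * u i) 0 (psi j).

Lemma wcomp_pmap_le (u : H) (k : K) (s : seq I) : uniq s -> all (fun j => e j == k) s ->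
  uniq (pmap psi s) /\
  \sum_(j <- s) sqmod (wcomp_fun u j) <= M ^+ 2 * \sum_(i <- pmap psi s) sqmod (u i).
Proof.
elim: s => [|j s IH] /=; first by rewrite !big_nil mulr0.
move=> /andP[js us] /andP[/eqP jk sk]; have [IH1 IH2] := IH us sk.
rewrite big_cons /wcomp_fun; case jE : (psi j) => [i|] /=; last first.
  by rewrite sqmod0 add0r; split.
split.
  rewrite IH1 andbT mem_pmap; apply: contra js => /mapP[j' j's j'i].
  suff -> : j = j' by [].
  apply: (psi_inj jE) => //.
  by rewrite jk; move/allP : sk => /(_ _ j's)/eqP.
rewrite big_cons mulrDr sqmodM lerD // ler_wpM2r ?sqmod_ge0 //.
by rewrite -sqr_absC ler_sqr ?nnegrE ?absC_ge0 // cM // jE.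
Qed.

(** Each sheet contributes at most M^2 times the squared norm of u. *)
Lemma wcomp_sum_le (u : H) (F : {fset I}) :
  \sum_(j <- F) sqmod (wcomp_fun u j) <= M ^+ 2 * #|K|%:R * hnorm u ^+ 2.
Proof.
rewrite (partition_big e xpredT) //=.
apply: (@le_trans _ _ (\sum_(k : K) M ^+ 2 * hnorm u ^+ 2)).
  apply: ler_sum => k _; rewrite -big_filter.
  have us : uniq [seq j <- F | e j == k] by rewrite filter_uniq // fset_uniq.
  have sk : all (fun j => e j == k) [seq j <- F | e j == k] by exact: filter_all.
  have [us' le] := wcomp_pmap_le u us sk.
  by apply: le_trans le _; rewrite ler_wpM2l ?sqr_ge0 // uniq_sum_le_hnorm.
by rewrite sumr_const -[leLHS]mulr_natr (mulrAC (M ^+ 2)) lexx.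
Qed.

Lemma wcomp_subproof (u : H) : wcomp_fun u \in @square_summable R I.
Proof.
apply/square_summableP; exists (M ^+ 2 * #|K|%:R * hnorm u ^+ 2) => F.
exact: wcomp_sum_le.
Qed.

Lemma wcomp_exists : exists T : H -> H, bounded_op T /\
  forall u j, T u j = oapp (fun i => c j * u i) 0 (psi j).
Proof.
exists (fun u => Ell2 (wcomp_subproof u)); split=> //.
split=> [a u v|].
  apply: ell2P => j; rewrite ell2D ell2Z /ell2_fun /wcomp_fun.
  by case: (psi j) => [i|] /=; rewrite ?ell2D ?ell2Z; ring.
exists (Num.sqrt (M ^+ 2 * #|K|%:R)) => u.
have K0 : 0 <= M ^+ 2 * #|K|%:R by rewrite mulr_ge0 ?sqr_ge0.
apply/hnorm_leP; first by rewrite mulr_ge0 ?sqrtr_ge0 ?hnorm_ge0.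
by move=> F; rewrite exprMn sqr_sqrtr //; exact: wcomp_sum_le.
Qed.

End WeightedComposition.

Section Diagonal.
Variables (R : realType) (I : choiceType).
Local Notation C := (Cx R).
Local Notation H := (ell2 R I).

(** The sharp bound M makes uniform approximation of diagonal entries the same as norm
    approximation, and makes taking diagonals contractive. *)
Lemma diag_exists (c : I -> C) (M : R) : 0 <= M -> (forall i, absC (c i) <= M) ->
  exists T : H -> H, [/\ bounded_op T, opnorm T <= M & forall u i, T u i = c i * u i].
Proof.
move=> M0 cM.
have [T [bT TE]] := @wcomp_exists R I unit Some (fun=> tt) c M
  (fun i j k (iE : Some i = Some k) (jE : Some j = Some k) _ =>
     etrans (Some_inj iE) (esym (Some_inj jE))) M0 (fun i _ => cM i).
exists T; split=> //; apply: opnorm_le => // u.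
apply/hnorm_leP; first by rewrite mulr_ge0 ?hnorm_ge0.
move=> F; rewrite exprMn; apply: le_trans (_ : M ^+ 2 * \sum_(i <- F) sqmod (u i) <= _); last first.
  by rewrite ler_wpM2l ?sqr_ge0 // sum_le_hnorm.
rewrite mulr_sumr; apply: ler_sum => i _; rewrite TE /= sqmodM ler_wpM2r ?sqmod_ge0 //.
by rewrite -sqr_absC ler_sqr ?nnegrE ?absC_ge0.
Qed.

End Diagonal.

Notation ups := (@Defs.shift _).

Section TensorShift.
Variables (R : realType) (I : choiceType).
Local Notation C := (Cx R).
Local Notation H := (ell2 R I).
Local Notation Hhat := (ell2 R (I * int)%type).

Lemma slice_subproof (u : Hhat) (n : int) : (fun i => u (i, n)) \in @square_summable R I.
Proof.
apply/square_summableP; exists (hnorm u ^+ 2) => F.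
rewrite -(big_map (fun i => (i, n)) xpredT (fun p => sqmod (u p))).
by apply: uniq_sum_le_hnorm; rewrite map_inj_uniq ?fset_uniq // => i j [].
Qed.

Definition slice (n : int) (u : Hhat) : H := Ell2 (slice_subproof u n).

Lemma sliceE n u i : slice n u i = u (i, n). Proof. by []. Qed.

Lemma slice_lin n (a : C) u v : slice n (a *: u + v) = a *: slice n u + slice n v.
Proof. by apply: ell2P => i; rewrite !(sliceE, ell2D, ell2Z). Qed.

Lemma sum_slice_le (u : Hhat) (s : seq int) : uniq s ->
  \sum_(n <- s) hnorm (slice n u) ^+ 2 <= hnorm u ^+ 2.
Proof.
move=> us; apply/ler_addgt0Pr => d d0.
(* Each slice is approximated by a finite sum with error d'; the [size s] errors together stay below
   d. *)
pose d' := d / (size s).+1%:R.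
have d'0 : 0 < d' by rewrite divr_gt0.
have /choice[X XE] n : exists X : {fset I}, hnorm (slice n u) ^+ 2 - d' <
    \sum_(i <- X) sqmod (slice n u i) by exact: hnorm_approx.
apply: (@le_trans _ _ (\sum_(n <- s) (\sum_(i <- X n) sqmod (slice n u i) + d'))).
  by apply: ler_sum => n _; rewrite -lerBlDr ltW.
rewrite big_split /= lerD //; last first.
  rewrite big_const_seq count_predT iter_addr_0 -[leLHS]mulr_natr /d' mulrAC.
  by rewrite ler_pdivrMr // ler_wpM2l ?ltW // ltr_nat.
rewrite (_ : \sum_(n <- s) _ =
  \sum_(p <- [seq (i, n) | n <- s, i <- enum_fset (X n)]) sqmod (u p)); last first.
  by rewrite big_allpairs_dep.
apply: uniq_sum_le_hnorm; apply: allpairs_uniq_dep => //.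
by case=> n i; case=> m j _ _ /= [-> ->].
Qed.

Section Existence.
Variables (S : H -> H) (n : int).
Hypothesis bS : bounded_op S.

Definition tshift_fun (u : Hhat) (p : I * int) : C := S (slice (p.2 - n) u) p.1.

Lemma tshift_sum_le (u : Hhat) (F : {fset I * int}) :
  \sum_(p <- F) sqmod (tshift_fun u p) <= (opnorm S * hnorm u) ^+ 2.
Proof.
pose B := undup [seq p.2 | p <- F].
have uB : uniq B := undup_uniq _.
apply: (@le_trans _ _ (\sum_(m <- B) hnorm (S (slice (m - n) u)) ^+ 2)).
  have -> : \sum_(p <- F) sqmod (tshift_fun u p) =
      \sum_(m <- B) \sum_(p <- F | p.2 == m) sqmod (tshift_fun u p).
    rewrite (exchange_big_dep xpredT) //= big_seq [RHS]big_seq; apply: eq_bigr => p pF.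
    rewrite (big_rem p.2) /=; last by rewrite mem_undup map_f.
    rewrite eqxx big_seq_cond big1 ?addr0 // => m /andP[mB /eqP pm].
    by move: mB; rewrite -pm mem_rem_uniqF.
  apply: ler_sum => m _.
  rewrite -big_filter (eq_big_seq (fun p : I * int => sqmod (S (slice (m - n) u) p.1))); last first.
    by move=> p; rewrite mem_filter /tshift_fun => /andP[/eqP ->].
  rewrite -(big_map (fun p : I * int => p.1) xpredT (fun i => sqmod (S (slice (m - n) u) i))).
  apply: uniq_sum_le_hnorm; rewrite map_inj_in_uniq ?filter_uniq ?fset_uniq //.
  move=> [i r] [j q]; rewrite !mem_filter /= => /andP[/eqP -> _] /andP[/eqP -> _].
  by move=> ->.
apply: (@le_trans _ _ (\sum_(m <- B) opnorm S ^+ 2 * hnorm (slice (m - n) u) ^+ 2)).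
  apply: ler_sum => m _; rewrite -exprMn ler_sqr ?nnegrE ?mulr_ge0 ?hnorm_ge0 ?opnorm_ge0 //.
  exact: opnormP.
rewrite -mulr_sumr exprMn ler_wpM2l ?sqr_ge0 //.
rewrite -(big_map (fun m => m - n) xpredT (fun m => hnorm (slice m u) ^+ 2)).
by apply: sum_slice_le; rewrite map_inj_uniq // => i j /addIr.
Qed.

Lemma tshift_subproof u : tshift_fun u \in @square_summable R (I * int)%type.
Proof.
by apply/square_summableP; exists ((opnorm S * hnorm u) ^+ 2) => F; exact: tshift_sum_le.
Qed.

(** [tshift_fun] fills the slice at height m with the image under S of the slice at height m - n.
    Distinct slices are orthogonal, so the norm of S bounds the result. The basis consists of
    elementary tensors, so the specification of [op_tens] has no other solution. *)
Lemma op_tens_shift_spec : [/\ bounded_op (op_tens S (ups n)),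
  opnorm (op_tens S (ups n)) <= opnorm S
  & forall u i m, op_tens S (ups n) u (i, m) = S (slice (m - n) u) i].
Proof.
pose W u : Hhat := Ell2 (tshift_subproof u).
have WE u i m : W u (i, m) = S (slice (m - n) u) i by [].
have WM u : hnorm (W u) <= opnorm S * hnorm u.
  apply/hnorm_leP; first by rewrite mulr_ge0 ?hnorm_ge0 ?opnorm_ge0.
  by move=> F; exact: tshift_sum_le.
have bW : bounded_op W.
  split; last by exists (opnorm S).
  move=> a u v; apply: ell2P => -[i m].
  by rewrite ell2D ell2Z !WE slice_lin (bop_lin _ _ _ bS) ell2D ell2Z.
suff -> : op_tens S (ups n) = W.
  by split=> //; apply: opnorm_le => //; exact: opnorm_ge0.
apply: the_op_eq => // [u v|W' bW' W'E].
  apply: ell2P => -[i m]; rewrite WE.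
  have -> : slice (m - n) (tens u v) = v (m - n) *: u.
    by apply: ell2P => j; rewrite sliceE ell2Z mulrC.
  by rewrite bopZ // ell2Z mulrC.
apply: bop_ext => // -[i m].
have -> : delta R (i, m) = tens (delta R i) (delta R m).
  apply: ell2P => -[j k]; rewrite deltaE -[RHS]/((j == i)%:R * (k == m)%:R).
  by rewrite -natrM mulnb xpair_eqE.
rewrite W'E; apply: ell2P => -[j k]; rewrite WE.
have -> : slice (k - n) (tens (delta R i) (delta R m)) = delta R m (k - n) *: delta R i.
  by apply: ell2P => l; rewrite sliceE ell2Z mulrC.
by rewrite bopZ // ell2Z mulrC.
Qed.

Lemma bop_tens : bounded_op (op_tens S (ups n)).
Proof. by case: op_tens_shift_spec. Qed.

Lemma opnorm_tens : opnorm (op_tens S (ups n)) <= opnorm S.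
Proof. by case: op_tens_shift_spec. Qed.

Lemma op_tensE u i m : op_tens S (ups n) u (i, m) = S (slice (m - n) u) i.
Proof. by case: op_tens_shift_spec. Qed.

Lemma slice_delta i m k : slice k (delta R (i, m)) = (k == m)%:R *: delta R i.
Proof.
apply: ell2P => j; rewrite sliceE ell2Z !deltaE xpair_eqE -natrM mulnb.
by rewrite andbC.
Qed.

Lemma op_tens_entry i j m k :
  op_tens S (ups n) (delta R (j, k)) (i, m) = (m - n == k)%:R * S (delta R j) i.
Proof. by rewrite op_tensE slice_delta bopZ // ell2Z. Qed.

End Existence.

Lemma op_tens_comb (a : C) (S T : H -> H) n : bounded_op S -> bounded_op T ->
  op_tens (a *: S + T) (ups n) = a *: op_tens S (ups n) + op_tens T (ups n).
Proof.
move=> bS bT; apply/funext => u; apply: ell2P => -[i m].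
rewrite opD opZ ell2D ell2Z !op_tensE //; exact: bop_comb.
Qed.

Lemma op_tens_sub (S T : H -> H) n : bounded_op S -> bounded_op T ->
  op_tens (S - T) (ups n) = op_tens S (ups n) - op_tens T (ups n).
Proof.
move=> bS bT; apply/funext => u; apply: ell2P => -[i m].
rewrite opB ell2B !op_tensE //; exact: bop_sub.
Qed.

End TensorShift.

(** * Words and chains *)

Section Words.
Variables (X : topologicalType) (N : nat) (g : 'I_N -> X -> X) (XX : set X).
Hypothesis inv : completely_invariant g XX.
Hypothesis disj : trivIset setT (fun k => g k @` XX).
Hypothesis inj : forall k, set_inj XX (g k).
Local Notation Y := (set_type XX).
Implicit Types (w : seq 'I_N) (x y z : Y).

Lemma XX_val y : XX (val y).
Proof. exact: (set_mem (valP y)). Qed.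

Definition toY (x : X) (Xx : XX x) : Y := SigSub (mem_set Xx).

Lemma gXX k y : XX (g k (val y)).
Proof. by apply: (inv k).1; exists (val y) => //; exact: XX_val. Qed.

Definition gY k y : Y := toY (gXX k y).

Lemma val_gY k y : val (gY k y) = g k (val y). Proof. by []. Qed.

Definition wmap w y : Y := foldr gY y w.

Lemma val_wmap w y : val (wmap w y) = word_map g w (val y).
Proof. by elim: w => //= k w IH; rewrite IH. Qed.

Lemma word_map_cat w1 w2 (x : X) : word_map g (w1 ++ w2) x = word_map g w1 (word_map g w2 x).
Proof. exact: foldr_cat. Qed.

Lemma wmap_cat w1 w2 y : wmap (w1 ++ w2) y = wmap w1 (wmap w2 y).
Proof. exact: foldr_cat. Qed.

Lemma gY_inj k l x y : gY k x = gY l y -> k = l /\ x = y.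
Proof.
move=> /(congr1 val); rewrite !val_gY => gxy.
have kl : k = l.
  apply/eqP; apply: contraT => /eqP kl; exfalso; apply: kl.
  apply: (disj I I); exists (g k (val x)).
  by split; [exists (val x)|exists (val y)] => //; exact: XX_val.
split=> //; apply: val_inj; apply: (inj (k := k)); rewrite ?inE; try exact: XX_val.
by rewrite gxy kl.
Qed.

Lemma wmap_inj w1 w2 x y : size w1 = size w2 -> wmap w1 x = wmap w2 y -> w1 = w2 /\ x = y.
Proof.
elim: w1 w2 => [|k w1 IH] [|l w2] //= [sw] /gY_inj[-> /(IH _ sw)[-> ->]].
by [].
Qed.

(** Inverts [wmap] on words of length m. By [wmap_inj] there is at most one such pair, so the choice
    is harmless; matrix entries are expressed through this decoding. *)
Definition dec (m : nat) y : option (seq 'I_N * Y) :=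
  if pselect (exists p : seq 'I_N * Y, size p.1 = m /\ y = wmap p.1 p.2) is left e
  then Some (projT1 (cid e)) else None.

Lemma dec_some m y w x : dec m y = Some (w, x) -> size w = m /\ y = wmap w x.
Proof.
rewrite /dec; case: pselect => // e; case: (cid e) => -[w' x'] /= pP [<- <-].
exact: pP.
Qed.

Lemma dec_wmap m w x : size w = m -> dec m (wmap w x) = Some (w, x).
Proof.
move=> sw; rewrite /dec; case: pselect => [e|]; last by case; exists (w, x).
case: (cid e) => -[w' x'] /= [sw' E].
by have [-> ->] := wmap_inj (etrans sw (esym sw')) E.
Qed.

Lemma dec0 y : dec 0 y = Some ([::], y).
Proof. exact: (@dec_wmap 0 [::] y). Qed.

Lemma ifs_iterP n (S : set X) (x : X) :
  ifs_iter g n S x <-> exists w (z : X), [/\ size w = n, S z & x = word_map g w z].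
Proof.
elim: n x => [|n IH] x; split.
- by move=> Sx; exists [::], x.
- by move=> [w [z [/size0nil -> Sz ->]]].
- move=> [k _ [z /IH[w [t [sw St ->]]] <-]]; exists (k :: w), t.
  by rewrite /= sw.
- move=> [[|k w] [z []]] //= [sw] Sz ->; exists k => //; exists (word_map g w z) => //.
  by apply/IH; exists w, z.
Qed.

Lemma word_preimage w (x : X) : XX (word_map g w x) -> XX x.
Proof. by elim: w => //= k w IH H; apply: IH; exact: (inv k).2. Qed.

(** Backward invariance puts the base point of a word back in [XX], so being decodable is membership
    in the set gamma^d(X): this links the coding of [XX] to the topology of X. *)
Lemma dec_iter d y : ifs_iter g d setT (val y) <-> exists w x, dec d y = Some (w, x).
Proof.
split=> [/ifs_iterP[w [z [sw _ yE]]]|[w [x /dec_some[sw ->]]]].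
  have Xz : XX z by apply: (@word_preimage w); rewrite -yE; exact: XX_val.
  exists w, (toY Xz).
  have -> : y = wmap w (toY Xz) by apply: val_inj; rewrite val_wmap.
  exact: dec_wmap.
by apply/ifs_iterP; exists w, (val x); rewrite val_wmap.
Qed.

Lemma dec_iterXX d y : ifs_iter g d XX (val y) <-> ifs_iter g d setT (val y).
Proof.
split=> /ifs_iterP[w [z [sw Sz yE]]]; apply/ifs_iterP; exists w, z; split=> //.
by apply: (@word_preimage w); rewrite -yE; exact: XX_val.
Qed.

Lemma dec_cat_Some m d w i y x : size w = m -> dec d y = Some (i, x) ->
  dec (m + d) (wmap w y) = Some (w ++ i, x).
Proof.
move=> sw /dec_some[si ->]; rewrite -wmap_cat; apply: dec_wmap.
by rewrite size_cat sw si.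
Qed.

Lemma dec_cat_None m d w y : size w = m -> dec d y = None ->
  dec (m + d) (wmap w y) = None.
Proof.
move=> sw dN; case E : (dec _ _) => [[v x]|//].
have [sv] := dec_some E.
rewrite -(cat_take_drop m v) wmap_cat.
case/wmap_inj => [|_ yE]; first by rewrite size_takel ?sv ?leq_addr.
by move: dN; rewrite yE dec_wmap // size_drop sv addKn.
Qed.

End Words.

Section Chains.
Variables (X : topologicalType) (N : nat) (g : 'I_N -> X -> X).
Implicit Types (w : seq 'I_N) (x : X).

(** Convertible to [word_chain], but on plain sequences, so that words can be concatenated and split
    without changes of type. *)
Definition chain m w x : {ptws 'I_m.+1 -> X} := fun i => word_map g (drop (m - i) w) x.
Arguments chain : clear implicits.

Lemma chain_is_chain m w x : size w = m -> is_chain g (chain m w x).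
Proof.
move=> sw i; have im : (m - i.+1 < size w)%N by rewrite sw; have := ltn_ord i; lia.
(* The head of a word is applied last, so the step from entry i to entry i + 1 uses the letter at
   position m - (i + 1). *)
pose k := tnth (in_tuple w) (Ordinal im).
exists k; rewrite /chain /= /bump /= add1n.
rewrite (drop_nth k im) /=; congr (g _ _).
  by rewrite [RHS](tnth_nth k).
by congr foldr; congr drop; have := ltn_ord i; lia.
Qed.

Lemma chain_pairsP m n w k x : size w = m -> size k = n ->
  chain_pairs g m n (chain m w x, chain n k x).
Proof.
move=> sw sk; split; [exact: chain_is_chain|exact: chain_is_chain|].
by rewrite /= /chain /= !subn0 !drop_oversize ?sw ?sk.
Qed.

End Chains.
Arguments chain {X N} g m w x.

(** * Continuity of restricted and cut-off functions *)

Section TopologyFacts.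

Lemma ptws_cvg (T : Type) (X : topologicalType) (J : eqType) (F : set_system T)
    (G : T -> {ptws J -> X}) (f : {ptws J -> X}) : Filter F ->
  (forall i, (fun t => G t i) @ F --> f i) -> G @ F --> f.
Proof.
move=> FF Gf; apply/cvg_sup => i U [V] [[W] oW <-] Wf WU.
apply: filterS WU _; apply: Gf; apply: open_nbhs_nbhs; split=> //.
Qed.

(** Used with A a set of chain pairs or the graph of gamma and G a parametrization by points of X:
    it turns continuity on A into continuity in the base point. *)
Lemma within_cvg (X P S : topologicalType) (A : set P) (f : P -> S) (G : X -> P)
    (D : set X) (x : X) :
  {within A, continuous f} -> open D -> D x -> (forall z, D z -> A (G z)) ->
  G z @[z --> x] --> G x -> f (G z) @[z --> x] --> f (G x).
Proof.
move=> /subspace_continuousP cf oD Dx DA GG.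
apply: cvg_trans (cf _ (DA _ Dx)) => B /= nB.
rewrite !nbhs_simpl /= in nB *.
have := GG _ nB; rewrite nbhs_simpl /=.
have nD : nbhs x D by apply: open_nbhs_nbhs.
move=> H; near=> z; apply: (near H z) => //; apply: DA; exact: (near nD z).
Unshelve. all: by end_near.
Qed.

(** Clopenness of gamma^n(X) enters here: n iterations of sigma make sense on gamma^n(X) only, and
    functions built from them are extended by zero. *)
Lemma clopen_cutoff_continuous (R : realType) (X : topologicalType) (D : set X)
    (phi : X -> Cx R) : clopen D -> (forall x, D x -> {for x, continuous phi}) ->
  continuous (fun x => if pselect (D x) then phi x else 0).
Proof.
move=> [oD cD] cphi x; have [Dx|nDx] := pselect (D x).
  have nD : nbhs x D by exact: open_nbhs_nbhs.
  rewrite /continuous_at; case: pselect => // Dx'.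
  apply: (@cvg_trans _ (phi z @[z --> x])); last exact: cphi.
  apply: near_eq_cvg; near=> z; case: pselect => // -[]; exact: (near nD z).
have nD : nbhs x (~` D) by apply: open_nbhs_nbhs; split=> //; exact: closed_openC.
rewrite /continuous_at; case: pselect => // Dx'.
apply: (@cvg_trans _ ((fun=> 0 : Cx R) z @[z --> x])); last exact: cvg_cst.
apply: near_eq_cvg; near=> z; case: pselect => // Dz; exfalso; exact: (near nD z).
Unshelve. all: by end_near.
Qed.

Lemma nowhere_dense_subset (X : topologicalType) (V A : set X) :
  open V -> V !=set0 -> V `<=` closure A -> ~ nowhere_dense A.
Proof.
move=> oV [x Vx] VA nA; suff : interior (closure A) x by rewrite nA.
by apply: (filterS VA); exact: open_nbhs_nbhs.
Qed.

End TopologyFacts.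

(** * Iterates of the left inverse and chain kernels *)

Section Sigma.
Variables (X : topologicalType) (N : nat) (g : 'I_N -> X -> X) (sigma : X -> X).
Hypothesis g_continuous : forall k, continuous (g k).
Hypothesis g_clopen : forall n, clopen (ifs_iter g n setT).
Hypothesis sigma_cont : {within ifs_image g setT, continuous sigma}.
Hypothesis sigmaK : forall k x, sigma (g k x) = x.
Implicit Types (w : seq 'I_N) (x : X).

Lemma word_map_continuous w : continuous (word_map g w).
Proof.
elim: w => [|k w IH] x /=; first exact: cvg_id.
by apply: continuous_comp; [exact: IH|exact: g_continuous].
Qed.

Lemma word_map_injective w : injective (word_map g w).
Proof.
by elim: w => [|k w IH] x y //= /(congr1 sigma); rewrite !sigmaK => /IH.
Qed.

Lemma sigma_word e w x : (e <= size w)%N ->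
  iter e sigma (word_map g w x) = word_map g (drop e w) x.
Proof.
by elim: e w => [|e IH] [|k w] //= ew; rewrite -iterS iterSr /= sigmaK IH.
Qed.

Lemma ifs_iter_le d e x : (d <= e)%N -> ifs_iter g e setT x -> ifs_iter g d setT x.
Proof.
move=> de /ifs_iterP[w [z [sw _ ->]]]; apply/ifs_iterP.
exists (take d w), (word_map g (drop d w) z); split=> //.
  by rewrite size_takel // sw.
by rewrite -word_map_cat cat_take_drop.
Qed.

Lemma sigma_continuous_at x : ifs_iter g 1 setT x -> {for x, continuous sigma}.
Proof.
move=> Gx; have [oG _] := g_clopen 1.
have := sigma_cont; rewrite continuous_open_subspace //.
by apply; rewrite inE.
Qed.

Lemma iter_sigma_continuous e x : ifs_iter g e setT x -> {for x, continuous (iter e sigma)}.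
Proof.
elim: e x => [|e IH] x; first by move=> _; exact: cvg_id.
move=> /[dup] Gx /ifs_iterP[w [z [sw _ xE]]].
have -> : iter e.+1 sigma = iter e sigma \o sigma.
  by apply/funext => y; rewrite iterSr.
apply: continuous_comp; first by apply: sigma_continuous_at; apply: ifs_iter_le Gx.
apply: IH; rewrite xE -[sigma _]/(iter 1 sigma _) sigma_word ?sw //.
by apply/ifs_iterP; exists (drop 1 w), z; split=> //; rewrite size_drop sw subn1.
Qed.

(* A chain starting with the word [j], expressed through the point where the
   remaining [d] letters have been applied, the latter being undone by [sigma]. *)
Definition cext (j : seq 'I_N) (m d : nat) x : {ptws 'I_m.+1 -> X} :=
  fun i => word_map g (drop (m - i) j) (iter (d - i) sigma x).
Arguments cext : clear implicits.

Lemma cext_word j m d i x : size i = d -> m = (size j + d)%N ->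
  cext j m d (word_map g i x) = chain g m (j ++ i) x.
Proof.
move=> si mE; apply/funext => l; rewrite /cext /chain sigma_word ?si ?leq_subr //.
rewrite -word_map_cat; congr word_map; rewrite drop_cat; have ll := ltn_ord l.
(* Entries above position d come from letters of j, where sigma is not iterated; those up to d come
   from undoing letters of i, where all of j is dropped. *)
case: ltnP => h.
  have -> : (d - l = 0)%N by lia.
  by rewrite drop0.
rewrite drop_oversize //=; congr drop; lia.
Qed.

Lemma cext_continuous j m d x : ifs_iter g d setT x -> {for x, continuous (cext j m d)}.
Proof.
move=> Gx; apply: ptws_cvg => i.
apply: (@continuous_comp _ _ _ (iter (d - i) sigma) (word_map g (drop (m - i) j))).
  by apply: iter_sigma_continuous; apply: ifs_iter_le Gx; exact: leq_subr.
exact: word_map_continuous.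
Qed.

Section Kernels.
Variables (R : realType) (m n : nat).
Variable f : ({ptws 'I_m.+1 -> X} * {ptws 'I_n.+1 -> X})%type -> Cx R.
Hypothesis cf : {within chain_pairs g m n, continuous f}.

(** The entry of [rho m n f] from branch l to branch j over x, as a function on all of X; the d
    letters by which both words are too short are read off x itself. *)
Definition Fext (j l : seq 'I_N) (d : nat) (x : X) : Cx R :=
  if pselect (ifs_iter g d setT x) then f (cext j m d x, cext l n d x) else 0.

Lemma Fext_continuous j l d : m = (size j + d)%N -> n = (size l + d)%N ->
  continuous (Fext j l d).
Proof.
move=> mE nE; apply: (clopen_cutoff_continuous (g_clopen d)) => x Gx.
have [oG _] := g_clopen d.
apply: (@within_cvg _ _ _ (chain_pairs g m n) f (fun z => (cext j m d z, cext l n d z)) _ x cf oG) => //.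
  move=> z /ifs_iterP[w [t [sw _ ->]]]; rewrite !cext_word //.
  by apply: chain_pairsP; rewrite size_cat sw.
have c1 : {for x, continuous (cext j m d)} by exact: cext_continuous.
have c2 : {for x, continuous (cext l n d)} by exact: cext_continuous.
exact: (cvg_pair c1 c2).
Qed.

Lemma chain_kernel_continuous w k : size w = m -> size k = n ->
  continuous (fun x => f (chain g m w x, chain g n k x)).
Proof.
move=> sw sk x.
apply: (@within_cvg _ _ _ (chain_pairs g m n) f (fun z => (chain g m w z, chain g n k z)) setT x cf openT) => //.
  by move=> z _; exact: chain_pairsP.
have c p (v : seq 'I_N) : {for x, continuous (chain g p v)}.
  by apply: ptws_cvg => i; exact: word_map_continuous.
exact: (cvg_pair (c m w) (c n k)).
Qed.

End Kernels.
End Sigma.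

Lemma nbhs_absC (R : realType) (z0 : Cx R) (e : R) : 0 < e ->
  \forall z \near z0, absC (z0 - z) < e.
Proof.
move=> e0; have e0' : 0 < toC e by rewrite -toC0 toC_lt.
have /cvgrPdist_lt /(_ _ e0') : z @[z --> z0] --> z0 by exact: cvg_id.
by apply: filterS => z; rewrite norm_absC toC_lt.
Qed.

Lemma cvg_absC_dist (R : realType) (T : Type) (F : set_system T) (FF : Filter F)
    (f : T -> Cx R) (l : Cx R) :
  (forall e : R, 0 < e -> \forall t \near F, absC (l - f t) < e) -> f @ F --> l.
Proof.
move=> H; apply/cvgrPdist_lt => e e0.
have [e' e'0 ->] : exists2 e', 0 < e' & e = toC e'.
  exists (complex.Re e); move: e0; rewrite ltcE => /andP[/eqP /= im0 //].
  by move: im0; case: (e) => a b /= ->.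
by apply: filterS (H _ e'0) => t; rewrite norm_absC toC_lt.
Qed.

Lemma continuous_absC_near (R : realType) (X : topologicalType) (phi : X -> Cx R) (x : X)
    (e : R) : {for x, continuous phi} -> 0 < e -> \forall z \near x, absC (phi x - phi z) < e.
Proof. by move=> cphi e0; exact: cphi (nbhs_absC (phi x) e0). Qed.

Lemma absC_lerB (R : realType) (z w : Cx R) : absC z - absC w <= absC (z - w).
Proof. by rewrite lerBlDr -[X in absC X <= _](subrK w) absCD. Qed.

Lemma absC_continuous (R : realType) (z : Cx R) : absC w @[w --> z] --> absC z.
Proof.
apply/(@cvgrPdist_lt R R^o (Cx R) (nbhs z)) => e e0; near=> w.
have : absC (z - w) < e by near: w; exact: nbhs_absC.
apply: le_lt_trans; rewrite ler_norml absC_lerB andbT lerNl opprB.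
by rewrite absC_dist absC_lerB.
Unshelve. all: by end_near.
Qed.

Lemma continuous_absC_bounded (R : realType) (X : topologicalType) (phi : X -> Cx R) :
  compact [set: X] -> continuous phi ->
  exists2 M : R, 0 <= M & forall x, absC (phi x) <= M.
Proof.
move=> cX cphi.
have cI : compact ((fun x => absC (phi x) : R^o) @` setT).
  apply: continuous_compact => //; apply: continuous_subspaceT => x.
  by apply: continuous_comp; [exact: cphi|exact: absC_continuous].
have [M [_ MP]] := compact_bounded cI.
exists `|M + 1| => // x; apply: le_trans (ler_norm _) _.
apply: (@le_trans _ _ (M + 1)); last exact: ler_norm.
by apply: (MP (M + 1)); [rewrite ltrDl|exists x].
Qed.

(** * Matrix formulas for the representation *)

Section RhoOperators.
Variables (R : realType) (X : topologicalType) (N : nat) (g : 'I_N -> X -> X) (XX : set X).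
Hypothesis inv : completely_invariant g XX.
Hypothesis disj : trivIset setT (fun k => g k @` XX).
Hypothesis inj : forall k, set_inj XX (g k).
Local Notation Y := (set_type XX).
Local Notation C := (Cx R).
Local Notation H := (ell2 R Y).
Local Notation dec := (dec inv).
Local Notation wmap := (wmap inv).
Local Notation dec_wmap := (dec_wmap inv disj inj).
Local Notation wmap_inj := (wmap_inj disj inj).

Lemma kernel_term_exists m (k : seq 'I_N) (F : seq 'I_N -> Y -> C) (M : R) : 0 <= M ->
  (forall w x, size w = m -> absC (F w x) <= M) ->
  exists T : H -> H, bounded_op T /\ forall u y,
    T u y = if dec m y is Some (w, x) then F w x * u (wmap k x) else 0.
Proof.
move=> M0 FM.
(* For a fixed source word k, the point y coded by (w, x) is sent to [wmap k x]; the target word w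
   labels the sheets, of which there are finitely many. *)
pose psi y := omap (fun p => wmap k p.2) (dec m y).
pose e y : option (m.-tuple 'I_N) := if dec m y is Some (w, _) then insub w else None.
pose c y : C := if dec m y is Some (w, x) then F w x else 0.
have [|||T [bT TE]] := @wcomp_exists R Y (option (m.-tuple 'I_N)) psi e c M.
- move=> i j z; rewrite /psi /e.
  case iE : (dec m i) => [[w x]|//]; case jE : (dec m j) => [[w' x']|//] /=.
  have [sw iE'] := dec_some iE; have [sw' jE'] := dec_some jE.
  move=> [<-] [xx]; have [_ {}xx] := wmap_inj erefl xx.
  rewrite !insubT ?sw ?sw' // => swP sw'P [] ww.
  by rewrite iE' jE' ww xx.
- by [].
- move=> y; rewrite /psi /c; case yE : (dec m y) => [[w x]|//] _.
  by have [sw _] := dec_some yE; exact: FM.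
exists T; split=> // u y; rewrite TE /psi /c.
by case: (dec m y) => [[w x]|].
Qed.

Lemma kernel_op_exists m n (F : seq 'I_N -> seq 'I_N -> Y -> C) (M : R) : 0 <= M ->
  (forall w k x, size w = m -> size k = n -> absC (F w k x) <= M) ->
  exists T : H -> H, bounded_op T /\ forall u y, T u y =
    if dec m y is Some (w, x) then \sum_(k : n.-tuple 'I_N) F w k x * u (wmap k x) else 0.
Proof.
move=> M0 FM.
have /choice[T TP] (k : n.-tuple 'I_N) : exists T : H -> H, bounded_op T /\ forall u y,
    T u y = if dec m y is Some (w, x) then F w k x * u (wmap k x) else 0.
  apply: (@kernel_term_exists m k (fun w => F w k) M M0) => w x sw.
  by apply: FM => //; rewrite size_tuple.
exists (\sum_(k : n.-tuple 'I_N) T k); split.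
  by apply: bop_bigsum => k; have [] := TP k.
move=> u y; rewrite op_sum ell2_sum.
case yE : (dec m y) => [[w x]|]; last first.
  by apply: big1 => k _; have [_ ->] := TP k; rewrite yE.
by apply: eq_bigr => k _; have [_ ->] := TP k; rewrite yE.
Qed.

Lemma kernel_op_delta m n (F : seq 'I_N -> seq 'I_N -> Y -> C) (T : H -> H) :
  (forall u y, T u y =
    if dec m y is Some (w, x) then \sum_(k : n.-tuple 'I_N) F w k x * u (wmap k x) else 0) ->
  forall z y, T (delta R z) y =
    if dec m y is Some (w, x) then
      if dec n z is Some (k, x') then (x == x')%:R * F w k x else 0
    else 0.
Proof.
move=> TE z y; rewrite TE; case yE : (dec m y) => [[w x]|//].
case zE : (dec n z) => [[k x']|]; last first.
  apply: big1 => k _; rewrite delta_neq ?mulr0 //.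
  apply: contra_eqN zE => /eqP <-; by rewrite dec_wmap ?size_tuple.
have [/eqP sk zE'] := dec_some zE; pose kt := Tuple sk.
rewrite (bigD1 kt) //= big1 ?addr0 => [|j jk].
  rewrite mulrC deltaE; congr (_%:R * _); congr nat_of_bool.
  rewrite zE'; apply/eqP/eqP => [/wmap_inj[]//|-> //].
rewrite delta_neq ?mulr0 //; apply: contraNneq jk.
rewrite zE' => /wmap_inj[]; first by rewrite size_tuple (eqP sk).
by move=> jk _; apply/eqP/val_inj.
Qed.

Lemma evec_val (y : Y) : @evec R X XX (val y) = delta R y.
Proof. by rewrite /evec valK. Qed.

Lemma val_ind (P : X -> Prop) : (forall y : Y, P (val y)) -> forall x, XX x -> P x.
Proof. by move=> PY x Xx; exact: (PY (toY Xx)). Qed.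

Lemma rhoA_spec (a : X -> C) (M : R) : 0 <= M -> (forall x, absC (a x) <= M) ->
  [/\ bounded_op (@rhoA R X XX a), opnorm (@rhoA R X XX a) <= M &
      forall u (y : Y), @rhoA R X XX a u y = a (val y) * u y].
Proof.
move=> M0 aM; have [T [bT TM TE]] := diag_exists (c := fun y : Y => a (val y)) M0 (fun y => aM _).
suff -> : @rhoA R X XX a = T by [].
apply: the_op_eq => //.
  apply: val_ind => y; rewrite evec_val; apply: ell2P => z; rewrite TE ell2Z !deltaE.
  by have [->//|_] := eqVneq z y; rewrite !mulr0.
move=> S bS SE; apply: bop_ext => // y.
rewrite -evec_val SE; last exact: XX_val.
apply: ell2P => z; rewrite evec_val TE ell2Z !deltaE.
by have [->//|_] := eqVneq z y; rewrite !mulr0.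
Qed.

Lemma sum_wmap_delta m (G : seq 'I_N -> C) (x y : Y) :
  (\sum_(j : m.-tuple 'I_N) G j *: delta R (wmap j x)) y =
  if dec m y is Some (w, x') then (x' == x)%:R * G w else 0.
Proof.
rewrite ell2_sum; case yE : (dec m y) => [[w x']|]; last first.
  apply: big1 => k _; rewrite ell2Z delta_neq ?mulr0 //.
  by apply: contra_eqN yE => /eqP ->; rewrite dec_wmap ?size_tuple.
have [/eqP sw yE'] := dec_some yE; pose wt := Tuple sw.
rewrite (bigD1 wt) //= big1 ?addr0 => [|j jw].
  rewrite ell2Z mulrC deltaE; congr (_%:R * _); congr nat_of_bool.
  rewrite yE'; apply/eqP/eqP => [/wmap_inj[]//|-> //].
rewrite ell2Z delta_neq ?mulr0 //; apply: contraNneq jw.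
rewrite yE' => /wmap_inj[]; first by rewrite size_tuple (eqP sw).
by move=> jw _; apply/eqP/val_inj.
Qed.

(** The two clauses defining [rho] prescribe each basis vector exactly once: those in gamma^n(XX)
    through their unique word, the others by zero. *)
Lemma rho_spec m n (f : ({ptws 'I_m.+1 -> X} * {ptws 'I_n.+1 -> X})%type -> C) (M : R) :
  0 <= M ->
  (forall w k x, size w = m -> size k = n -> absC (f (chain g m w x, chain g n k x)) <= M) ->
  bounded_op (@rho R X N g XX m n f) /\ forall z y, @rho R X N g XX m n f (delta R z) y =
    if dec m y is Some (w, x) then
      if dec n z is Some (k, x') then
        (x == x')%:R * f (chain g m w (val x), chain g n k (val x)) else 0
    else 0.
Proof.
move=> M0 fM.
have [T [bT TE]] := @kernel_op_exists m n
  (fun w k x => f (chain g m w (val x), chain g n k (val x))) M M0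
  (fun w k x sw sk => fM w k (val x) sw sk).
have Td := @kernel_op_delta m n
  (fun w k x => f (chain g m w (val x), chain g n k (val x))) T TE.
suff -> : @rho R X N g XX m n f = T by split.
have PT : forall (k : n.-tuple 'I_N) (x : Y), T (delta R (wmap k x)) =
   \sum_(j : m.-tuple 'I_N) f (chain g m j (val x), chain g n k (val x)) *: delta R (wmap j x).
  move=> k x; apply: ell2P => y; rewrite Td.
  rewrite (@sum_wmap_delta m (fun j => f (chain g m j (val x), chain g n k (val x)))).
  case: (dec m y) => [[w x']|//]; rewrite dec_wmap ?size_tuple //.
  by have [->|_] := eqVneq x' x; rewrite ?mul0r.
have PT' (y : Y) : dec n y = None -> T (delta R y) = 0.
  move=> yN; apply: ell2P => z; rewrite Td yN.
  by case: (dec m z) => [[]|].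
have decN (y : Y) : ~ ifs_iter g n XX (val y) -> dec n y = None.
  case yE : (dec n y) => [[w x]|//] []; apply/(dec_iterXX inv)/(dec_iter inv disj inj).
  by exists w, x.
apply: the_op_eq => //.
  split=> [k|]; apply: val_ind => y; last first.
    by move=> /decN /PT'; rewrite evec_val.
  rewrite -(val_wmap inv) evec_val PT; apply: eq_bigr => j _.
  by rewrite -(val_wmap inv) evec_val.
move=> S bS [SE1 SE2]; apply: bop_ext => // y.
case yE : (dec n y) => [[w x]|].
  have [/eqP sw ->] := dec_some yE; pose wt := Tuple sw.
  rewrite -evec_val val_wmap (SE1 wt); last exact: XX_val.
  rewrite -[w]/(val wt) -(val_wmap inv) evec_val PT; apply: eq_bigr => j _.
  by rewrite -(val_wmap inv) evec_val.
rewrite PT' // -evec_val SE2 //; first exact: XX_val.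
by move=> /(dec_iterXX inv)/(dec_iter inv disj inj)[w [x]]; rewrite yE.
Qed.

Lemma rhoE_spec (f : X * X -> C) (M : R) : 0 <= M ->
  (forall k x, absC (f (g k x, x)) <= M) ->
  bounded_op (@rhoE R X N g XX f) /\ forall u (y : Y), @rhoE R X N g XX f u y =
    if dec 1 y is Some (w, x) then f (val y, val x) * u x else 0.
Proof.
move=> M0 fM.
have [|T [bT TE]] := @kernel_term_exists 1 [::] (fun w x => f (word_map g w (val x), val x)) M M0.
  by move=> [|k [|]] //= x _; exact: fM.
have TE' u (y : Y) : T u y = if dec 1 y is Some (w, x) then f (val y, val x) * u x else 0.
  rewrite TE; case yE : (dec 1 y) => [[w x]|//].
  by have [_ ->] := dec_some yE; rewrite val_wmap.
suff -> : @rhoE R X N g XX f = T by [].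
have PT (z : Y) : T (delta R z) = \sum_(k < N) f (g k (val z), val z) *: delta R (gY inv k z).
  apply: ell2P => y; rewrite TE' ell2_sum; case yE : (dec 1 y) => [[w x]|]; last first.
    rewrite big1 // => k _; rewrite ell2Z delta_neq ?mulr0 //.
    apply: contra_eqN yE => /eqP ->.
    by rewrite -[gY inv k z]/(wmap [:: k] z) dec_wmap.
  have [] := dec_some yE; case: w yE => [|k [|]] //= yE _ ->.
  rewrite (bigD1 k) //= big1 ?addr0 => [|j jk].
    rewrite ell2Z !deltaE; have [->|xz] := eqVneq x z; first by rewrite eqxx.
    have [/(gY_inj disj inj)[_ /eqP]|_] := eqVneq (gY inv k x) (gY inv k z).
      by rewrite (negPf xz).
    by rewrite !mulr0.
  rewrite ell2Z delta_neq ?mulr0 //; apply: contraNneq jk => /(gY_inj disj inj)[-> _].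
  exact: eqxx.
apply: the_op_eq => //.
  apply: val_ind => y; rewrite evec_val PT; apply: eq_bigr => k _.
  by rewrite -[g k (val y)]/(val (gY inv k y)) evec_val.
move=> S bS SE; apply: bop_ext => // y; rewrite PT -evec_val SE; last exact: XX_val.
by apply: eq_bigr => k _; rewrite -[g k (val y)]/(val (gY inv k y)) evec_val.
Qed.

End RhoOperators.

(** * Continuity of matrix entries *)

Section Approximable.
Variables (R : realType) (X : topologicalType) (XX : set X).
Local Notation Y := (set_type XX).
Local Notation C := (Cx R).

(** When [XX] is dense this amounts to a continuous extension to X; the form by approximants passes
    to uniform limits without constructing the limit function. *)
Definition approximable (psi : Y -> C) : Prop := forall e : R, 0 < e ->
  exists2 phi : X -> C, continuous phi & forall x : Y, absC (psi x - phi (val x)) <= e.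

Lemma approximable_continuous (phi : X -> C) : continuous phi ->
  approximable (fun x => phi (val x)).
Proof. by move=> cphi e e0; exists phi => // x; rewrite subrr absC0 ltW. Qed.

Lemma approximable_cst (c : C) : approximable (fun=> c).
Proof. by move=> e e0; exists (fun=> c) => [x|x]; [exact: cvg_cst|rewrite subrr absC0 ltW]. Qed.

Lemma continuous_comb (a : C) (phi phi' : X -> C) : continuous phi -> continuous phi' ->
  continuous (fun x => a * phi x + phi' x).
Proof.
move=> cp cp' x; apply: cvgD (cp' x); apply: cvgM (cp x); exact: cvg_cst.
Qed.

(** The tolerances behind the stability proofs under [a *: S + T]; the summand 1 covers a = 0. *)
Lemma absC_comb_le (a z z' w w' : C) (e : R) : 0 < e ->
  absC (z - w) <= e / (absC a + 1) / 2 -> absC (z' - w') <= e / 2 ->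
  absC (a * z + z' - (a * w + w')) <= e.
Proof.
move=> e0 h1 h2; have a0 := absC_ge0 a.
have -> : a * z + z' - (a * w + w') = a * (z - w) + (z' - w') by ring.
apply: le_trans (absCD _ _) _; rewrite absCM.
have : absC a * absC (z - w) <= e / 2.
  apply: le_trans (ler_wpM2l a0 h1) _.
  rewrite mulrA ler_pM2r ?invr_gt0 // mulrA ler_pdivrMr; last by rewrite ltr_wpDl.
  by rewrite mulrC; apply: ler_wpM2l; [exact: ltW|rewrite lerDl].
by move=> h; apply: le_trans (lerD h h2) _; lra.
Qed.

Lemma approximable_comb (a : C) (psi psi' : Y -> C) :
  approximable psi -> approximable psi' -> approximable (fun x => a * psi x + psi' x).
Proof.
move=> ap ap' e e0.
have a1 : 0 < absC a + 1 by rewrite ltr_wpDl ?absC_ge0.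
have [phi cphi pp] := ap _ (divr_gt0 (divr_gt0 e0 a1) (ltr0n R 2)).
have [phi' cphi' pp'] := ap' _ (divr_gt0 e0 (ltr0n R 2)).
exists (fun x => a * phi x + phi' x); first exact: continuous_comb.
by move=> x; exact: absC_comb_le.
Qed.

Lemma approximable_limit (psi : Y -> C) :
  (forall e : R, 0 < e -> exists2 psi' : Y -> C, approximable psi' &
     forall x, absC (psi x - psi' x) <= e) -> approximable psi.
Proof.
move=> H e e0; have e2 := divr_gt0 e0 (ltr0n R 2).
have [psi' ap pp] := H _ e2; have [phi cphi pp'] := ap _ e2.
exists phi => // x; rewrite -(subrKA (psi' x)).
by apply: le_trans (absCD _ _) _; have := pp x; have := pp' x; lra.
Qed.

End Approximable.

Section Key.
Variables (R : realType) (X : topologicalType) (N : nat) (g : 'I_N -> X -> X) (XX : set X).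
Variable sigma : X -> X.
Hypothesis g_continuous : forall k, continuous (g k).
Hypothesis inv : completely_invariant g XX.
Hypothesis disj : trivIset setT (fun k => g k @` XX).
Hypothesis inj : forall k, set_inj XX (g k).
Hypothesis g_clopen : forall n, clopen (ifs_iter g n setT).
Hypothesis sigma_cont : {within ifs_image g setT, continuous sigma}.
Hypothesis sigmaK : forall k x, sigma (g k x) = x.
Local Notation Y := (set_type XX).
Local Notation C := (Cx R).
Local Notation Hhat := (ell2 R (Y * int)%type).
Local Notation dec := (dec inv).
Local Notation wmap := (wmap inv).

Definition entry (T : Hhat -> Hhat) (y : Y) (s : int) (z : Y) (r : int) : C :=
  T (delta R (z, r)) (y, s).

Lemma entry_comb (a : C) S T y s z r :
  entry (a *: S + T) y s z r = a * entry S y s z r + entry T y s z r.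
Proof. by []. Qed.

Lemma entry0 y s z r : entry 0 y s z r = 0.
Proof. by []. Qed.

Lemma entry_dist S T y s z r : bounded_op S -> bounded_op T ->
  absC (entry S y s z r - entry T y s z r) <= opnorm (S - T).
Proof.
move=> bS bT; exact: (entry_le_opnorm (y, s) (z, r) (bop_sub bS bT)).
Qed.

Definition shift_invariant T := forall t y s z r,
  entry T y (s + t) z (r + t) = entry T y s z r.

Definition word_entries_approximable T := forall j l,
  approximable (fun x : Y => entry T (wmap j x) (size j)%:Z (wmap l x) (size l)%:Z).

(* Entries along two branches that collide at [x0] have the same limit there:
   the coefficient function of a generator depends on chains of points, not on
   the words that produce them. *)
Definition letters_agree T := forall j k (x0 : X), g j x0 = g k x0 ->
  forall e : R, 0 < e -> exists phi phi' : X -> C,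
    [/\ continuous phi, continuous phi', phi x0 = phi' x0 &
      forall x : Y, absC (entry T (gY inv j x) 1 x 0 - phi (val x)) <= e /\
        absC (entry T (gY inv k x) 1 x 0 - phi' (val x)) <= e].

(** Each pair (j, l) is a bisection of the groupoid of germs of sigma; the finite list W stands for
    a compact set containing the support. *)
Definition word_supported (W : seq (seq 'I_N * seq 'I_N)) S := forall y s z r,
  entry S y s z r != 0 -> exists j l x,
    [/\ (j, l) \in W, y = wmap j x, z = wmap l x & s - r = (size j)%:Z - (size l)%:Z].

Definition finitely_approximable T := forall e : R, 0 < e ->
  exists S W, [/\ bounded_op S, opnorm (T - S) <= e & word_supported W S].

(* Closed conditions on a bounded operator which hold for all
   [rho_{m,n}(f) (x) upsilon_{m-n}]; they say that the matrix entries form a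
   uniform limit of continuous compactly supported functions on the groupoid of
   germs [(word_map j x, |j| - |l|, word_map l x)] of sigma. *)
Definition admissible : set (Hhat -> Hhat) := [set T | [/\ bounded_op T, shift_invariant T,
  word_entries_approximable T, letters_agree T & finitely_approximable T]].

Lemma word_supported0 W : word_supported W 0.
Proof. by move=> y s z r; rewrite entry0 eqxx. Qed.

Lemma admissible0 : admissible 0.
Proof.
split.
- exact: bop_zero.
- by [].
- by move=> j l; exact: approximable_cst.
- move=> j k x0 _ e e0; exists (fun=> 0), (fun=> 0); split=> // [x|x|x]; try exact: cvg_cst.
  by rewrite !entry0 subrr absC0; split; exact: ltW.
- move=> e e0; exists 0, [::]; split; first exact: bop_zero.
    by rewrite subrr opnorm0 ltW.
  exact: word_supported0.
Qed.

Lemma admissible_comb (a : C) S T : admissible S -> admissible T -> admissible (a *: S + T).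
Proof.
move=> [bS S1 S2 S4 S3] [bT T1 T2 T4 T3]; split.
- exact: bop_comb.
- by move=> t y s z r; rewrite !entry_comb S1 T1.
- by move=> j l; exact: (approximable_comb a (S2 j l) (T2 j l)).
- move=> j k x0 jk e e0.
  have a1 : 0 < absC a + 1 by rewrite ltr_wpDl ?absC_ge0.
  have [p [p' [cp cp' pp H]]] := S4 _ _ _ jk _ (divr_gt0 (divr_gt0 e0 a1) (ltr0n R 2)).
  have [q [q' [cq cq' qq K]]] := T4 _ _ _ jk _ (divr_gt0 e0 (ltr0n R 2)).
  exists (fun x => a * p x + q x), (fun x => a * p' x + q' x).
  split; [exact: continuous_comb|exact: continuous_comb|by rewrite /= pp qq|].
  move=> x; have [h1 h2] := H x; have [k1 k2] := K x.
  by rewrite !entry_comb; split; exact: absC_comb_le.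
- move=> e e0.
  have a1 : 0 < absC a + 1 by rewrite ltr_wpDl ?absC_ge0.
  have [S' [V [bS' SS' SV]]] := S3 _ (divr_gt0 (divr_gt0 e0 a1) (ltr0n R 2)).
  have [T' [W [bT' TT' TW]]] := T3 _ (divr_gt0 e0 (ltr0n R 2)).
  exists (a *: S' + T'), (V ++ W); split; first exact: bop_comb.
    have -> : a *: S + T - (a *: S' + T') = a *: (S - S') + (T - T').
      by rewrite scalerBr opprD addrACA.
    apply: le_trans (opnorm_comb _ (bop_sub bS bS') (bop_sub bT bT')) _.
    have : absC a * opnorm (S - S') <= e / 2.
      apply: le_trans (ler_wpM2l (absC_ge0 a) SS') _.
      rewrite mulrA ler_pM2r ?invr_gt0 // mulrA ler_pdivrMr //.
      by rewrite mulrC; apply: ler_wpM2l; [exact: ltW|rewrite lerDl].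
    by move=> h; apply: le_trans (lerD h TT') _; lra.
  move=> y s z r; rewrite entry_comb.
  have [/eqP S0|S0 _] := boolP (entry S' y s z r == 0); last first.
    have [j [l [x [jl ? ? ?]]]] := SV _ _ _ _ S0.
    by exists j, l, x; split=> //; rewrite mem_cat jl.
  rewrite S0 mulr0 add0r => T0.
  have [j [l [x [jl ? ? ?]]]] := TW _ _ _ _ T0.
  by exists j, l, x; split=> //; rewrite mem_cat jl orbT.
Qed.

Lemma admissible_limit T : bounded_op T ->
  (forall e : R, 0 < e -> exists2 S, admissible S & opnorm (T - S) < e) -> admissible T.
Proof.
move=> bT TK; split=> //.
- move=> t y s z r; apply/eqP; rewrite -subr_eq0; apply/eqP/absC_eq0/eqP.
  rewrite eq_le absC_ge0 andbT; apply: (@le0_small _ _ 2) => // e e0.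
  have [S [bS S1 _ _ _] ST] := TK _ e0.
  have h1 := entry_dist y (s + t) z (r + t) bT bS.
  have h2 := entry_dist y s z r bT bS.
  rewrite S1 in h1; rewrite absC_dist in h2; rewrite -(subrKA (entry S y s z r)).
  by apply: le_trans (absCD _ _) _; apply: le_trans (lerD h1 h2) _; lra.
- move=> j l; apply: approximable_limit => e e0.
  have [S [bS _ S2 _ _] ST] := TK _ e0.
  exists (fun x : Y => entry S (wmap j x) (size j)%:Z (wmap l x) (size l)%:Z); first exact: S2.
  by move=> x; apply: le_trans (entry_dist _ _ _ _ bT bS) (ltW ST).
- move=> j k x0 jk e e0; have e2 := divr_gt0 e0 (ltr0n R 2).
  have [S [bS _ _ S4 _] ST] := TK _ e2.
  have [p [p' [cp cp' pp H]]] := S4 _ _ _ jk _ e2.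
  exists p, p'; split=> // x; have [h1 h2] := H x; split.
    rewrite -(subrKA (entry S (gY inv j x) 1 x 0)).
    apply: le_trans (absCD _ _) _.
    by have := entry_dist (gY inv j x) 1 x 0 bT bS; move: ST h1; lra.
  rewrite -(subrKA (entry S (gY inv k x) 1 x 0)).
  apply: le_trans (absCD _ _) _.
  by have := entry_dist (gY inv k x) 1 x 0 bT bS; move: ST h2; lra.
- move=> e e0; have e2 := divr_gt0 e0 (ltr0n R 2).
  have [S [bS _ _ _ S3] ST] := TK _ e2.
  have [S' [W [bS' SS' SW]]] := S3 _ e2.
  exists S', W; split=> //; rewrite -(subrKA S).
  by apply: le_trans (opnormD (bop_sub bT bS) (bop_sub bS bS')) _; lra.
Qed.

Lemma admissible_closed_subspace : closed_subspace admissible.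
Proof.
split; [by move=> T []|exact: admissible0|by move=> a S T; exact: admissible_comb|exact: admissible_limit].
Qed.

Section Elementary.
Variables (m n : nat).
Variable f : ({ptws 'I_m.+1 -> X} * {ptws 'I_n.+1 -> X})%type -> C.
Hypothesis cf : {within chain_pairs g m n, continuous f}.

(** Stated for an arbitrary operator because two families have this matrix: the operators of [Emn]
    tensored with their shift, and the monomials. *)
Definition elementary (T : Hhat -> Hhat) := bounded_op T /\ forall y s z r,
  entry T y s z r =
    if dec m y is Some (w, x) then
      if dec n z is Some (k, x') then
        ((x == x') && (s - r == m%:Z - n%:Z))%:R *
          f (chain g m w (val x), chain g n k (val x))
      else 0
    else 0.

Lemma elementary_degree T y s z r : elementary T -> s - r != m%:Z - n%:Z ->
  entry T y s z r = 0.
Proof.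
move=> [_ TE] /negPf sr; rewrite TE sr.
case: (dec m y) => [[w x]|//]; case: (dec n z) => [[k x']|//].
by rewrite andbF mul0r.
Qed.

Lemma elementary_Fext T j l d : elementary T -> m = (size j + d)%N -> n = (size l + d)%N ->
  forall x : Y, entry T (wmap j x) (size j)%:Z (wmap l x) (size l)%:Z =
    Fext g sigma f j l d (val x).
Proof.
move=> [_ TE] mE nE x; rewrite TE.
have sE : (size j)%:Z - (size l)%:Z == m%:Z - n%:Z by rewrite mE nE; lia.
rewrite sE; case xE : (dec d x) => [[i x']|]; last first.
  have -> : dec m (wmap j x) = None by rewrite mE; exact: (dec_cat_None disj inj).
  rewrite /Fext.
  case: pselect => // Gx.
  by have [w [z]] := (dec_iter inv disj inj d x).1 Gx; rewrite xE.
have [si xE'] := dec_some xE.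
have -> : dec m (wmap j x) = Some (j ++ i, x').
  by rewrite mE; exact: (dec_cat_Some disj inj).
have -> : dec n (wmap l x) = Some (l ++ i, x').
  by rewrite nE; exact: (dec_cat_Some disj inj).
rewrite eqxx mul1r /Fext; case: pselect => [Gx|[]]; last first.
  by apply/(dec_iter inv disj inj); exists i, x'.
by rewrite /= xE' val_wmap !(cext_word sigmaK).
Qed.

Lemma elementary_admissible T : elementary T -> admissible T.
Proof.
move=> TE; have [bT Te] := TE; split=> //.
- move=> t y s z r; rewrite !Te.
  by have -> : s + t - (r + t) = s - r by lia.
- move=> j l.
  have [jl|jl] := eqVneq ((size j)%:Z - (size l)%:Z) (m%:Z - n%:Z); last first.
    have -> : (fun x : Y => entry T (wmap j x) (size j)%:Z (wmap l x) (size l)%:Z) = fun=> 0.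
      by apply/funext => x; rewrite (elementary_degree _ _ TE jl).
    exact: approximable_cst.
  (* If j is no longer than m, the missing letters are read off the base point. If it is longer, the
     surplus letters of j and l have to agree, and f is evaluated at the point they lead to. *)
  have [jm|mj] := leqP (size j) m.
    have mE : m = (size j + (m - size j))%N by lia.
    have nE : n = (size l + (m - size j))%N by lia.
    have := @approximable_continuous R X XX _
      (Fext_continuous g_continuous g_clopen sigma_cont sigmaK cf mE nE).
    congr approximable; apply/funext => x.
    by rewrite (elementary_Fext TE mE nE).
  have nl : (n < size l)%N by lia.
  pose u := drop m j; pose v := drop n l.
  have sj1 : size (take m j) = m by rewrite size_takel // ltnW.
  have sl1 : size (take n l) = n by rewrite size_takel // ltnW.
  have E x : entry T (wmap j x) (size j)%:Z (wmap l x) (size l)%:Z =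
     if u == v then f (chain g m (take m j) (word_map g u (val x)),
                       chain g n (take n l) (word_map g u (val x))) else 0.
    rewrite Te (introT eqP jl).
    have -> : dec m (wmap j x) = Some (take m j, wmap u x).
      by rewrite -{1}(cat_take_drop m j) wmap_cat dec_wmap.
    have -> : dec n (wmap l x) = Some (take n l, wmap v x).
      by rewrite -{1}(cat_take_drop n l) wmap_cat dec_wmap.
    rewrite andbT val_wmap.
    have [->|uv] := eqVneq u v; first by rewrite eqxx mul1r.
    have [/(wmap_inj disj inj)[]|_] := eqVneq (wmap u x) (wmap v x); last by rewrite mul0r.
      by rewrite /u /v !size_drop; lia.
    by move/eqP; rewrite (negPf uv).
  under eq_fun do rewrite E.
  case: eqP => _; last exact: approximable_cst.
  apply: (@approximable_continuous _ _ _ (fun x => f (chain g m (take m j) (word_map g u x),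
                       chain g n (take n l) (word_map g u x)))) => x.
  apply: (@continuous_comp _ _ _ (word_map g u)
     (fun x => f (chain g m (take m j) x, chain g n (take n l) x))).
    exact: word_map_continuous.
  exact: chain_kernel_continuous.
- move=> j k x0 jk e e0.
  have [mn|mn] := eqVneq (1 - 0 : int) (m%:Z - n%:Z); last first.
    exists (fun=> 0), (fun=> 0); split=> // [x|x|x]; try exact: cvg_cst.
    by rewrite !(elementary_degree _ _ TE mn) subrr absC0; split; exact: ltW.
  have mE : m = (1 + n)%N by lia.
  have cF i := Fext_continuous g_continuous g_clopen sigma_cont sigmaK cf
    (mE : m = size [:: i] + n)%N (erefl : n = size [::] + n)%N.
  exists (Fext g sigma f [:: j] [::] n), (Fext g sigma f [:: k] [::] n).
  split; [exact: cF|exact: cF| |].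
    (* Only the top entry of the longer chain, at position m, involves the letter j or k, and there
       both letters give the common image of x0. *)
    rewrite /Fext; case: pselect => // Gx /=; congr (f (_, _)).
    apply/funext => i; rewrite /cext.
    case E : (m - i)%N => [|p] //=; have -> : (n - i = 0)%N by lia.
    by rewrite /= jk.
  have h i (x : Y) := elementary_Fext TE (mE : m = size [:: i] + n)%N (erefl : n = size [::] + n)%N x.
  move=> x; rewrite -(h j x) -(h k x) !subrr absC0.
  by split; exact: ltW.
- move=> e e0; exists T, [seq (val w, val k) | w <- enum {: m.-tuple 'I_N}, k <- enum {: n.-tuple 'I_N}].
  split=> //; first by rewrite subrr opnorm0 ltW.
  move=> y s z r; rewrite Te.
  case yE : (dec m y) => [[w x]|]; last by rewrite eqxx.
  case zE : (dec n z) => [[k x']|]; last by rewrite eqxx.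
  have [xx|_] := eqVneq x x'; last by rewrite mul0r eqxx.
  have [sr _|_] := eqVneq (s - r) (m%:Z - n%:Z); last by rewrite mul0r eqxx.
  have [/eqP sw ->] := dec_some yE; have [/eqP sk ->] := dec_some zE; rewrite -xx.
  exists w, k, x; split=> //; last by rewrite sr (eqP sw) (eqP sk).
  apply/allpairsP; exists (Tuple sw, Tuple sk).
  by split=> //=; rewrite mem_enum.
Qed.

End Elementary.
End Key.

(** * The algebra generated by the representation *)

Section GaugeAlgebra.
Variables (R : realType) (X : topologicalType) (N : nat) (g : 'I_N -> X -> X) (XX : set X).
Variable sigma : X -> X.
Hypothesis X_compact : compact [set: X].
Hypothesis g_continuous : forall k, continuous (g k).
Hypothesis inv : completely_invariant g XX.
Hypothesis disj : trivIset setT (fun k => g k @` XX).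
Hypothesis inj : forall k, set_inj XX (g k).
Hypothesis g_clopen : forall n, clopen (ifs_iter g n setT).
Hypothesis sigma_cont : {within ifs_image g setT, continuous sigma}.
Hypothesis sigmaK : forall k x, sigma (g k x) = x.
Local Notation Y := (set_type XX).
Local Notation C := (Cx R).
Local Notation H := (ell2 R Y).
Local Notation Hhat := (ell2 R (Y * int)%type).
Local Notation dec := (dec inv).
Local Notation wmap := (wmap inv).
Local Notation hatA := (@hatrhoA R X XX).
Local Notation hatE := (@hatrhoE R X N g XX).
Implicit Types (a b c : X -> C).

Lemma hatA_spec a (M : R) : 0 <= M -> (forall x, absC (a x) <= M) ->
  [/\ bounded_op (hatA a), opnorm (hatA a) <= M &
    forall u y s, hatA a u (y, s) = a (val y) * u (y, s)].
Proof.
move=> M0 aM; have [bA AM AE] := rhoA_spec XX M0 aM.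
split; [exact: bop_tens|by apply: le_trans (opnorm_tens _ bA) AM|].
by move=> u y s; rewrite op_tensE // AE sliceE subr0.
Qed.

Lemma hatAE a u y s : continuous a -> hatA a u (y, s) = a (val y) * u (y, s).
Proof.
move=> ca; have [M M0 aM] := continuous_absC_bounded X_compact ca.
by have [_ _ ->] := hatA_spec M0 aM.
Qed.

Lemma bop_hatA a : continuous a -> bounded_op (hatA a).
Proof.
move=> ca; have [M M0 aM] := continuous_absC_bounded X_compact ca.
by have [] := hatA_spec M0 aM.
Qed.

Lemma continuousM2 a b : continuous a -> continuous b -> continuous (fun x => a x * b x).
Proof. by move=> ca cb x; apply: cvgM; [exact: ca|exact: cb]. Qed.

Lemma continuous_one : continuous (fun _ : X => 1 : C).
Proof. exact: cst_continuous. Qed.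

Lemma hatA_mul a b : continuous a -> continuous b ->
  hatA a \o hatA b = hatA (fun x => a x * b x).
Proof.
move=> ca cb; have cab := continuousM2 ca cb.
apply/funext => u; apply: ell2P => -[y s]; rewrite [LHS]/=.
by rewrite (hatAE _ _ _ ca) (hatAE _ _ _ cb) (hatAE _ _ _ cab) mulrA.
Qed.

Lemma hatA1 : hatA (fun=> 1) = id.
Proof.
apply/funext => u; apply: ell2P => -[y s]; by rewrite (hatAE _ _ _ continuous_one) mul1r.
Qed.

Lemma continuous_conj a : continuous a -> continuous (fun x => (a x)^*).
Proof.
move=> ca x; apply: cvg_absC_dist => e e0.
apply: filterS (continuous_absC_near (ca x) e0) => z.
by rewrite -rmorphB absC_conj.
Qed.

Lemma adj_hatA a : continuous a -> adj (hatA a) = hatA (fun x => (a x)^*).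
Proof.
move=> ca; have cj := continuous_conj ca; apply: adj_eq; first exact: bop_hatA.
move=> u v; apply: ip_ext => -[y s]; rewrite (hatAE _ _ _ ca) (hatAE _ _ _ cj).
by rewrite rmorphM /= mulrCA mulrA.
Qed.

Lemma branch_kernel_continuous (f : X * X -> C) k :
  {within ifs_graph g, continuous f} -> continuous (fun x => f (g k x, x)).
Proof.
move=> cf x.
apply: (@within_cvg _ _ _ (ifs_graph g) f (fun z => (g k z, z)) setT x cf openT) => //.
  by move=> z _; exists k => //; exists z.
by apply: cvg_pair; [exact: g_continuous|exact: cvg_id].
Qed.

Lemma hatE_spec (f : X * X -> C) : {within ifs_graph g, continuous f} ->
  bounded_op (hatE f) /\ forall u y s, hatE f u (y, s) =
    if dec 1 y is Some (w, x) then f (val y, val x) * u (x, s - 1) else 0.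
Proof.
move=> cf.
have cfk k : continuous (fun x => f (g k x, x)) by exact: branch_kernel_continuous.
have /choice[M MP] k : exists M : R, 0 <= M /\ forall x, absC (f (g k x, x)) <= M.
  by have [M M0 fM] := continuous_absC_bounded X_compact (cfk k); exists M.
have S0 : 0 <= \sum_k M k by apply: sumr_ge0 => k _; case: (MP k).
have [k x|bE EE] := rhoE_spec (R := R) inv disj inj (f := f) S0.
  rewrite (bigD1 k) //=; apply: le_trans (proj2 (MP k) x) _; rewrite lerDl.
  by apply: sumr_ge0 => j _; case: (MP j).
split; first exact: bop_tens.
move=> u y s; rewrite op_tensE // EE.
by case: (dec 1 y) => [[w x]|//]; rewrite sliceE.
Qed.

(** Composition with sigma, cut off to gamma(X) and raised by one degree. *)
Definition vop : Hhat -> Hhat := hatE (fun=> 1).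

Lemma one_within : {within ifs_graph g, continuous (fun=> 1 : C)}.
Proof. by move=> x; exact: cvg_cst. Qed.

Lemma bop_vop : bounded_op vop.
Proof. by have [] := hatE_spec one_within. Qed.

Lemma vopE u y s : vop u (y, s) = if dec 1 y is Some (w, x) then u (x, s - 1) else 0.
Proof.
have [_ ->] := hatE_spec one_within.
by case: (dec 1 y) => [[w x]|//]; rewrite mul1r.
Qed.

Definition vpow (m : nat) : Hhat -> Hhat := fun u => iter m vop u.

Lemma bop_vpow m : bounded_op (vpow m).
Proof.
elim: m => [|m IH]; first exact: bop_id.
exact: (bop_comp bop_vop IH).
Qed.

Lemma vpowD m n : vpow (m + n) = vpow m \o vpow n.
Proof. by apply/funext => u; rewrite /vpow /= iterD. Qed.

Lemma vpowE m u y s :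
  vpow m u (y, s) = if dec m y is Some (w, x) then u (x, s - m%:Z) else 0.
Proof.
elim: m y s => [|m IH] y s; first by rewrite dec0 //= subr0.
rewrite -[vpow m.+1 u]/(vop (vpow m u)) vopE.
case yE : (dec 1 y) => [[w x]|].
  have [sw ->] := dec_some yE; rewrite IH.
  case xE : (dec m x) => [[v z]|].
    rewrite (dec_cat_Some disj inj sw xE); congr (u (_, _)); lia.
  by rewrite (dec_cat_None disj inj sw xE).
case zE : (dec m.+1 y) => [[[|k w] x]|//].
  by have [] := dec_some zE.
have [/= _ yE'] := dec_some zE; move: yE.
by rewrite yE' -[gY inv k _]/(wmap [:: k] (wmap w x)) dec_wmap.
Qed.

Definition wpow (n : nat) : Hhat -> Hhat := adj (vpow n).

Lemma bop_wpow n : bounded_op (wpow n).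
Proof. exact/bop_adj/bop_vpow. Qed.

Lemma wpowD m n : wpow (m + n) = wpow n \o wpow m.
Proof. by rewrite /wpow vpowD adj_comp //; exact: bop_vpow. Qed.

Definition pullback (m : nat) a (x : X) : C :=
  if pselect (ifs_iter g m setT x) then a (iter m sigma x) else 0.

Lemma pullback_continuous m a : continuous a -> continuous (pullback m a).
Proof.
move=> ca; apply: (clopen_cutoff_continuous (g_clopen m)) => x Gx.
apply: (@continuous_comp _ _ _ (iter m sigma) a); last exact: ca.
exact: (iter_sigma_continuous g_clopen sigma_cont sigmaK).
Qed.

Lemma vpow_hatA m a : continuous a -> vpow m \o hatA a = hatA (pullback m a) \o vpow m.
Proof.
move=> ca; have cE := pullback_continuous (m := m) ca.
apply/funext => u; apply: ell2P => -[y s]; rewrite [LHS]/= [RHS]/=.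
rewrite (hatAE _ _ _ cE) !vpowE.
case yE : (dec m y) => [[w x]|]; last by rewrite mulr0.
rewrite (hatAE _ _ _ ca); congr (_ * _); have [sw yE'] := dec_some yE.
rewrite /pullback; case: pselect => [Gy|[]]; last first.
  by apply/(dec_iter inv disj inj); exists w, x.
by rewrite /= yE' val_wmap (sigma_word sigmaK) ?sw // -sw drop_size.
Qed.

(** The adjoint of [vpow_hatA] for the conjugate function; conjugating twice restores a. *)
Lemma hatA_wpow m a : continuous a -> hatA a \o wpow m = wpow m \o hatA (pullback m a).
Proof.
move=> ca; have ca' := continuous_conj ca.
have cE := pullback_continuous (m := m) ca; have cE' := pullback_continuous (m := m) ca'.
have := vpow_hatA m ca' => /(congr1 (@adj R _)).
rewrite (adj_comp (bop_vpow m) (bop_hatA ca')) (adj_comp (bop_hatA cE') (bop_vpow m)).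
rewrite (adj_hatA ca') (adj_hatA cE') -/(wpow m) => E.
have E1 : (fun x => ((a x)^*)^*) = a by apply/funext => x; rewrite conjCK.
rewrite E1 in E; rewrite E; congr (_ \o hatA _); apply/funext => x.
by rewrite /pullback; case: pselect => Gx /=; rewrite ?conjCK ?conjC0.
Qed.

(** The n-th power of the transfer operator of sigma with weight 1. It sums over words and not over
    points: coinciding branches count with multiplicity, which keeps the result continuous. *)
Definition transfer (n : nat) a (x : X) : C := \sum_(w : n.-tuple 'I_N) a (word_map g w x).

Lemma continuous_sum (J : Type) (s : seq J) (f : J -> X -> C) :
  (forall j, continuous (f j)) -> continuous (fun x => \sum_(j <- s) f j x).
Proof.
move=> cf; elim: s => [|j s IH].
  by under eq_fun do rewrite big_nil; exact: cst_continuous.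
under eq_fun do rewrite big_cons.
by move=> x; apply: cvgD; [exact: cf|exact: IH].
Qed.

Lemma transfer_continuous n a : continuous a -> continuous (transfer n a).
Proof.
move=> ca; apply: continuous_sum => w x.
by apply: continuous_comp; [exact: word_map_continuous|exact: ca].
Qed.

Lemma vpow_delta n (x : Y) (s : int) :
  vpow n (delta R (x, s)) = \sum_(w : n.-tuple 'I_N) delta R (wmap w x, s + n%:Z).
Proof.
apply: ell2P => -[y r]; rewrite vpowE ell2_sum.
case yE : (dec n y) => [[w z]|]; last first.
  rewrite big1 // => w _; rewrite delta_neq // xpair_eqE negb_and.
  apply/orP; left; apply: contra_eqN yE => /eqP ->.
  by rewrite dec_wmap ?size_tuple.
have [/eqP sw ->] := dec_some yE; pose wt := Tuple sw.
rewrite (bigD1 wt) //= big1 ?addr0 => [|v vw].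
  rewrite !deltaE !xpair_eqE; congr (_%:R); congr nat_of_bool; congr (_ && _).
    by apply/eqP/eqP => [->|/(wmap_inj disj inj)[]].
  by apply/eqP/eqP; lia.
rewrite delta_neq // xpair_eqE negb_and; apply/orP; left; apply: contraNneq vw.
move=> /(wmap_inj disj inj)[]; first by rewrite size_tuple (eqP sw).
by move=> vw _; apply/eqP/val_inj.
Qed.

Lemma wpow_hatA_vpow n b : continuous b ->
  wpow n \o hatA b \o vpow n = hatA (transfer n b).
Proof.
move=> cb; have cT := transfer_continuous (n := n) cb.
have bW := bop_wpow n; have bV := bop_vpow n; have bB := bop_hatA cb.
apply: bop_ext.
- exact: (bop_comp (bop_comp bW bB) bV).
- exact: bop_hatA.
move=> [z r] /=; apply: ell2P => -[x s].
rewrite (hatAE _ _ _ cT) -ip_delta ip_adjr // vpow_delta ip_suml /transfer mulr_suml.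
apply: eq_bigr => w _; rewrite ip_delta (hatAE _ _ _ cb) val_wmap; congr (_ * _).
by rewrite vpowE dec_wmap ?size_tuple // addrK.
Qed.

Definition monomial (T : Hhat -> Hhat) := exists m n a b,
  [/\ continuous a, continuous b & T = hatA a \o vpow m \o wpow n \o hatA b].

Lemma bop_monomial T : monomial T -> bounded_op T.
Proof.
move=> [m [n [a [b [ca cb ->]]]]].
have bA := bop_hatA ca; have bB := bop_hatA cb.
have bW := bop_wpow n; have bV := bop_vpow m.
exact: (bop_comp (bop_comp (bop_comp bA bV) bW) bB).
Qed.

(** In the middle [wpow n] meets [vpow p]. The shorter power is absorbed into a transfer operator,
    and the resulting coefficient moves outwards by [vpow_hatA] or [hatA_wpow]. *)
Lemma monomial_comp S T : monomial S -> monomial T -> monomial (S \o T).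
Proof.
move=> [m [n [a [b [ca cb ->]]]]] [p [q [c [d [cc cd ->]]]]].
pose e := fun x => b x * c x.
have ce : continuous e by exact: continuousM2.
have -> : hatA a \o vpow m \o wpow n \o hatA b \o (hatA c \o vpow p \o wpow q \o hatA d) =
   hatA a \o vpow m \o (wpow n \o (hatA b \o hatA c) \o vpow p) \o wpow q \o hatA d by [].
rewrite (hatA_mul cb cc) -/e.
have [np|pn] := leqP n p.
- have pE : p = (n + (p - n))%N by lia.
  have -> : wpow n \o hatA e \o vpow p = hatA (transfer n e) \o vpow (p - n).
    by rewrite -(wpow_hatA_vpow n ce) {1}pE vpowD.
  have cT := transfer_continuous (n := n) ce.
  have cX := pullback_continuous (m := m) cT.
  exists (m + (p - n))%N, q, (fun x => a x * pullback m (transfer n e) x), d.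
  split; [exact: continuousM2|exact: cd|rewrite -(hatA_mul ca cX) vpowD].
  have -> : hatA a \o hatA (pullback m (transfer n e)) \o (vpow m \o vpow (p - n)) =
    hatA a \o (hatA (pullback m (transfer n e)) \o vpow m) \o vpow (p - n) by [].
  by rewrite -(vpow_hatA m cT).
- have nE : n = (p + (n - p))%N by lia.
  have -> : wpow n \o hatA e \o vpow p = wpow (n - p) \o hatA (transfer p e).
    by rewrite -(wpow_hatA_vpow p ce) {1}nE wpowD.
  have cT := transfer_continuous (n := p) ce.
  have cX := pullback_continuous (m := q) cT.
  exists m, (q + (n - p))%N, a, (fun x => pullback q (transfer p e) x * d x).
  split; [exact: ca|exact: continuousM2|rewrite -(hatA_mul cX cd) wpowD].
  have -> : hatA a \o vpow m \o (wpow (n - p) \o wpow q) \o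
     (hatA (pullback q (transfer p e)) \o hatA d) =
    hatA a \o vpow m \o wpow (n - p) \o (wpow q \o hatA (pullback q (transfer p e))) \o hatA d by [].
  by rewrite -(hatA_wpow q cT).
Qed.

Lemma monomial_adj T : monomial T -> monomial (adj T).
Proof.
move=> [m [n [a [b [ca cb ->]]]]].
have bA := bop_hatA ca; have bB := bop_hatA cb.
have bW := bop_wpow n; have bV := bop_vpow m.
have bAV := bop_comp bA bV; have bAVW := bop_comp bAV bW.
exists n, m, (fun x => (b x)^*), (fun x => (a x)^*); split.
- exact: continuous_conj.
- exact: continuous_conj.
- rewrite (adj_comp bAVW bB) (adj_comp bAV bW) (adj_comp bA bV).
  by rewrite (adj_hatA ca) (adj_hatA cb) /wpow (adjK (bop_vpow n)).
Qed.

Lemma monomial_span_cstar : cstar_subalgebra (closed_span monomial).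
Proof.
apply: cstar_closed_span.
- exact: bop_monomial.
- by move=> S T MS MT; apply: closed_span_sub; exact: monomial_comp.
- by move=> T MT; apply: closed_span_sub; exact: monomial_adj.
Qed.

Lemma wpow0 : wpow 0 = id.
Proof. by apply: adj_eq => //; exact: bop_id. Qed.

Lemma hatA_monomial a : continuous a -> monomial (hatA a).
Proof.
move=> ca; exists 0, 0, a, (fun=> 1); split; [exact: ca|exact: continuous_one|].
by rewrite hatA1 wpow0.
Qed.

(** The graph of gamma is the graph of sigma over gamma(X) with its coordinates swapped, so f is a
    function of y alone through y -> (y, sigma y). *)
Lemma hatE_decomp (f : X * X -> C) : {within ifs_graph g, continuous f} ->
  exists2 a, continuous a & hatE f = hatA a \o vop.
Proof.
move=> cf; pose a x : C := if pselect (ifs_iter g 1 setT x) then f (x, sigma x) else 0.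
have ca : continuous a.
  apply: (clopen_cutoff_continuous (g_clopen 1)) => x Gx; have [oG _] := g_clopen 1.
  apply: (@within_cvg _ _ _ (ifs_graph g) f (fun z => (z, sigma z)) _ x cf oG) => //.
    by move=> z [k _ [t _ <-]]; rewrite sigmaK; exists k => //; exists t.
  have cs := sigma_continuous_at g_clopen sigma_cont Gx.
  exact: (cvg_pair (@cvg_id _ (nbhs x)) cs).
exists a; first exact: ca.
have [_ fE] := hatE_spec cf.
apply/funext => u; apply: ell2P => -[y s]; rewrite [RHS]/= fE (hatAE _ _ _ ca) vopE.
case yE : (dec 1 y) => [[w x]|]; last by rewrite mulr0.
congr (_ * _); rewrite /a; case: pselect => [Gy|[]]; last first.
  by apply/(dec_iter inv disj inj); exists w, x.
congr (f (_, _)); have [sw ->] := dec_some yE.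
by case: w sw yE => [|k [|]] /=.
Qed.

Lemma hatE_monomial f : {within ifs_graph g, continuous f} -> monomial (hatE f).
Proof.
move=> cf; have [a ca ->] := hatE_decomp cf.
exists 1, 0, a, (fun=> 1); split; [exact: ca|exact: continuous_one|].
by rewrite hatA1 wpow0.
Qed.

Lemma monomial_elementary T : monomial T -> exists m n
  (f : ({ptws 'I_m.+1 -> X} * {ptws 'I_n.+1 -> X})%type -> C),
  {within chain_pairs g m n, continuous f} /\ elementary inv f T.
Proof.
move=> /[dup] MT [m [n [a [b [ca cb TE]]]]].
(* The entry at [ord_max] is the top of a chain, the image of the base point under the whole
   word. *)
exists m, n, (fun p => a (p.1 ord_max) * b (p.2 ord_max)); split.
  apply: continuous_subspaceT => p; apply: cvgM.
    apply: (@continuous_comp _ _ _ (fun p : {ptws 'I_m.+1 -> X} * {ptws 'I_n.+1 -> X} => p.1 ord_max) a); last exact: ca.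
    apply: (@continuous_comp _ _ _ fst (fun q : {ptws 'I_m.+1 -> X} => q ord_max)); first exact: cvg_fst.
    exact: (@proj_continuous _ (fun=> X) ord_max).
  apply: (@continuous_comp _ _ _ (fun p : {ptws 'I_m.+1 -> X} * {ptws 'I_n.+1 -> X} => p.2 ord_max) b); last exact: cb.
  apply: (@continuous_comp _ _ _ snd (fun q : {ptws 'I_n.+1 -> X} => q ord_max)); first exact: cvg_snd.
  exact: (@proj_continuous _ (fun=> X) ord_max).
split; first exact: bop_monomial.
have bV := bop_vpow m; have bW := bop_wpow n.
move=> y s z r; rewrite /entry TE [LHS]/= (hatAE _ _ _ ca) vpowE.
have -> : hatA b (delta R (z, r)) = b (val z) *: delta R (z, r).
  apply: ell2P => -[t q]; rewrite (hatAE _ _ _ cb) ell2Z !deltaE.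
  by have [[-> _]//|_] := eqVneq (t, q) (z, r); rewrite !mulr0.
case yE : (dec m y) => [[w x]|]; last by rewrite mulr0.
rewrite bopZ // ell2Z adj_entry; last exact: bop_vpow.
rewrite vpowE; case zE : (dec n z) => [[k x']|]; last by rewrite conjC0 !mulr0.
rewrite /= /chain !subnn !drop0.
have [_ yE'] := dec_some yE; have [_ zE'] := dec_some zE.
rewrite deltaE xpair_eqE conjC_nat (eq_sym x' x).
have [xx|_] := eqVneq x x'; last by rewrite !(mulr0, mul0r).
rewrite {2}xx -!(val_wmap inv) -yE' -zE' mulrA mulrC; congr (_%:R * _).
by congr nat_of_bool; apply/eqP/eqP; lia.
Qed.

Lemma monomial_span_admissible : closed_span monomial `<=` admissible inv.
Proof.
apply: closed_span_min; first exact: admissible_closed_subspace.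
move=> T /monomial_elementary[m [n [f [cf fT]]]].
exact: (elementary_admissible g_continuous disj inj g_clopen sigma_cont sigmaK cf fT).
Qed.

Definition gens : set (Hhat -> Hhat) :=
  [set hatA a | a in [set a : X -> C | continuous a]] `|`
  [set hatE f | f in [set f : X * X -> C | {within ifs_graph g, continuous f}]].

Lemma gens_monomial : gens `<=` monomial.
Proof.
move=> T [[a /= ca <-]|[f /= cf <-]]; [exact: hatA_monomial|exact: hatE_monomial].
Qed.

Lemma gens_bop : gens `<=` @bounded_op R _.
Proof. by move=> T /gens_monomial; exact: bop_monomial. Qed.

Local Notation Q := (cstar_hatrho R g XX).

Lemma cstar_hatrho_cstar : cstar_subalgebra Q.
Proof. exact: cstar_generated_cstar gens_bop. Qed.

(** Admissibility is only known to be linear and closed, not multiplicative, so the generated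
    algebra is first enclosed in the closed span of the monomials. *)
Lemma cstar_hatrho_admissible : Q `<=` admissible inv.
Proof.
move=> T QT; apply: monomial_span_admissible; move: T QT.
apply: cstar_generated_min; first exact: monomial_span_cstar.
by move=> T /gens_monomial; exact: closed_span_sub.
Qed.

Lemma cstar_hatrho_hatA a : continuous a -> Q (hatA a).
Proof. by move=> ca; apply: cstar_generated_sub; left; exists a. Qed.

Lemma cstar_hatrho_hatE f : {within ifs_graph g, continuous f} -> Q (hatE f).
Proof. by move=> cf; apply: cstar_generated_sub; right; exists f. Qed.

End GaugeAlgebra.

(** * The diagonal subalgebra *)

Section DiagonalOperators.
Variables (R : realType) (I : choiceType).
Local Notation C := (Cx R).
Local Notation H := (ell2 R I).

(** Coordinate i of T u is the inner product of u with [adj T (delta R i)], a multiple of one basis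
    vector; this evaluates T on every vector without approximation. *)
Lemma diag_apply (T : H -> H) (c : I -> C) : bounded_op T ->
  (forall i j, T (delta R i) j = (i == j)%:R * c i) -> forall u i, T u i = c i * u i.
Proof.
move=> bT Tc u i; rewrite -ip_delta -ip_adjl //.
have -> : adj T (delta R i) = (c i)^* *: delta R i.
  apply: ell2P => j; rewrite adj_entry // Tc ell2Z deltaE.
  by have [->|_] := eqVneq j i; rewrite ?mul1r ?mulr1 // mul0r mulr0 conjC0.
by rewrite ipZl conjCK ip_delta.
Qed.

Lemma diag_opnorm (T : H -> H) (c : I -> C) (M : R) : 0 <= M ->
  (forall u i, T u i = c i * u i) -> (forall i, absC (c i) <= M) -> opnorm T <= M.
Proof.
move=> M0 Tc cM; have [T' [_ T'M T'c]] := diag_exists M0 cM.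
by have -> : T = T' by apply/funext => u; apply: ell2P => i; rewrite Tc T'c.
Qed.

End DiagonalOperators.

Lemma separating_function (R : realType) (X : topologicalType) (x z : X) :
  compact [set: X] -> hausdorff_space X -> x != z ->
  exists a : X -> Cx R, [/\ continuous a, a x = 1, a z = 0 & forall y, absC (a y) <= 1].
Proof.
move=> cX hX xz.
have nX := compact_normal hX cX.
have c1 (y : X) : closed [set y] by apply: accessible_closed_set1; exact: hausdorff_accessible.
have xz0 : [set z] `&` [set x] = set0.
  by apply/seteqP; split=> // y /= [-> zx]; move: xz; rewrite zx eqxx.
have sep := normal_uniform_separator nX (c1 z) (c1 x) xz0.
pose f := @Urysohn X R [set z] [set x].
have cf : continuous f by exact: Urysohn_continuous.
exists (fun y => toC (f y)); split.
- move=> y; apply: cvg_absC_dist => e e0.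
  have /cvgrPdist_lt /(_ _ e0) := cf y; apply: filterS => t.
  by rewrite -toCN -toCD absC_toC.
- by rewrite /f; have -> : Urysohn [set z] [set x] x = 1 :> R by apply: (Urysohn_sub1 sep); exists x.
- by rewrite /f; have -> : Urysohn [set z] [set x] z = 0 :> R by apply: (Urysohn_sub0 sep); exists z.
- move=> y; rewrite absC_toC.
  have : `[0, 1]%classic (f y) by apply: (@Urysohn_range X R [set z] [set x]); exists y.
  by rewrite /= in_itv /= => /andP[f0 f1]; rewrite ger0_norm.
Qed.

Section DiagonalSubalgebra.
Variables (R : realType) (X : topologicalType) (N : nat) (g : 'I_N -> X -> X) (XX : set X).
Variable sigma : X -> X.
Hypothesis X_compact : compact [set: X].
Hypothesis X_hausdorff : hausdorff_space X.
Hypothesis g_continuous : forall k, continuous (g k).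
Hypothesis XX_dense : dense XX.
Hypothesis inv : completely_invariant g XX.
Hypothesis disj : trivIset setT (fun k => g k @` XX).
Hypothesis inj : forall k, set_inj XX (g k).
Hypothesis g_free : essentially_free g.
Hypothesis g_clopen : forall n, clopen (ifs_iter g n setT).
Hypothesis sigma_cont : {within ifs_image g setT, continuous sigma}.
Hypothesis sigmaK : forall k x, sigma (g k x) = x.
Local Notation Y := (set_type XX).
Local Notation C := (Cx R).
Local Notation H := (ell2 R Y).
Local Notation Hhat := (ell2 R (Y * int)%type).
Local Notation dec := (dec inv).
Local Notation wmap := (wmap inv).
Local Notation hatA := (@hatrhoA R X XX).
Local Notation hatE := (@hatrhoE R X N g XX).
Local Notation admissible := (@admissible R X N g XX inv).
Implicit Types (a b c : X -> C).

Definition diagA : set (Hhat -> Hhat) :=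
  closed_span [set hatA a | a in [set a : X -> C | continuous a]].

Lemma hatA_bop_set : [set hatA a | a in [set a : X -> C | continuous a]] `<=` @bounded_op R _.
Proof. by move=> _ [a /= ca <-]; exact: bop_hatA. Qed.

Lemma diagA_closed : closed_subspace diagA.
Proof. exact: closed_span_closed hatA_bop_set. Qed.

Lemma bop_diagA T : diagA T -> bounded_op T.
Proof. exact: closed_subspace_bop diagA_closed. Qed.

Lemma diagA_hatA a : continuous a -> diagA (hatA a).
Proof. by move=> ca; apply: closed_span_sub; exists a. Qed.

Lemma diagA_cstar : cstar_subalgebra diagA.
Proof.
apply: cstar_closed_span; first exact: hatA_bop_set.
  move=> _ _ [a /= ca <-] [b /= cb <-]; rewrite (hatA_mul XX X_compact ca cb).
  apply: (@diagA_hatA (fun x => a x * b x)); exact: continuousM2.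
move=> _ [a /= ca <-]; rewrite (adj_hatA XX X_compact ca).
apply: (@diagA_hatA (fun x => (a x)^*)); exact: continuous_conj.
Qed.

Lemma diagA_abelian : abelian_op diagA.
Proof.
apply: abelian_closed_span; first exact: hatA_bop_set.
move=> _ _ [a /= ca <-] [b /= cb <-]; rewrite (hatA_mul XX X_compact ca cb) (hatA_mul XX X_compact cb ca).
by congr hatA; apply/funext => x; rewrite mulrC.
Qed.

Lemma diagA_admissible : diagA `<=` admissible.
Proof.
apply: closed_span_min; first exact: admissible_closed_subspace.
move=> _ [a /= ca <-].
apply: (monomial_span_admissible X_compact g_continuous inv disj inj g_clopen sigma_cont sigmaK).
apply: closed_span_sub; exact: (hatA_monomial g XX X_compact ca).
Qed.

Lemma entry_closed_subspace (y z : Y) (s r : int) :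
  closed_subspace [set T : Hhat -> Hhat | bounded_op T /\ entry T y s z r = 0].
Proof.
split=> [T []//|||].
- by split; first exact: bop_zero.
- move=> c S T [bS S0] [bT T0]; split; first exact: bop_comb.
  by rewrite entry_comb S0 T0 mulr0 addr0.
- move=> T bT TS; split=> //; apply/absC_eq0/eqP; rewrite eq_le absC_ge0 andbT.
  apply: (@le0_small _ _ 1) => // e e0; have [S [bS S0] ST] := TS e e0.
  by have := entry_dist y s z r bT bS; rewrite S0 subr0 mul1r => /le_trans; apply; exact: ltW.
Qed.

Lemma diagA_offdiag T y s z r : diagA T -> (y, s) != (z, r) -> entry T y s z r = 0.
Proof.
move=> DT yz; suff [] : [set T : Hhat -> Hhat | bounded_op T /\ entry T y s z r = 0] T by [].
move: T DT; apply: closed_span_min; first exact: entry_closed_subspace.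
move=> _ [a /= ca <-]; split; first exact: bop_hatA.
by rewrite /entry (hatAE X_compact _ _ _ ca) delta_neq ?mulr0.
Qed.

Lemma admissible_entry0 T y s : admissible T -> entry T y s y s = entry T y 0 y 0.
Proof. by move=> [_ TS _ _ _]; rewrite -(TS s y 0 y 0) !add0r. Qed.

Lemma diagA_apply T : diagA T -> forall u y s, T u (y, s) = entry T y 0 y 0 * u (y, s).
Proof.
move=> DT u y s.
apply: (@diag_apply _ _ T (fun p : Y * int => entry T p.1 0 p.1 0) (bop_diagA DT)).
move=> [z r] [t q]; have [[<- <-]|zt] := eqVneq (z, r) (t, q).
  by rewrite mul1r; exact: (admissible_entry0 _ _ (diagA_admissible DT)).
by rewrite mul0r; apply: (diagA_offdiag DT); rewrite eq_sym.
Qed.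

(** The norm of a diagonal operator is the supremum of its entries, so uniform approximants of [psi]
    give norm approximants [hatA phi]. *)
Lemma diagA_intro T (psi : Y -> C) : bounded_op T -> approximable psi ->
  (forall u y s, T u (y, s) = psi y * u (y, s)) -> diagA T.
Proof.
move=> bT ap Tpsi; have [_ _ _ dn] := diagA_closed.
apply: dn => // e e0; have e2 := divr_gt0 e0 (ltr0n R 2).
have [phi cphi pp] := ap _ e2; exists (hatA phi); first exact: diagA_hatA.
suff : opnorm (T - hatA phi) <= e / 2 by move=> h; lra.
apply: (@diag_opnorm _ _ _ (fun p : Y * int => psi p.1 - phi (val p.1))); first exact: ltW.
  by move=> u [y s]; rewrite opB ell2B Tpsi (hatAE X_compact _ _ _ cphi) mulrBl.
by move=> [y s]; exact: pp.
Qed.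

Lemma admissible_approximable T : admissible T -> approximable (fun y : Y => entry T y 0 y 0).
Proof. by move=> [_ _ /(_ [::] [::])]. Qed.

(* A nonzero entry of degree s - r <> 0 at a diagonal position would persist on
   an open set, on which two distinct words would have to agree. *)
Lemma admissible_diagonal T : admissible T ->
  (forall y s z r, y != z -> entry T y s z r = 0) -> diagA T.
Proof.
move=> kT T0; have [bT TS TA _ TF] := kT.
suff T1 y s r : s != r -> entry T y s y r = 0.
  apply: (diagA_intro bT (admissible_approximable kT)) => u y s.
  apply: (@diag_apply _ _ T (fun p : Y * int => entry T p.1 0 p.1 0) bT) => -[z q] [t p].
  have [[<- <-]|] := eqVneq (z, q) (t, p).
    by rewrite mul1r; exact: (admissible_entry0 _ _ kT).
  rewrite mul0r xpair_eqE negb_and; have [<-|zt _] := eqVneq z t; last first.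
    by apply: T0; rewrite eq_sym.
  by move=> /= qp; apply: T1; rewrite eq_sym.
move=> sr; apply: contrapT => /eqP E0.
have c0 : 0 < absC (entry T y s y r).
  rewrite lt_def absC_ge0 andbT; apply: contra_neqN E0 => /eqP; exact: absC_eq0.
(* The three thirds of c pay for passing from the entry to phi at x, for the variation of phi, and
   for returning to an entry nearby. An S within c/3 of T still has a nonzero entry here, which
   provides the words j and l. *)
set c := absC _ in c0; have c3 : 0 < c / 3 by rewrite divr_gt0.
have [S [W [bS ST SW]]] := TF _ c3.
have [|j [l [x [_ yj yl srE]]]] := SW y s y r.
  apply: contraTneq c0 => S0; rewrite -leNgt.
  by have := entry_dist y s y r bT bS; rewrite S0 subr0 -/c; lra.
have jl : j <> l by move=> jl; move: sr; rewrite -subr_eq0 srE jl subrr.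
have [phi cphi pp] := TA j l _ c3.
have ET : entry T (wmap j x) (size j)%:Z (wmap l x) (size l)%:Z = entry T y s y r.
  rewrite -yj -yl -(TS (s - (size j)%:Z)); congr entry; lia.
have phix : c - c / 3 <= absC (phi (val x)).
  have := pp x; rewrite ET; have := absC_lerB (entry T y s y r) (phi (val x)).
  by rewrite -/c; lra.
have nV : nbhs (val x) [set z | c / 3 < absC (phi z)].
  have := continuous_absC_near (cphi (val x)) c3; apply: filterS => z /=.
  by have := absC_lerB (phi (val x)) (phi z); lra.
move: nV; rewrite nbhsE => -[V [oV Vx] VP].
apply: (nowhere_dense_subset oV) (g_free jl); first by exists (val x).
(* Near each z of V there are points t of [XX] in V. The entry over t is nonzero, hence not off the
   diagonal, so the two words agree at t; thus V lies in the closure of their coincidence set. *)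
move=> z Vz B nB.
have [t [[Vt Bt] Xt]] : (V `&` interior B) `&` XX !=set0.
  apply: XX_dense; last by apply: openI => //; exact: open_interior.
  by exists z; split.
exists t; split; last by have := @interior_subset _ B t Bt.
pose t' := toY Xt.
have := VP _ Vt => /= ct; have := pp t' => /= ppt.
have : entry T (wmap j t') (size j)%:Z (wmap l t') (size l)%:Z != 0.
  apply: contraTneq ct => tE0; rewrite -leNgt.
  by move: ppt; rewrite tE0 sub0r absCN.
have [/(congr1 val)|tjl] := eqVneq (wmap j t') (wmap l t').
  by rewrite !val_wmap.
by rewrite T0 ?eqxx.
Qed.

(** Chain pairs along two fixed words are parametrized continuously by the compact space X, so f is
    bounded on them; the bounds for the finitely many pairs of words are added up. *)
Lemma rho_cont_spec m n (f : ({ptws 'I_m.+1 -> X} * {ptws 'I_n.+1 -> X})%type -> C) :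
  {within chain_pairs g m n, continuous f} ->
  bounded_op (@rho R X N g XX m n f) /\ forall z y, @rho R X N g XX m n f (delta R z) y =
    if dec m y is Some (w, x) then
      if dec n z is Some (k, x') then
        (x == x')%:R * f (chain g m w (val x), chain g n k (val x)) else 0
    else 0.
Proof.
move=> cf.
have /choice[M MP] (p : m.-tuple 'I_N * n.-tuple 'I_N) :
    exists M : R, 0 <= M /\ forall x, absC (f (chain g m p.1 x, chain g n p.2 x)) <= M.
  have ck := chain_kernel_continuous g_continuous cf (size_tuple p.1) (size_tuple p.2).
  by have [M M0 fM] := continuous_absC_bounded X_compact ck; exists M.
have S0 : 0 <= \sum_p M p by apply: sumr_ge0 => p _; case: (MP p).
apply: (rho_spec inv disj inj S0) => w k x /eqP sw /eqP sk.
pose p := (Tuple sw, Tuple sk).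
rewrite (bigD1 p) //=; apply: le_trans (proj2 (MP p) x) _; rewrite lerDl.
by apply: sumr_ge0 => q _; case: (MP q).
Qed.

Definition degree_set (k : int) : set (H -> H) :=
  [set T | exists m n : nat, m%:Z - n%:Z = k /\ @Emn R X N g XX m n T].

Lemma degree_set_bop k : degree_set k `<=` @bounded_op R _.
Proof. by move=> _ [m [n [_ [f /= cf <-]]]]; have [] := rho_cont_spec cf. Qed.

(** Tensoring with a shift is linear and contractive, so admissibility pulls back to a closed linear
    condition on operators of l^2(XX), to be tested on the ranges of the maps [rho]. *)
Lemma Bk_admissible k T : @Bk R X N g XX k T -> bounded_op T /\ admissible (op_tens T (ups k)).
Proof.
suff cK : closed_subspace [set T : H -> H | bounded_op T /\ admissible (op_tens T (ups k))].
  move: T; apply: closed_span_min => //.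
  move=> T DT; have bT := degree_set_bop DT; split=> //.
  have [m [n [mn [f /= cf fT]]]] := DT.
  apply: (elementary_admissible g_continuous disj inj g_clopen sigma_cont sigmaK cf).
  split; first exact: bop_tens.
  move=> y s z r; rewrite /entry op_tens_entry // -fT; have [_ ->] := rho_cont_spec cf.
  case: (dec m y) => [[w x]|]; last by rewrite mulr0.
  case: (dec n z) => [[v x']|]; last by rewrite mulr0.
  rewrite mulrA -natrM mulnb andbC mn; congr (_%:R * _); congr nat_of_bool.
  by congr (_ && _); apply/eqP/eqP; lia.
have [_ k0 kc kl] := admissible_closed_subspace R inv; clear T.
split=> [S []//|||].
- split; first exact: bop_zero.
  suff -> : op_tens (0 : H -> H) (ups k) = 0 by [].
  apply/funext => u; apply: ell2P => -[y s]; rewrite op_tensE //; exact: bop_zero.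
- move=> c S T [bS kS] [bT kT]; split; first exact: bop_comb.
  rewrite (op_tens_comb _ _ bS bT); exact: kc _ _ _ kS kT.
- move=> T bT TS; split; first exact: bT.
  apply: kl; first exact: bop_tens.
  move=> e e0; have [S [bS kS] ST] := TS e e0.
  exists (op_tens S (ups k)); first exact: kS.
  rewrite -(op_tens_sub _ bT bS); apply: le_lt_trans ST.
  exact: (opnorm_tens k (bop_sub bT bS)).
Qed.

Lemma rhoA_Dk a : continuous a -> @Dk R X N g XX 0 (@rhoA R X XX a).
Proof.
move=> ca; have [M M0 aM] := continuous_absC_bounded X_compact ca.
have [bA _ AE] := rhoA_spec XX M0 aM; split; last first.
  split=> // x y xy; rewrite ip_delta AE delta_neq ?mulr0 //.
apply: closed_span_sub; exists 0, 0; split=> //.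
pose f (p : {ptws 'I_1 -> X} * {ptws 'I_1 -> X}) := a (p.1 ord0).
have cf : {within chain_pairs g 0 0, continuous f}.
  apply: continuous_subspaceT => p.
  apply: (@continuous_comp _ _ _ (fun p : {ptws 'I_1 -> X} * {ptws 'I_1 -> X} => p.1 ord0) a); last exact: ca.
  apply: (@continuous_comp _ _ _ fst (fun q : {ptws 'I_1 -> X} => q ord0)); first exact: cvg_fst.
  exact: (@proj_continuous _ (fun=> X) ord0).
exists f => //; have [bf fE] := rho_cont_spec cf.
apply: bop_ext => // y; apply: ell2P => z.
rewrite fE !dec0 // AE deltaE /f /chain /= mulrC.
by have [->|_] := eqVneq z y; rewrite ?mulr0.
Qed.

(** An element of D_k tensored with its shift is diagonal over [XX], so [admissible_diagonal] places
    it in [diagA]; for k other than 0 this leaves only zero. *)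
Lemma hatD_eq : hatD R g XX = diagA.
Proof.
have sub : [set T : Hhat -> Hhat | exists k S, @Dk R X N g XX k S /\ T = op_tens S (ups k)]
    `<=` diagA.
  move=> _ [k [S [[BS [bS S0]] ->]]]; have [_ kS] := Bk_admissible BS.
  apply: admissible_diagonal => // y s z r yz.
  by rewrite /entry op_tens_entry // -ip_delta S0 // mulr0.
apply/seteqP; split.
  by apply: closed_span_min => //; exact: diagA_closed.
apply: closed_span_min.
  by apply: closed_span_closed => T /sub; exact: bop_diagA.
move=> _ [a /= ca <-]; apply: closed_span_sub; exists 0, (@rhoA R X XX a).
by split=> //; exact: rhoA_Dk.
Qed.

End DiagonalSubalgebra.

(** * Graph separation implies the Cartan property *)

Section Cartan.
Variables (R : realType) (X : topologicalType) (N : nat) (g : 'I_N -> X -> X) (XX : set X).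
Variable sigma : X -> X.
Hypothesis X_compact : compact [set: X].
Hypothesis X_hausdorff : hausdorff_space X.
Hypothesis g_continuous : forall k, continuous (g k).
Hypothesis XX_dense : dense XX.
Hypothesis inv : completely_invariant g XX.
Hypothesis disj : trivIset setT (fun k => g k @` XX).
Hypothesis inj : forall k, set_inj XX (g k).
Hypothesis g_free : essentially_free g.
Hypothesis g_clopen : forall n, clopen (ifs_iter g n setT).
Hypothesis sigma_cont : {within ifs_image g setT, continuous sigma}.
Hypothesis sigmaK : forall k x, sigma (g k x) = x.
Local Notation Y := (set_type XX).
Local Notation C := (Cx R).
Local Notation H := (ell2 R Y).
Local Notation Hhat := (ell2 R (Y * int)%type).
Local Notation dec := (dec inv).
Local Notation wmap := (wmap inv).
Local Notation hatA := (@hatrhoA R X XX).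
Local Notation hatE := (@hatrhoE R X N g XX).
Local Notation admissible := (@admissible R X N g XX inv).
Local Notation Q := (cstar_hatrho R g XX).
Local Notation P := (@diagA R X XX).
Local Notation vop := (@vop R X N g XX).
Implicit Types (a b c : X -> C).

Let P_closed : closed_subspace P := diagA_closed R XX X_compact.
Let Q_cstar : cstar_subalgebra Q :=
  cstar_hatrho_cstar R X_compact g_continuous inv disj inj g_clopen sigma_cont sigmaK.
Let Q_admissible T : Q T -> admissible T.
Proof.
exact: (cstar_hatrho_admissible X_compact g_continuous inv disj inj g_clopen sigma_cont sigmaK).
Qed.

Lemma diagA_sub : P `<=` Q.
Proof.
apply: closed_span_min; first by case: Q_cstar.
by move=> _ [a /= ca <-]; exact: cstar_hatrho_hatA.
Qed.

Lemma bop_Q T : Q T -> bounded_op T.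
Proof. by move=> /Q_admissible[]. Qed.

Lemma diagA_id : P id.
Proof. by rewrite -(hatA1 R XX X_compact); apply: diagA_hatA; exact: continuous_one. Qed.

Lemma positive_id : positive_op (@id Hhat).
Proof. by move=> u; rewrite ip_hnorm -toC0 toC_le sqr_ge0. Qed.

(** The constant function 1 acts as the identity, so a one-point net suffices. *)
Lemma diagA_approximate_unit : approximate_unit_in Q P.
Proof.
exists unit, (fun _ _ => True), (fun _ => id); split.
- by split=> // _ _; exists tt.
- move=> _; split; [exact: diagA_id|exact: positive_id|].
  by apply: opnorm_le => // u; rewrite mul1r.
- by move=> _ _ _ u; rewrite opB subrr ip0r.
- move=> q d Qq d0; exists tt => _ _.
  by split; rewrite -[X in opnorm X]/(q - q) subrr opnorm0.
Qed.

(** For a equal to 1 at y and 0 at z, the two products have the entry of T and 0 at this place. The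
    case y = z with different degrees is left to [admissible_diagonal]. *)
Lemma commutant_diagonal T : bounded_op T ->
  (forall a, continuous a -> hatA a \o T = T \o hatA a) ->
  forall y s z r, y != z -> entry T y s z r = 0.
Proof.
move=> bT Tcomm y s z r yz.
have xyz : val y != val z by apply: contraNneq yz => /val_inj ->.
have [a [ca ay az _]] := separating_function R X_compact X_hausdorff xyz.
have := congr1 (fun F : Hhat -> Hhat => F (delta R (z, r)) (y, s)) (Tcomm a ca).
rewrite /= (hatAE X_compact _ _ _ ca) ay mul1r.
have -> : hatA a (delta R (z, r)) = 0.
  apply: ell2P => -[t q]; rewrite (hatAE X_compact _ _ _ ca) deltaE.
  by have [[-> _]|_] := eqVneq (t, q) (z, r); rewrite ?az ?mul0r ?mulr0.
by rewrite bop0.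
Qed.

Lemma diagA_maximal_abelian : maximal_abelian Q P.
Proof.
split; first exact: diagA_abelian.
move=> P' cP' aP' PP' P'Q; apply/seteqP; split=> // T P'T.
have kT := Q_admissible (P'Q _ P'T).
apply: (admissible_diagonal X_compact XX_dense g_free kT).
apply: commutant_diagonal; first by case: kT.
by move=> a ca; apply: aP' => //; apply: PP'; exact: diagA_hatA.
Qed.

Section Expectation.

(** Entries are taken at degree 0; by shift invariance they represent all degrees. *)
Definition expectation (T : Hhat -> Hhat) : Hhat -> Hhat :=
  the_op (fun W => forall u y s, W u (y, s) = entry T y 0 y 0 * u (y, s)).

Lemma expectation_spec T : bounded_op T -> [/\ bounded_op (expectation T),
  opnorm (expectation T) <= opnorm T
  & forall u y s, expectation T u (y, s) = entry T y 0 y 0 * u (y, s)].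
Proof.
move=> bT.
have [W [bW WM WE]] := @diag_exists R _ (fun p : Y * int => entry T p.1 0 p.1 0) _
  (opnorm_ge0 bT) (fun p => entry_le_opnorm (p.1, 0) (p.1, 0) bT).
suff -> : expectation T = W by split=> // u y s; rewrite WE.
apply: the_op_eq => // S bS SE.
by apply/funext => u; apply: ell2P => -[y s]; rewrite SE WE.
Qed.

Lemma expectationE T u y s : bounded_op T ->
  expectation T u (y, s) = entry T y 0 y 0 * u (y, s).
Proof. by case/expectation_spec. Qed.

Lemma expectation_diagA T : Q T -> P (expectation T).
Proof.
move=> QT; have kT := Q_admissible QT; have [bT _ _ _ _] := kT.
have [bE _ EE] := expectation_spec bT.
exact: (diagA_intro X_compact bE (admissible_approximable kT) EE).
Qed.

Lemma expectation_diagA_apply T : P T -> forall u y s, T u (y, s) = entry T y 0 y 0 * u (y, s).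
Proof.
exact: (diagA_apply X_compact g_continuous inv disj inj g_clopen sigma_cont sigmaK).
Qed.

(** The diagonal entry of [adj q \o q] at (z, 0) is the squared norm of that column of q; shift
    invariance carries the vanishing to the columns at other degrees. *)
Lemma expectation_faithful q : Q q -> expectation (adj q \o q) = 0 -> q = 0.
Proof.
move=> Qq E0; have kq := Q_admissible Qq; have [bq qS _ _ _] := kq.
have baq : bounded_op (adj q \o q) by apply: bop_comp => //; exact: bop_adj.
apply: bop_ext => //; first exact: bop_zero.
move=> [z r]; rewrite op0.
have : q (delta R (z, 0)) = 0.
  apply: hnorm_eq0; apply/eqP; rewrite -sqrf_eq0; apply/eqP; apply: (@toC_inj R).
  rewrite -ip_hnorm -ip_adjr // ip_delta.
  have := expectationE (delta R (z, 0)) z 0 baq.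
  by rewrite E0 op0 ell2_0 delta_eq mulr1 => E; exact: (esym E).
move=> qz; apply: ell2P => -[y s]; rewrite ell2_0.
rewrite -[LHS]/(entry q y s z r).
have -> : entry q y s z r = entry q y (s - r + r) z (0 + r) by congr entry; lia.
by rewrite qS /entry qz ell2_0.
Qed.

Lemma ge0_toC (z : C) : 0 <= z -> z = toC (complex.Re z) /\ 0 <= complex.Re z.
Proof.
by case: z => a b; rewrite lecE /= => /andP[/eqP -> a0].
Qed.

(* A positive diagonal operator is a square, which avoids any closedness argument
   for the series defining the inner product. *)
Lemma expectation_positive q : Q q -> positive_op q -> positive_op (expectation q).
Proof.
move=> Qq pq; have bq := bop_Q Qq => u.
pose r (p : Y * int) := complex.Re (entry q p.1 0 p.1 0).
have rE p : entry q p.1 0 p.1 0 = toC (r p) /\ 0 <= r p.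
  by apply: ge0_toC; have := pq (delta R (p.1, 0)); rewrite ip_delta.
have rM p : absC (toC (Num.sqrt (r p)) : C) <= Num.sqrt (opnorm q).
  rewrite absC_toC ger0_norm ?sqrtr_ge0 // ler_sqrt ?opnorm_ge0 //.
  have := entry_le_opnorm (p.1, 0) (p.1, 0) bq.
  by rewrite -/(entry q p.1 0 p.1 0) (rE p).1 absC_toC ger0_norm ?(rE p).2.
have [D [bD _ DE]] := diag_exists (sqrtr_ge0 (opnorm q)) rM.
have -> : ip u (expectation q u) = ip (D u) (D u).
  apply: ip_ext => -[y s]; rewrite (expectationE _ _ _ bq) !DE.
  rewrite -[y in entry q y]/((y, s).1) (rE (y, s)).1.
  have [_ r0] := rE (y, s).
  rewrite -{1}(sqr_sqrtr r0) expr2 toCM rmorphM /=.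
  have -> : (toC (Num.sqrt (r (y, s))) : C)^* = toC (Num.sqrt (r (y, s))).
    by apply/CrealP; apply/complex_realP; eexists.
  by ring.
by rewrite ip_hnorm -toC0 toC_le sqr_ge0.
Qed.

Lemma diagA_expectation : faithful_conditional_expectation Q P expectation.
Proof.
have [[Qsub _ Qlin _] Qcomp Qadj] := Q_cstar.
split.
- split.
  + exact: expectation_diagA.
  + move=> p Pp; have bp := bop_Q (diagA_sub Pp).
    apply/funext => u; apply: ell2P => -[y s].
    by rewrite (expectationE _ _ _ bp) (expectation_diagA_apply Pp).
  + move=> a q q' Qq Qq'; have bq := bop_Q Qq; have bq' := bop_Q Qq'.
    apply/funext => u; apply: ell2P => -[y s].
    rewrite (expectationE _ _ _ (bop_comb a bq bq')) opD opZ ell2D ell2Z.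
    by rewrite !expectationE // entry_comb mulrDl mulrA.
- by move=> q Qq; have [] := expectation_spec (bop_Q Qq).
- exact: expectation_positive.
- move=> p q p' Pp Qq Pp'; have bq := bop_Q Qq.
  have bp := bop_Q (diagA_sub Pp); have bp' := bop_Q (diagA_sub Pp').
  have bpqp' := bop_comp (bop_comp bp bq) bp'.
  apply/funext => u; apply: ell2P => -[y s].
  rewrite (expectationE _ _ _ bpqp') [RHS]/= (expectation_diagA_apply Pp) (expectationE _ _ _ bq).
  rewrite (expectation_diagA_apply Pp') {1}/entry [X in X * _]/= (expectation_diagA_apply Pp).
  have -> : p' (delta R (y, 0)) = entry p' y 0 y 0 *: delta R (y, 0).
    apply: ell2P => -[z r]; rewrite (expectation_diagA_apply Pp') ell2Z !deltaE.
    by have [[-> _]|_] := eqVneq (z, r) (y, 0); rewrite ?mulr0.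
  by rewrite bopZ // ell2Z -/(entry q y 0 y 0); ring.
- exact: expectation_faithful.
Qed.

End Expectation.

Lemma closed_image k : closed (g k @` setT).
Proof.
apply: (compact_closed X_hausdorff); apply: continuous_compact => //.
exact: continuous_subspaceT.
Qed.

Section Regular.
Hypothesis sep : graph_separation g.

(** For openness, the image is gamma(X) minus the other images, which are closed. Applying sigma to
    a common point of two images gives one preimage under both branches, against separation. *)
Lemma clopen_image k : clopen (g k @` setT).
Proof.
split; last exact: closed_image.
have [oG _] := g_clopen 1.
have -> : g k @` setT = ifs_iter g 1 setT `&` ~` (\bigcup_(j in [set j | j != k]) (g j @` setT)).
  apply/seteqP; split=> [_ [x _ <-]|x [[j _ [z _ <-]] H]].
    split; first by exists k => //; exists x.
    move=> [j /= jk [z _ gz]]; apply: (sep (x := x) (_ : j <> k)); first exact/eqP.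
    by rewrite -gz; congr (g j _); rewrite -(sigmaK j z) gz sigmaK.
  have [->|jk] := eqVneq j k; first by exists z.
  by exfalso; apply: H; exists j => //; exists z.
apply: openI => //; apply: closed_openC.
by apply: closed_bigcup => [|j _]; [exact: finite_finset|exact: closed_image].
Qed.

Definition indic_image k (x : X) : C := if pselect ((g k @` setT) x) then 1 else 0.

Lemma indic_image_continuous k : continuous (indic_image k).
Proof.
apply: (clopen_cutoff_continuous (clopen_image k)) => x _; exact: cvg_cst.
Qed.

Lemma indic_image_gY j k (x : Y) : indic_image k (val (gY inv j x)) = (j == k)%:R.
Proof.
rewrite /indic_image; have [->|jk] := eqVneq j k.
  by case: pselect => [Gx|[]]; [rewrite mulr1n|exists (val x)].
case: pselect => [Gx|Gx]; last by rewrite mulr0n.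
have [z _ gz] := Gx; exfalso; apply: (@sep j k (val x) (elimN eqP jk)).
rewrite -[LHS]/(val (gY inv j x)) -gz; congr (g k _).
by rewrite -(sigmaK k z) gz val_gY sigmaK.
Qed.

(** The isometry that sends the basis vector at x to the one at [g k x], one degree up, like a
    generator of a Cuntz algebra. *)
Definition branch_op (k : 'I_N) : Hhat -> Hhat := hatA (indic_image k) \o vop.

Let vE (u : Hhat) (y : Y) (s : int) := vopE X_compact g_continuous inv disj inj u y s.

Lemma branch_opE k u y s : branch_op k u (y, s) =
  if dec 1 y is Some (w, x) then (w == [:: k])%:R * u (x, s - 1) else 0.
Proof.
rewrite /branch_op /= (hatAE X_compact _ _ _ (indic_image_continuous (k := k))) vE.
case yE : (dec 1 y) => [[w x]|]; last by rewrite mulr0.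
have [] := dec_some yE; case: w yE => [|j [|]] //= _ _ ->.
by rewrite indic_image_gY eqseq_cons andbT.
Qed.

Lemma dec1_gY k (x : Y) : dec 1 (gY inv k x) = Some ([:: k], x).
Proof. exact: (dec_wmap inv disj inj (w := [:: k])). Qed.

Lemma branch_op_gY j k u (x : Y) s :
  branch_op k u (gY inv j x, s) = (j == k)%:R * u (x, s - 1).
Proof. by rewrite branch_opE dec1_gY eqseq_cons andbT. Qed.

Lemma bop_branch_op k : bounded_op (branch_op k).
Proof.
apply: bop_comp; last exact: (bop_vop R X_compact g_continuous inv disj inj).
exact: (bop_hatA XX X_compact (indic_image_continuous (k := k))).
Qed.

Lemma branch_op_in k : Q (branch_op k).
Proof.
have [_ Qcomp _] := Q_cstar; apply: Qcomp.
  apply: cstar_hatrho_hatA; exact: indic_image_continuous.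
apply: cstar_hatrho_hatE; exact: one_within.
Qed.

Lemma branch_op_delta k (x : Y) (s : int) :
  branch_op k (delta R (x, s)) = delta R (gY inv k x, s + 1).
Proof.
apply: ell2P => -[y r]; rewrite branch_opE.
case yE : (dec 1 y) => [[w z]|]; last first.
  rewrite delta_neq // xpair_eqE negb_and; apply/orP; left.
  by apply: contra_eqN yE => /eqP ->; rewrite dec1_gY.
have [] := dec_some yE; case: w yE => [|j [|]] //= _ _ ->.
rewrite eqseq_cons andbT !deltaE -natrM mulnb !xpair_eqE; congr (_%:R); congr nat_of_bool.
rewrite andbA; congr (_ && _).
  apply/andP/eqP => [[/eqP -> /eqP ->//]|/(gY_inj disj inj)[-> ->]].
  by rewrite !eqxx.
by apply/eqP/eqP; lia.
Qed.

Lemma branch_op_adjE k u x s : adj (branch_op k) u (x, s) = u (gY inv k x, s + 1).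
Proof. by rewrite -ip_delta ip_adjr ?branch_op_delta ?ip_delta //; exact: bop_branch_op. Qed.

Let extE a := pullback_continuous g_clopen sigma_cont sigmaK (m := 1) (a := a).

Lemma branch_op_conj k a : continuous a -> branch_op k \o hatA a \o adj (branch_op k) =
  hatA (fun x => indic_image k x * pullback g sigma 1 a x).
Proof.
move=> ca; have cE := extE ca.
have cI := continuousM2 (indic_image_continuous (k := k)) cE.
apply/funext => u; apply: ell2P => -[y s]; rewrite (hatAE X_compact _ _ _ cI).
rewrite [LHS]/= branch_opE; case yE : (dec 1 y) => [[w x]|]; last first.
  rewrite /pullback; case: pselect => /= Gy; last by rewrite mulr0 mul0r.
  by have [w [x]] := (dec_iter inv disj inj 1 y).1 Gy; rewrite yE.
have [] := dec_some yE; case: w yE => [|j [|]] //= yE _ yE'.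
rewrite (hatAE X_compact _ _ _ ca) branch_op_adjE subrK {1}yE' indic_image_gY eqseq_cons andbT.
have [<-|_] := eqVneq j k; last by rewrite !mul0r.
rewrite !mul1r -yE'; congr (_ * _); rewrite /pullback; case: pselect => [Gy|[]].
  by rewrite /= yE' val_gY sigmaK.
by apply/(dec_iter inv disj inj); exists [:: j], x.
Qed.

Lemma branch_op_conj_adj k a : continuous a -> adj (branch_op k) \o hatA a \o branch_op k =
  hatA (fun x => a (g k x)).
Proof.
move=> ca; have cak : continuous (fun x => a (g k x)).
  by move=> x; apply: continuous_comp; [exact: g_continuous|exact: ca].
apply/funext => u; apply: ell2P => -[x s]; rewrite (hatAE X_compact _ _ _ cak).
by rewrite [LHS]/= branch_op_adjE (hatAE X_compact _ _ _ ca) branch_op_gY eqxx mul1r addrK.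
Qed.

(** Reduces the normalizer condition to the generators [hatA a] of the closed span. *)
Lemma conj_diagA S T : bounded_op S -> bounded_op T ->
  (forall a, continuous a -> P (S \o hatA a \o T)) ->
  forall p, P p -> P (S \o p \o T).
Proof.
move=> bS bT HP p Pp.
have c1 := closed_subspace_compl (closed_subspace_compr P_closed bT) bS.
suff [_ [_]] : [set p | bounded_op p /\ [set p | bounded_op p /\ P (p \o T)] (S \o p)] p by [].
move: p Pp; apply: closed_span_min; first exact: c1.
move=> _ [a /= ca <-]; have bA := bop_hatA XX X_compact ca.
by split=> //; split; [exact: bop_comp|exact: HP].
Qed.

Lemma branch_op_normalizer k : normalizer Q P (branch_op k).
Proof.
have bI := bop_branch_op k; have baI := bop_adj bI; split.
- exact: branch_op_in.
- apply: conj_diagA => // a ca; rewrite branch_op_conj //; apply: diagA_hatA.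
  exact: (continuousM2 (indic_image_continuous (k := k)) (extE ca)).
- apply: conj_diagA => // a ca; rewrite branch_op_conj_adj //.
  apply: (@diagA_hatA R X XX (fun x => a (g k x))).
  by move=> x; apply: continuous_comp; [exact: g_continuous|exact: ca].
Qed.

Lemma hatA_normalizer a : continuous a -> normalizer Q P (hatA a).
Proof.
move=> ca; have [_ Pcomp Padj] := diagA_cstar R XX X_compact.
have PA : P (hatA a) by exact: diagA_hatA.
split; first exact: cstar_hatrho_hatA.
- by move=> p Pp; apply: Pcomp (Pcomp _ _ PA Pp) (Padj _ PA).
- by move=> p Pp; apply: Pcomp (Pcomp _ _ (Padj _ PA) Pp) PA.
Qed.

Lemma hatE_branch_op (f : X * X -> C) : {within ifs_graph g, continuous f} ->
  hatE f = \sum_k (branch_op k \o hatA (fun x => f (g k x, x))).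
Proof.
move=> cf.
have cfk k : continuous (fun x => f (g k x, x)) by exact: (branch_kernel_continuous g_continuous cf).
have [_ fE] := hatE_spec X_compact g_continuous inv disj inj cf.
apply/funext => u; apply: ell2P => -[y s]; rewrite fE op_sum ell2_sum.
case yE : (dec 1 y) => [[w x]|]; last first.
  by rewrite big1 // => k _; rewrite /= branch_opE yE.
have [] := dec_some yE; case: w yE => [|j [|]] //= yE _ yE'.
rewrite (bigD1 j) //= big1 ?addr0 => [|k kj].
  rewrite [in RHS]yE' branch_op_gY eqxx mul1r (hatAE X_compact _ _ _ (cfk j)).
  by rewrite yE' val_gY.
by rewrite yE' branch_op_gY eq_sym (negPf kj) mul0r.
Qed.

Lemma normalizer_bop : normalizer Q P `<=` @bounded_op R _.
Proof. by move=> b [Qb _ _]; exact: bop_Q. Qed.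

Lemma diagA_regular : cstar_generated (normalizer Q P) = Q.
Proof.
have cN := cstar_generated_cstar normalizer_bop.
have [cNs cNc cNa] := cN.
apply/seteqP; split.
  by apply: cstar_generated_min => // b [].
apply: cstar_generated_min => // T [[a /= ca <-]|[f /= cf <-]].
  by apply: cstar_generated_sub; exact: hatA_normalizer.
have cfk k : continuous (fun x => f (g k x, x)) by exact: (branch_kernel_continuous g_continuous cf).
rewrite (hatE_branch_op cf); apply: (closed_subspace_sum _ cNs) => k; apply: cNc.
  by apply: cstar_generated_sub; exact: branch_op_normalizer.
by apply: cstar_generated_sub; exact: (hatA_normalizer (cfk k)).
Qed.

Lemma diagA_cartan : cartan_subalgebra Q P.
Proof.
split.
- by split; [exact: diagA_cstar|exact: diagA_abelian|exact: diagA_sub].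
- exact: diagA_approximate_unit.
- exact: diagA_maximal_abelian.
- exact: diagA_regular.
- by exists expectation; exact: diagA_expectation.
Qed.

End Regular.

End Cartan.

(** * Regularity implies graph separation *)

(** The finite case of the Baire property: V loses one closed set at a time and stays nonempty, as
    no [B j] contains a nonempty open set. *)
Lemma avoid_nowhere_dense (X : topologicalType) (J : eqType) (s : seq J) (B : J -> set X)
    (V : set X) : (forall j, j \in s -> closed (B j)) ->
  (forall j O, j \in s -> open O -> O !=set0 -> ~ (O `<=` B j)) ->
  open V -> V !=set0 ->
  exists O, [/\ open O, O !=set0, O `<=` V & forall j x, j \in s -> O x -> ~ B j x].
Proof.
elim: s V => [|j s IH] V cB nB oV V0; first by exists V; split.
have [x [Vx Bx]] : exists x, V x /\ ~ B j x.
  apply: contrapT => H; apply: (nB j V (mem_head _ _) oV V0) => x Vx.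
  by apply: contrapT => Bx; apply: H; exists x.
have oVB : open (V `&` ~` B j).
  by apply: openI => //; apply: closed_openC; apply: cB; exact: mem_head.
have [||||O [oO O0 OV OB]] := IH (V `&` ~` B j).
- by move=> i si; apply: cB; rewrite inE si orbT.
- by move=> i O si; apply: nB; rewrite inE si orbT.
- exact: oVB.
- by exists x.
exists O; split=> // [t /OV[]//|i t]; rewrite inE => /orP[/eqP -> /OV[]//|]; exact: OB.
Qed.

Section Regularity.
Variables (R : realType) (X : topologicalType) (N : nat) (g : 'I_N -> X -> X) (XX : set X).
Variable sigma : X -> X.
Hypothesis X_compact : compact [set: X].
Hypothesis X_hausdorff : hausdorff_space X.
Hypothesis g_continuous : forall k, continuous (g k).
Hypothesis XX_dense : dense XX.
Hypothesis inv : completely_invariant g XX.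
Hypothesis disj : trivIset setT (fun k => g k @` XX).
Hypothesis inj : forall k, set_inj XX (g k).
Hypothesis g_free : essentially_free g.
Hypothesis g_clopen : forall n, clopen (ifs_iter g n setT).
Hypothesis sigma_cont : {within ifs_image g setT, continuous sigma}.
Hypothesis sigmaK : forall k x, sigma (g k x) = x.
Local Notation Y := (set_type XX).
Local Notation C := (Cx R).
Local Notation Hhat := (ell2 R (Y * int)%type).
Local Notation dec := (dec inv).
Local Notation wmap := (wmap inv).
Local Notation hatA := (@hatrhoA R X XX).
Local Notation admissible := (@admissible R X N g XX inv).
Local Notation Q := (cstar_hatrho R g XX).
Local Notation P := (@diagA R X XX).
Local Notation vop := (@vop R X N g XX).
Implicit Types (a b c : X -> C).

Let Q_cstar : cstar_subalgebra Q :=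
  cstar_hatrho_cstar R X_compact g_continuous inv disj inj g_clopen sigma_cont sigmaK.
Let Q_admissible T : Q T -> admissible T.
Proof.
exact: (cstar_hatrho_admissible X_compact g_continuous inv disj inj g_clopen sigma_cont sigmaK).
Qed.

(** A product of Urysohn functions; the bound by 1 controls the error made with it in
    [atom_vanishes]. *)
Lemma separating_product (x : Y) (s : seq Y) : exists a,
  [/\ continuous a, a (val x) = 1, forall y, absC (a y) <= 1 &
    forall z, z \in s -> z != x -> a (val z) = 0].
Proof.
elim: s => [|z s [a [ca ax a1 az]]].
  exists (fun=> 1); split=> [|//|y|//]; [exact: continuous_one|by rewrite absC1].
have [->|zx] := eqVneq z x.
  exists a; split=> // t; rewrite inE => /orP[/eqP ->|]; first by rewrite eqxx.
  exact: az.
have xz : val x != val z by apply: contraNneq zx => /val_inj ->.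
have [b [cb bx bz b1]] := separating_function R X_compact X_hausdorff xz.
exists (fun y => a y * b y); split.
- exact: continuousM2.
- by rewrite ax bx mulr1.
- by move=> y; rewrite absCM; apply: mulr_ile1; rewrite ?absC_ge0.
- move=> t; rewrite inE => /orP[/eqP -> _|ts tx]; first by rewrite bz mulr0.
  by rewrite az ?mul0r.
Qed.

(* If every [hatA a w'] is orthogonal to [w], the atomic complex measure
   [sum_z <w, 1_z w'> delta_z] annihilates C(X), so each of its atoms vanishes. *)
Lemma atom_vanishes (w w' v : Hhat) (x : Y) :
  (forall a, continuous a -> ip w (hatA a w') = 0) ->
  (forall z s, v (z, s) = (z == x)%:R * w' (z, s)) -> ip w v = 0.
Proof.
move=> H vE; apply/absC_eq0/eqP; rewrite eq_le absC_ge0 andbT.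
apply: (le0_small (hnorm_ge0 w)) => e e0.
have [F wF] := trunc_approx w' e0.
have [a [ca ax a1 az]] := separating_product x [seq p.1 | p <- F].
(* c is the indicator of x minus a. It vanishes on F and is bounded by 1, so replacing v by
   [hatA a w'] costs at most the tail of w' off F. *)
pose c (p : Y * int) : C := (p.1 == x)%:R - a (val p.1).
have c1 p : absC (c p) <= 1.
  rewrite /c; have [->|_] := eqVneq p.1 x; first by rewrite ax subrr absC0.
  by rewrite sub0r absCN.
have [D [bD D1 DE]] := diag_exists ler01 c1.
have vD : v - hatA a w' = D (w' - trunc F w').
  apply: ell2P => -[z s]; rewrite ell2B vE (hatAE X_compact _ _ _ ca) DE ell2B truncE /c /=.
  case: ifP => zF; last by rewrite subr0 mulrBl.
  have [->|zx] := eqVneq z x; first by rewrite ax !(mul1r, subrr, mul0r).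
  by rewrite (az z) // ?(subrr, mul0r) //; apply/mapP; exists (z, s).
have -> : ip w v = ip w (D (w' - trunc F w')) by rewrite -vD ipBr H // subr0.
apply: le_trans (cauchy_schwarz _ _) _; apply: ler_wpM2l; first exact: hnorm_ge0.
apply: le_trans (opnormP _ bD) _; apply: le_trans (ltW wF).
by rewrite -[leRHS]mul1r; apply: ler_wpM2r => //; exact: hnorm_ge0.
Qed.

Lemma diagA_entry_offdiag T : P T -> forall y s z r, y != z -> entry T y s z r = 0.
Proof.
move=> PT y s z r yz; apply: (diagA_offdiag X_compact PT).
by rewrite xpair_eqE negb_and yz.
Qed.

(** The vectors [adj b (delta R _)] are the conjugated rows of b, and their inner product weighted
    by a is an off-diagonal entry of [b \o hatA a \o adj b], which lies in P. *)
Lemma normalizer_orthogonal (b : Hhat -> Hhat) a y s z r : normalizer Q P b -> continuous a -> y != z ->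
  ip (adj b (delta R (y, s))) (hatA a (adj b (delta R (z, r)))) = 0.
Proof.
move=> [Qb bP _] ca yz; have [bb _ _ _ _] := Q_admissible Qb.
rewrite ip_adjl // ip_delta.
by apply: (diagA_entry_offdiag (bP _ (diagA_hatA ca))).
Qed.

(** For p = (j, l), these contain the points x = g_l t for which g_k x = g_j t, that is, where the
    pair (j, l) can link the row at g_k x to the fibre of x. The closure makes the set closed. *)
Definition bad_set (k : 'I_N) (p : seq 'I_N * seq 'I_N) : set X :=
  word_map g p.2 @` closure [set t | word_map g (k :: p.2) t = word_map g p.1 t].

Lemma bad_set_closed k p : closed (bad_set k p).
Proof.
apply: (compact_closed X_hausdorff); apply: continuous_compact.
  by apply: continuous_subspaceT; exact: word_map_continuous.
apply: (subclosed_compact _ X_compact) => //; exact: closed_closure.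
Qed.

(** Word maps are injective because of sigma, so an open subset would pull back to an open subset of
    the closure of the coincidence set of two distinct words. *)
Lemma bad_set_meagre k p O : p.1 != k :: p.2 -> open O -> O !=set0 -> ~ (O `<=` bad_set k p).
Proof.
move=> pk oO [y Oy] OB.
have pk' : k :: p.2 <> p.1 by move=> E; move: pk; rewrite E eqxx.
have [t _ ty] := OB _ Oy.
have oP : open (word_map g p.2 @^-1` O).
  by apply: open_comp => // z _; exact: word_map_continuous.
apply: (nowhere_dense_subset oP) (g_free pk'); first by exists t; rewrite /= ty.
move=> z /= Oz; have [z' cz' zz'] := OB _ Oz.
by rewrite -(word_map_injective sigmaK zz').
Qed.

Section CollidingBranches.
Variables (j k : 'I_N) (x0 : X).
Hypotheses (jk : j <> k) (gjk : g j x0 = g k x0).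

(** The vanishing of a product of two entries is not a linear condition; that the entry along j
    tends to 0 at x0 is linear and closed, so it passes to the closed span. *)
Definition vanishing : set (Hhat -> Hhat) := [set b | bounded_op b /\
  forall e : R, 0 < e -> exists V, [/\ open V, V x0 &
    forall x : Y, V (val x) -> absC (entry b (gY inv j x) 1 x 0) <= e]].

Lemma vanishing_closed : closed_subspace vanishing.
Proof.
split=> [T []//|||].
- split; first exact: bop_zero.
  by move=> e e0; exists setT; split=> // [|x _]; [exact: openT|rewrite entry0 absC0 ltW].
- move=> a S T [bS ZS] [bT ZT]; split; first exact: bop_comb.
  move=> e e0; have a1 : 0 < absC a + 1 by rewrite ltr_wpDl ?absC_ge0.
  have [V [oV Vx VS]] := ZS _ (divr_gt0 (divr_gt0 e0 a1) (ltr0n R 2)).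
  have [W [oW Wx WT]] := ZT _ (divr_gt0 e0 (ltr0n R 2)).
  exists (V `&` W); split=> // [|x [Vx' Wx']]; first exact: openI.
  have h1 := VS _ Vx'; have h2 := WT _ Wx'.
  rewrite entry_comb; rewrite -[entry S _ _ _ _]subr0 in h1; rewrite -[entry T _ _ _ _]subr0 in h2.
  by have := absC_comb_le e0 h1 h2; rewrite mulr0 addr0 subr0.
- move=> T bT TS; split=> // e e0; have e2 := divr_gt0 e0 (ltr0n R 2).
  have [S [bS ZS] ST] := TS _ e2; have [V [oV Vx VS]] := ZS _ e2.
  exists V; split=> // x Vx'; have := VS _ Vx'.
  have := entry_dist (gY inv j x) 1 x 0 bT bS.
  by have := absC_lerB (entry T (gY inv j x) 1 x 0) (entry S (gY inv j x) 1 x 0); lra.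
Qed.

(* Off finitely many nowhere dense sets, the row of [b] at [gY k x] meets the
   fibre of [x] only in degree 1, up to [e]; the orthogonality of the rows at
   [gY j x] and [gY k x] over that fibre then bounds the product. *)
Lemma normalizer_product (b : Hhat -> Hhat) (e : R) (V : set X) : 0 < e ->
  normalizer Q P b -> open V -> V !=set0 -> exists x : Y, V (val x) /\
  absC (entry b (gY inv j x) 1 x 0) * absC (entry b (gY inv k x) 1 x 0) <= opnorm b * e.
Proof.
move=> e0 Nb oV V0; have [Qb _ _] := Nb; have [bb _ _ _ bF] := Q_admissible Qb.
have [S [W [bS bSe SW]]] := bF _ e0.
(* Pairs (k :: l, l) are left out: their coincidence set is everything, but their lengths differ by
   one, so they only give entries at height 0 of the fibre. *)
pose W' := [seq p <- W | p.1 != k :: p.2].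
have [||O [oO O0 OV OB]] := avoid_nowhere_dense (s := W') (B := bad_set k) _ _ oV V0.
- by move=> p _; exact: bad_set_closed.
- by move=> p O; rewrite mem_filter => /andP[pk _]; exact: bad_set_meagre.
have [t [Ot Xt]] := XX_dense O0 oO.
pose x := toY Xt; exists x; split; first exact: OV.
have S0 s : s != 0 -> entry S (gY inv k x) 1 x s = 0.
  move=> s0; apply/eqP; apply: contraT => /SW [j' [l' [x1 [jlW yE xE sE]]]]; exfalso.
  have jk' : j' != k :: l'.
    by apply: contraNneq s0 => E; move: sE; rewrite E /=; lia.
  apply: (OB (j', l') t _ Ot); first by rewrite mem_filter jk'.
  exists (val x1); last by rewrite -val_wmap -xE.
  apply: subset_closure => /=; rewrite -!val_wmap -yE.
  by rewrite -[RHS]/(g k (val x)) xE val_wmap.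
set w := adj b (delta R (gY inv j x, 1)); set w' := adj b (delta R (gY inv k x, 1)).
pose cx (p : Y * int) : C := (p.1 == x)%:R.
have cx1 p : absC (cx p) <= 1 by rewrite /cx; case: eqP; rewrite ?absC1 ?absC0.
have [Dx [_ _ DxE]] := diag_exists ler01 cx1.
pose cr (p : Y * int) : C := ((p.1 == x) && (p.2 != 0))%:R.
have cr1 p : absC (cr p) <= 1 by rewrite /cr; case: andP; rewrite ?absC1 ?absC0.
have [Dr [bDr Dr1 DrE]] := diag_exists ler01 cr1.
have wv : ip w (Dx w') = 0.
  apply: (@atom_vanishes w w' _ x) => [a ca|z s]; last exact: DxE.
  apply: (normalizer_orthogonal _ _ Nb ca).
  by apply/eqP => /(gY_inj disj inj)[].
have bbS := bop_sub bb bS.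
pose rest := Dr (adj (b - S) (delta R (gY inv k x, 1))).
(* Over x, the row w' is its coordinate at height 0 plus a remainder. S has no entries at the other
   heights, so the remainder only sees b - S and has norm at most e. *)
have DxEr : Dx w' = w' (x, 0) *: delta R (x, 0) + rest.
  apply: ell2P => -[z s]; rewrite DxE ell2D ell2Z deltaE /rest DrE /cx /cr /=.
  rewrite xpair_eqE; have [->|zx] := eqVneq z x; last by rewrite !(mul0r, mulr0) addr0.
  have [->|s0] := eqVneq s 0; first by rewrite mul1r mul0r addr0 mulr1.
  rewrite mulr0 add0r !mul1r adj_sub // opB ell2B [X in _ - X]adj_entry //.
  by rewrite -/(entry S (gY inv k x) 1 x s) S0 // conjC0 subr0.
have restn : hnorm rest <= e.
  apply: le_trans (opnormP _ bDr) _; apply: le_trans bSe.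
  rewrite -[leRHS]mul1r; apply: ler_pM => //; [exact: opnorm_ge0|exact: hnorm_ge0|].
  by apply: le_trans (hnorm_adj _ bbS) _; rewrite hnorm_delta mulr1.
have wx : absC (w (x, 0)) = absC (entry b (gY inv j x) 1 x 0).
  by rewrite /w adj_entry // absC_conj.
have wx' : absC (w' (x, 0)) = absC (entry b (gY inv k x) 1 x 0).
  by rewrite /w' adj_entry // absC_conj.
move: wv; rewrite DxEr ipDr ipZr (ip_conj (delta R (x, 0)) w) ip_delta => /eqP.
rewrite addr_eq0 => /eqP /(congr1 (@absC R)).
rewrite absCM absC_conj absCN wx wx' mulrC => ->.
apply: le_trans (cauchy_schwarz _ _) _; apply: ler_pM => //; try exact: hnorm_ge0.
by apply: le_trans (hnorm_adj _ bb) _; rewrite hnorm_delta mulr1.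
Qed.

Lemma normalizer_vanishing : normalizer Q P `<=` vanishing.
Proof.
move=> b Nb; have [Qb _ _] := Nb; have [bb _ _ bL _] := Q_admissible Qb; split=> // n n0.
have M0 := opnorm_ge0 bb; have M1 : 0 < opnorm b + 1 by rewrite ltr_wpDl.
(* If the modulus of phi at x0 exceeds n/2, two errors of at most n/8 leave both entries at least
   n/4, with product at least n^2/16, while [normalizer_product] and the second bound on e allow at
   most n^2/32. Otherwise the entry near x0 is at most n/2 + 2e, below n. The summand 1 covers b =
   0. *)
pose e := Num.min (n / 8) (n ^+ 2 / (32 * (opnorm b + 1))).
have e0 : 0 < e.
  by rewrite /e lt_min !divr_gt0 ?exprn_gt0 ?mulr_gt0.
have e8 : e <= n / 8 by rewrite /e ge_min lexx.
have eM : e * (32 * (opnorm b + 1)) <= n ^+ 2.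
  by rewrite -ler_pdivlMr ?mulr_gt0 // /e ge_min lexx orbT.
have [phi [phi' [cp cp' pp H]]] := bL _ _ _ gjk _ e0.
have n1 := continuous_absC_near (cp x0) e0.
have n2 := continuous_absC_near (cp' x0) e0.
have nn : nbhs x0 ([set z | absC (phi x0 - phi z) < e] `&`
    [set z | absC (phi' x0 - phi' z) < e]) by exact: filterI.
move: nn; rewrite nbhsE => -[V [oV Vx] VP].
have c2 : absC (phi x0) <= n / 2.
  rewrite leNgt; apply/negP => c2.
  have V0 : V !=set0 by exists x0.
  have [x [Vx' prod]] := normalizer_product e0 Nb oV V0.
  have [h1 h2] := VP _ Vx'; have [k1 k2] := H x.
  have l1 : n / 4 <= absC (entry b (gY inv j x) 1 x 0).
    have := absC_lerB (phi x0) (phi (val x)).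
    have := absC_lerB (phi (val x)) (entry b (gY inv j x) 1 x 0).
    rewrite (absC_dist (phi (val x))); move: h1 k1 => /=; lra.
  have l2 : n / 4 <= absC (entry b (gY inv k x) 1 x 0).
    have := absC_lerB (phi' x0) (phi' (val x)).
    have := absC_lerB (phi' (val x)) (entry b (gY inv k x) 1 x 0).
    rewrite (absC_dist (phi' (val x))); move: h2 k2 => /=; rewrite -pp; lra.
  have n4 : 0 <= n / 4 by lra.
  have := le_trans (ler_pM n4 n4 l1 l2) prod.
  have n20 : 0 < n ^+ 2 by rewrite exprn_gt0.
  by move: eM n20 e0; rewrite expr2; nra.
exists V; split=> // x Vx'; have [h1 _] := VP _ Vx'; have [k1 _] := H x.
have := absC_lerB (entry b (gY inv j x) 1 x 0) (phi (val x)).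
have := absC_lerB (phi (val x)) (phi x0); rewrite (absC_dist (phi (val x)) (phi x0)).
by move: h1 => /=; lra.
Qed.

(** Normalizers are stable under composition and adjoints, so the C*-algebra they generate lies in
    their closed span, where a closed linear condition such as [vanishing] can be tested. *)
Lemma normalizer_span_cstar : cstar_subalgebra (closed_span (normalizer Q P)).
Proof.
have [_ Qcomp Qadj] := Q_cstar.
apply: cstar_closed_span.
- by move=> b [Qb _ _]; case: (Q_admissible Qb).
- move=> S T [QS SP SP'] [QT TP TP']; apply: closed_span_sub.
  have [bS _ _ _ _] := Q_admissible QS; have [bT _ _ _ _] := Q_admissible QT.
  split; first exact: Qcomp.
    by move=> p Pp; rewrite adj_comp //; exact: (SP _ (TP _ Pp)).
  by move=> p Pp; rewrite adj_comp //; exact: (TP' _ (SP' _ Pp)).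
- move=> T [QT TP TP']; apply: closed_span_sub.
  have [bT _ _ _ _] := Q_admissible QT.
  by split; [exact: Qadj|move=> p Pp; rewrite adjK //; exact: TP'|
    move=> p Pp; rewrite adjK //; exact: TP].
Qed.

Lemma colliding_not_regular : cstar_generated (normalizer Q P) <> Q.
Proof.
move=> NQ.
have Qv : Q vop by apply: cstar_hatrho_hatE; exact: one_within.
have : vanishing vop.
  apply: (closed_span_min vanishing_closed normalizer_vanishing).
  have Nv : cstar_generated (normalizer Q P) vop by rewrite NQ.
  exact: (cstar_generated_min normalizer_span_cstar (@closed_span_sub _ _ _) Nv).
(* Along j the entry of [vop] is 1 over every point of [XX], so the tolerance 1/2 already fails near
   x0. *)
move=> [_ /(_ (2^-1))[|V [oV Vx VE]]]; first by rewrite invr_gt0.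
have [t [Vt Xt]] : V `&` XX !=set0 by apply: XX_dense => //; exists x0.
have := VE (toY Xt) Vt.
rewrite /entry (vopE X_compact g_continuous inv disj inj).
rewrite (dec_wmap inv disj inj (w := [:: j])) //.
rewrite deltaE xpair_eqE eqxx subrr eqxx absC1.
by lra.
Qed.

End CollidingBranches.

Lemma regular_graph_separation : cstar_generated (normalizer Q P) = Q -> graph_separation g.
Proof. by move=> NQ j k x jk gjk; exact: (colliding_not_regular jk gjk NQ). Qed.

End Regularity.

Theorem theorem1p2p10 (R : realType) (X : topologicalType) (N : nat)
    (g : 'I_N -> X -> X) (XX : set X)
    (X_first_countable : first_countable X)
    (X_compact : compact [set: X])
    (X_hausdorff : hausdorff_space X)
    (g_continuous : forall k, continuous (g k))
    (XX_dense : dense XX)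
    (XX_invariant : completely_invariant g XX)
    (XX_images_disjoint : trivIset setT (fun k => g k @` XX))
    (XX_injective : forall k, set_inj XX (g k))
    (g_embedding : forall k, embedding (g k))
    (U_exists : exists U : set X,
       [/\ dense U /\ open U,
           trivIset setT (fun k => g k @` U),
           forall k, open (g k @` U) /\ g k @` U `<=` U
         & XX `<=` U])
    (XX_comeager : comeager XX)
    (g_essentially_free : essentially_free g)
    (g_clopen : forall n, clopen (ifs_iter g n setT))
    (sigma_exists : exists sigma : X -> X,
       {within ifs_image g setT, continuous sigma} /\
       forall k x, sigma (g k x) = x) :
  graph_separation g <-> cartan_subalgebra (cstar_hatrho R g XX) (hatD R g XX).
Proof.
have [sigma [sigma_cont sigmaK]] := sigma_exists.
rewrite (hatD_eq R X_compact g_continuous XX_dense XX_invariant XX_images_disjoint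
  XX_injective g_essentially_free g_clopen sigma_cont sigmaK).
split=> [sep|[_ _ _ regular _]].
  exact: (diagA_cartan R X_compact X_hausdorff g_continuous XX_dense XX_invariant
    XX_images_disjoint XX_injective g_essentially_free g_clopen sigma_cont sigmaK sep).
exact: (regular_graph_separation X_compact X_hausdorff g_continuous XX_dense
  XX_invariant XX_images_disjoint XX_injective g_essentially_free g_clopen
  sigma_cont sigmaK regular).
Qed.
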